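(* Let $p(t)=\sum_{k=0}^m c_k e^{\lambda_k t}$ be an exponential polynomial, where $c_k,\lambda_k\in\mathbb{C}$. Let $B\subset\mathbb{R}$ be an interval, let $D=D(p,B)$ be the diagram of $p$ on $B$, and let $\Omega\subset B$ be any set. Then $$\sup_{B}|p|\le e^{\mu_1(B)\cdot\max_k|\operatorname{Re}\lambda_k|}\cdot\left(\frac{c\,\mu_1(B)}{\omega_D(\Omega)}\right)^{m}\cdot\sup_{\Omega}|p|,$$ where $c>0$ is an absolute constant.
   Context: $\mu_1$ is the Lebesgue measure on $\mathbb{R}$. For an exponential polynomial $p(t)=\sum_{k=0}^m c_k e^{\lambda_k t}$ with $c_k,\lambda_k\in\mathbb{C}$ and an interval $B\subset\mathbb{R}$, the diagram $D=D(p,B)=(m,\lambda,l)$ comprises the degree $m$ of $p$, the maximal frequency $\lambda=\max_{k=0,\dots,m}|\operatorname{Im}\lambda_k|$, and the length $l=\mu_1(B)$. Let $d=d(m,\lambda,l)$ be the maximal number of solutions of $|p|=\rho$, $\rho\in\mathbb{R}$, on an interval of length $l$, for a complex exponential polynomial $p$ of degree $m$ and of maximal frequency $\lambda$ (the maximum being over all such $p$ and $\rho$). The frequency bound is $M_D=\lfloor d/2\rfloor+1$. For any bounded subset $\Omega\subset\mathbb{R}$ and $\varepsilon>0$, $M(\varepsilon,\Omega)$ is the minimal number of $\varepsilon$-intervals (intervals of length $\varepsilon$) covering $\Omega$. The metric span of $\Omega$ is $$\omega_D(\Omega)=\sup_{\varepsilon>0}\varepsilon\,[M(\varepsilon,\Omega)-M_D].$$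 *)

(* Defs.v *)
From HB Require Import structures.
From mathcomp Require Import all_boot all_order all_algebra.
From mathcomp Require Import all_classical all_reals all_analysis.
From mathcomp Require Import complex.

Set Implicit Arguments.
Unset Strict Implicit.
Unset Printing Implicit Defensive.
Import Order.TTheory GRing.Theory Num.Theory.
Import numFieldNormedType.Exports.

Local Open Scope classical_set_scope.
Local Open Scope ring_scope.
Local Open Scope complex_scope.

(* Both are 0 by convention when the extremum does not exist. *)
Definition nat_max (S : set nat) : nat :=
  xget 0%N [set n | S n /\ forall k, S k -> (k <= n)%N].

Definition nat_min (S : set nat) : nat :=
  xget 0%N [set n | S n /\ forall k, S k -> (n <= k)%N].

Section ExponentialPolynomials.
Context {R : realType}.

Definition cexp (z : R[i]) : R[i] :=
  (expR (complex.Re z) * cos (complex.Im z)) +i*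
  (expR (complex.Re z) * sin (complex.Im z)).

(* The degree m is that of the presentation with m + 1 terms: coefficients may
   vanish and exponents may coincide. *)
Definition exp_poly (m : nat) (c lam : 'I_m.+1 -> R[i]) (t : R) : R[i] :=
  \sum_(k < m.+1) c k * cexp (lam k * t%:C).

Definition abs_exp_poly (m : nat) (c lam : 'I_m.+1 -> R[i]) (t : R) : R :=
  Normc.normc (exp_poly c lam t).

Definition max_freq (m : nat) (lam : 'I_m.+1 -> R[i]) : R :=
  \big[Num.max/0]_(k < m.+1) `|complex.Im (lam k)|.

Definition max_abs_Re (m : nat) (lam : 'I_m.+1 -> R[i]) : R :=
  \big[Num.max/0]_(k < m.+1) `|complex.Re (lam k)|.

Definition interval_length (B : set R) : R := fine (lebesgue_measure B).

(* Open, closed and half-open intervals are all allowed. *)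
Definition interval_of_length (l : R) (I : set R) : Prop :=
  is_interval I /\ lebesgue_measure I = l%:E.

Record diagram := Diagram {
  diag_degree : nat;
  diag_freq : R;
  diag_length : R }.

Definition diagram_of (m : nat) (lam : 'I_m.+1 -> R[i]) (B : set R) : diagram :=
  Diagram m (max_freq lam) (interval_length B).

(* n is the number of solutions of |p| = rho on some interval of length l, for
   some p of degree m and maximal frequency equal to the given one.  Only
   finite solution sets are counted: by analyticity the set is infinite only
   when |p| is constantly rho, as for p(t) = e^(i t) and rho = 1, and then no
   maximal number of solutions would exist. *)
Definition solution_count (D : diagram) (n : nat) : Prop :=
  exists (c lam : 'I_(diag_degree D).+1 -> R[i]) (rho : R) (I : set R),
    [/\ max_freq lam = diag_freq D,
        interval_of_length (diag_length D) I &
        ([set t | I t /\ abs_exp_poly c lam t = rho] #= `I_n)%card].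

Definition max_solutions (D : diagram) : nat := nat_max (solution_count D).

Definition frequency_bound (D : diagram) : nat := ((max_solutions D)./2).+1.

Definition covering_number (eps : R) (Omega : set R) : nat :=
  nat_min [set n | exists I : 'I_n -> set R,
    (forall i, interval_of_length eps (I i)) /\
    Omega `<=` \bigcup_i I i].

(* The supremum is finite for a bounded Omega: the frequency bound is at least
   1 and a set inside an interval of length l is covered by at most
   l / eps + 1 intervals of length eps. *)
Definition metric_span (D : diagram) (Omega : set R) : R :=
  sup [set eps * ((covering_number eps Omega)%:R - (frequency_bound D)%:R)
      | eps in [set eps : R | 0 < eps]].

Definition sup_abs (m : nat) (c lam : 'I_m.+1 -> R[i]) (A : set R) : R :=
  sup [set abs_exp_poly c lam t | t in A].

End ExponentialPolynomials.

(* Main.v *)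
(* Turan-Nazarov inequality on a finite union E of intervals of total length mu
   in [0, 1], for exponents with nonnegative real parts: by induction on the
   number of terms one builds a multiplier Phi(t) = prod |t - w_j| / |t - z_j|
   with w_j, z_j in the closed lower half-plane such that Phi >= 1 on the real
   line, Phi(i) <= e^(C m mu) and |p(0)| <= (C / mu)^m Phi(t) |p(t)| on [0, 1].
   If the exponents are spread out compared with their number, one passes from
   p to p' - lambda p, which has one term fewer, and bounds p' - lambda p by p
   through Boole's identity for the sum of 1 / (t - z) over the nearby zeros z
   of p.  If they are clustered, the nearby zeros of p, each paired with its
   translate by - i mu, do the job.  The product of Phi over M nodes
   tan ((phi + pi l) / M) is essentially Phi(i)^M, so that Phi is bounded at some
   point of E.

   To pass to Omega, let rho be the supremum of |p| on Omega and cover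
   {|p| <= rho} greedily by intervals [x_j, x_j + eps).  Every interval on which
   |p| exceeds rho, except perhaps the last one, yields two solutions of
   |p| = rho' for a common rho' > rho, so that |p| <= rho on at least
   M(eps, Omega) - M_D of the intervals, and these form E.  The number of
   solutions of |p| = rho is bounded by Rolle's theorem, because
   |p|^2 - rho^2 is the real part of an exponential sum and the operator
   (d/dt - a)^2 + b^2 kills a term with exponent a + i b. *)

Require Import Defs.
From HB Require Import structures.
From mathcomp Require Import all_boot all_order all_algebra finmap.
From mathcomp Require Import all_classical all_reals all_analysis.
From mathcomp Require Import complex ring lra zify.
Import Order.TTheory GRing.Theory Num.Theory.
Import numFieldNormedType.Exports.

Set Implicit Arguments.
Unset Strict Implicit.
Unset Printing Implicit Defensive.
Local Open Scope classical_set_scope.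
Local Open Scope ring_scope.
Local Open Scope complex_scope.

(** The obstacle is the loss of measure: if each of the m steps discarded an exceptional part of
    [E], of size about [mu / m], it would cost a factor of order m per step. Multipliers leave [E]
    intact: those of all steps are multiplied together, their logarithms add up at i, and a single
    point of [E] is chosen at the very end. Since zeros and poles lie in the lower half-plane, log
    Phi is harmonic in the upper one and log Phi(i) is its Poisson mean over the real line; being
    nonnegative there, log Phi is at most of order log Phi(i) / mu somewhere on [E], that is O(m).
    The nodes correspond to M equidistant points of the unit circle and turn this mean into a finite
    product. No complex integration occurs: exponential sums are replaced by Taylor polynomials,
    which split into linear factors over [R[i]], and means over circles are sums over roots of
    unity. The parameter [eta] in the estimates absorbs the error of this replacement; it is removed
    in [one_sided_turan]. *)

Notation nc := Normc.normc.

(** * The complex exponential *)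

Section ComplexModulus.
Context {R : realType}.
Implicit Types (x y z : R[i]) (s t : R).

Lemma nc_ge0 z : 0 <= nc z.
Proof. by case: z => a b /=; exact: sqrtr_ge0. Qed.

Lemma nc0 : nc (0 : R[i]) = 0. Proof. exact: Normc.normc0. Qed.
Lemma nc1 : nc (1 : R[i]) = 1. Proof. exact: Normc.normc1. Qed.
Lemma ncM x y : nc (x * y) = nc x * nc y. Proof. exact: Normc.normcM. Qed.
Lemma ncV x : nc x^-1 = (nc x)^-1. Proof. exact: Normc.normcV. Qed.
Lemma ncN x : nc (- x) = nc x. Proof. exact: normcN. Qed.
Lemma ncD x y : nc (x + y) <= nc x + nc y. Proof. exact: le_normcD. Qed.

Lemma ncB x y : nc (x - y) <= nc x + nc y.
Proof. by rewrite -(ncN y) ncD. Qed.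

Lemma ncBC x y : nc (x - y) = nc (y - x).
Proof. by rewrite -ncN opprB. Qed.

Lemma nc_subr x y : nc x - nc y <= nc (x - y).
Proof. by rewrite lerBlDr -{1}(subrK y x) ncD. Qed.

Lemma nc_addr x y : nc x - nc y <= nc (x + y).
Proof. by rewrite -(opprK y) ncN nc_subr. Qed.

Lemma nc_eq0 z : (nc z == 0) = (z == 0).
Proof.
apply/eqP/eqP => [/Normc.eq0_normc //|->]; exact: nc0.
Qed.

Lemma nc_gt0 z : (0 < nc z) = (z != 0).
Proof. by rewrite lt0r nc_ge0 andbT nc_eq0. Qed.

Lemma ncX z n : nc (z ^+ n) = nc z ^+ n.
Proof. by elim: n => [|n IH]; rewrite ?expr0 ?nc1 // !exprS ncM IH. Qed.

Lemma nc_sum (I : Type) (r : seq I) (P : pred I) (F : I -> R[i]) :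
  nc (\sum_(i <- r | P i) F i) <= \sum_(i <- r | P i) nc (F i).
Proof.
elim/big_ind2: _ => //; first by rewrite nc0.
by move=> x a y b ha hb; rewrite (le_trans (ncD _ _)) ?lerD.
Qed.

Lemma nc_prod (I : Type) (r : seq I) (P : pred I) (F : I -> R[i]) :
  nc (\prod_(i <- r | P i) F i) = \prod_(i <- r | P i) nc (F i).
Proof. by apply: big_morph; [exact: ncM|exact: nc1]. Qed.

Lemma nc_real s : nc s%:C = `|s|.
Proof. by rewrite /= expr0n /= addr0 sqrtr_sqr. Qed.

Lemma nc_nat n : nc (n%:R : R[i]) = n%:R.
Proof. by rewrite -(rmorph_nat (real_complex R)) nc_real normr_nat. Qed.

Definition cj z : R[i] := z^*.

Lemma nc_cj z : nc (cj z) = nc z.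
Proof. by case: z => a b /=; rewrite sqrrN. Qed.

Lemma cjM x y : cj (x * y) = cj x * cj y. Proof. exact: rmorphM. Qed.
Lemma cjB x y : cj (x - y) = cj x - cj y. Proof. exact: rmorphB. Qed.
Lemma cjX x n : cj (x ^+ n) = cj x ^+ n. Proof. exact: rmorphXn. Qed.
Lemma cj0 : cj 0 = 0. Proof. exact: rmorph0. Qed.
Lemma cjV x : cj x^-1 = (cj x)^-1. Proof. exact: fmorphV. Qed.
Lemma cj_real s : cj s%:C = s%:C. Proof. exact: conjc_real. Qed.
Lemma cj_sum (I : Type) (r : seq I) (P : pred I) (F : I -> R[i]) :
  cj (\sum_(i <- r | P i) F i) = \sum_(i <- r | P i) cj (F i).
Proof. exact: (raddf_sum (@conjc R)). Qed.

Lemma Re_cj_add z : z + cj z = (2 * complex.Re z)%:C.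
Proof.
by case: z => a b; apply/eqP; rewrite eq_complex /= subrr eqxx mulr_natl mulr2n eqxx.
Qed.

Lemma sqr_nc z : nc z ^+ 2 = complex.Re z ^+ 2 + complex.Im z ^+ 2.
Proof. by case: z => a b /=; rewrite sqr_sqrtr // addr_ge0 ?sqr_ge0. Qed.

Lemma nc_ge_Re z : `|complex.Re z| <= nc z.
Proof.
case: z => a b /=; rewrite -sqrtr_sqr ler_wsqrtr // lerDl sqr_ge0 //.
Qed.

Lemma nc_ge_Im z : `|complex.Im z| <= nc z.
Proof.
case: z => a b /=; rewrite -(sqrtr_sqr b) ler_wsqrtr // lerDr sqr_ge0 //.
Qed.

Lemma Re_le_nc z : complex.Re z <= nc z.
Proof. exact: le_trans (ler_norm _) (nc_ge_Re z). Qed.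

Lemma nc_i : nc ('i : R[i]) = 1.
Proof. by rewrite /= expr0n /= add0r expr1n sqrtr1. Qed.

Lemma cReD x y : complex.Re (x + y) = complex.Re x + complex.Re y.
Proof. by case: x; case: y. Qed.
Lemma cImD x y : complex.Im (x + y) = complex.Im x + complex.Im y.
Proof. by case: x; case: y. Qed.
Lemma cReN x : complex.Re (- x) = - complex.Re x.
Proof. by case: x. Qed.
Lemma cImN x : complex.Im (- x) = - complex.Im x.
Proof. by case: x. Qed.
Lemma cReM x y : complex.Re (x * y) =
  complex.Re x * complex.Re y - complex.Im x * complex.Im y.
Proof. by case: x; case: y. Qed.
Lemma cImM x y : complex.Im (x * y) =
  complex.Re x * complex.Im y + complex.Im x * complex.Re y.
Proof. by case: x; case: y. Qed.

Lemma cRe_sum (I : Type) (r : seq I) (P : pred I) (F : I -> R[i]) :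
  complex.Re (\sum_(i <- r | P i) F i) = \sum_(i <- r | P i) complex.Re (F i).
Proof. by apply: big_morph; [exact: cReD|]. Qed.
Lemma cIm_sum (I : Type) (r : seq I) (P : pred I) (F : I -> R[i]) :
  complex.Im (\sum_(i <- r | P i) F i) = \sum_(i <- r | P i) complex.Im (F i).
Proof. by apply: big_morph; [exact: cImD|]. Qed.

(* A unimodular factor turns the modulus into a real part, so that real mean
   value arguments apply to complex-valued functions. *)
Lemma nc_Re_rot z : exists2 k, nc k = 1 & complex.Re (k * z) = nc z.
Proof.
have [->|z0] := eqVneq z 0.
  by exists 1; rewrite ?nc1 // mulr0 nc0.
have nz : nc z != 0 by rewrite nc_eq0.
exists ((nc z)^-1%:C * cj z).
  by rewrite ncM nc_real nc_cj ger0_norm ?invr_ge0 ?nc_ge0 // mulVf.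
apply: (mulfI nz); rewrite -expr2 sqr_nc.
case: z {z0} nz => a b; set n := nc _ => nz; rewrite !cReM !cImM /=.
by field.
Qed.

End ComplexModulus.

Section RealDerivatives.
Context {R : realType}.
Implicit Types (f g : R -> R) (t : R).

Lemma is_derive_mul f g t df dg : is_derive t 1 f df -> is_derive t 1 g dg ->
  is_derive t 1 (fun s => f s * g s) (df * g t + f t * dg).
Proof.
move=> hf hg; apply: (is_derive_eq (is_deriveM hf hg)).
by rewrite /GRing.scale /= addrC mulrC.
Qed.

Lemma is_derive_add f g t df dg : is_derive t 1 f df -> is_derive t 1 g dg ->
  is_derive t 1 (fun s => f s + g s) (df + dg).
Proof. by move=> hf hg; exact: is_deriveD. Qed.

Lemma is_derive_scale f (c : R) t df : is_derive t 1 f df ->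
  is_derive t 1 (fun s => c * f s) (c * df).
Proof. by move=> hf; exact: is_deriveZ. Qed.

Lemma is_derive_expn n t : is_derive t 1 (fun s : R => s ^+ n.+1) (n.+1%:R * t ^+ n).
Proof.
have := is_deriveX n.+1 (is_derive_id t (1 : R)).
by rewrite exprfctE /GRing.scale /= mulr1.
Qed.

Lemma is_derive_lin (a : R) t : is_derive t 1 (fun s => a * s) a.
Proof.
apply: is_derive_eq (is_derive_scale a (is_derive_id t (1 : R))) _.
by rewrite mulr1.
Qed.

Lemma is_derive_sumn n (F : 'I_n -> R -> R) (dF : 'I_n -> R) t :
  (forall i, is_derive t 1 (F i) (dF i)) ->
  is_derive t 1 (fun s => \sum_(i < n) F i s) (\sum_(i < n) dF i).
Proof.
move=> h; have := @is_derive_sum _ _ _ n F t 1 dF h.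
rewrite (_ : \sum_(i < n) F i = fun s => \sum_(i < n) F i s) //.
by apply/funext => s; rewrite fct_sumE.
Qed.

Lemma derive_continuous f df : (forall t, is_derive t 1 f (df t)) -> continuous f.
Proof.
move=> h t.
exact/differentiable_continuous/derivable1_diffP/ex_derive.
Qed.

Lemma le_mvt f (df : R -> R) (B : R) :
  (forall t, 0 <= t <= 1 -> is_derive t 1 f (df t)) ->
  (forall t, 0 <= t <= 1 -> `|df t| <= B) -> `|f 1 - f 0| <= B.
Proof.
move=> hf hB.
have hd (x : R) : x \in `]0, 1[ -> is_derive x 1 f (df x).
  by rewrite in_itv /= => /andP[/ltW ? /ltW ?]; apply: hf; apply/andP.
have [|c c01 ->] := MVT_segment (@ler01 R) hd.
  apply: derivable_within_continuous => x.
  by rewrite in_itv /= => x01; apply: ex_derive; exact: hf.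
by rewrite subr0 mulr1 hB.
Qed.

End RealDerivatives.

Section ComplexExponential.
Context {R : realType}.
Implicit Types (x y z k : R[i]) (s t : R).

Lemma cexp0 : cexp (0 : R[i]) = 1.
Proof. by rewrite /cexp /= expR0 cos0 sin0 mulr0 mulr1. Qed.

Lemma cexpD x y : cexp (x + y) = cexp x * cexp y.
Proof.
apply/eqP; rewrite eq_complex cReM cImM /cexp /= cReD cImD expRD cosD sinD.
by apply/andP; split; apply/eqP; ring.
Qed.

Lemma nc_cexp z : nc (cexp z) = expR (complex.Re z).
Proof.
apply/eqP; rewrite -(@eqrXn2 _ 2) ?nc_ge0 ?expR_ge0 // sqr_nc /cexp /=.
by rewrite !exprMn -mulrDr cos2Dsin2 mulr1.
Qed.

Lemma cexp_neq0 z : cexp z != 0.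
Proof. by rewrite -nc_eq0 nc_cexp gt_eqF ?expR_gt0. Qed.

Lemma cexpN z : cexp (- z) = (cexp z)^-1.
Proof. by apply: (mulfI (cexp_neq0 z)); rewrite -cexpD subrr cexp0 mulfV ?cexp_neq0. Qed.

Lemma cexpMn z n : cexp (z *+ n) = cexp z ^+ n.
Proof.
by elim: n => [|n IH]; rewrite ?mulr0n ?cexp0 ?expr0 // mulrS cexpD IH exprS.
Qed.

Lemma cexp_cj z : cexp (cj z) = cj (cexp z).
Proof. by case: z => a b; rewrite /cexp /cj /= cosN sinN mulrN. Qed.

Lemma nc_cexp_le z : nc (cexp z) <= expR (nc z).
Proof. by rewrite nc_cexp ler_expR Re_le_nc. Qed.

Lemma is_derive_Re_cexp k z t :
  is_derive t 1 (fun s => complex.Re (k * cexp (z * s%:C)))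
    (complex.Re (k * (z * cexp (z * t%:C)))).
Proof.
case: z k => a b [c d].
have e (s : R) : complex.Re ((c +i* d) * cexp ((a +i* b) * s%:C)) =
   c * (expR (a * s) * cos (b * s)) - d * (expR (a * s) * sin (b * s)).
  by rewrite cReM /cexp /= !mulr0 subr0 add0r.
under eq_fun do rewrite e.
apply: is_derive_eq.
rewrite /GRing.scale /= !mulr0 !subr0 !add0r.
by ring.
Qed.

End ComplexExponential.

Section Taylor.
Context {R : realType}.
Implicit Types (x y z k : R[i]) (s t : R).

Definition exp_trunc (L : nat) z : R[i] := \sum_(m < L) z ^+ m / m`!%:R.

Lemma factSr (m : nat) : (m.+1`!%:R : R) = m.+1%:R * m`!%:R.
Proof. by rewrite factS natrM. Qed.

(** The derivatives telescope: differentiating the exponential in one term cancels the power rule in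
    the next, and only the last term survives. *)
Lemma is_derive_trunc_cexp k z (L : nat) t :
  is_derive t 1 (fun s : R => \sum_(m < L.+1) s ^+ m / m`!%:R *
                        complex.Re (k * z ^+ m * cexp (- z * s%:C)))
    (- (t ^+ L / L`!%:R * complex.Re (k * z ^+ L.+1 * cexp (- z * t%:C)))).
Proof.
elim: L => [|L IH].
  under eq_fun do rewrite big_ord1 expr0 fact0 divr1 mul1r expr0 mulr1.
  rewrite expr0 fact0 divr1 mul1r expr1.
  have := is_derive_Re_cexp k (- z) t.
  by rewrite mulNr mulrN cReN mulrA.
under eq_fun do rewrite big_ord_recr /=.
have h := is_derive_Re_cexp (k * z ^+ L.+1) (- z) t.
have hp : is_derive t 1 (fun s : R => L.+1`!%:R^-1 * s ^+ L.+1)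
    (L.+1`!%:R^-1 * (L.+1%:R * t ^+ L)).
  exact: is_derive_scale (is_derive_expn L t).
under eq_fun do rewrite [_ ^+ L.+1 / _]mulrC.
apply: is_derive_eq (is_derive_add IH (is_derive_mul hp h)) _.
rewrite !mulNr !mulrN !cReN.
rewrite (_ : k * z ^+ L.+1 * (z * _) = k * z ^+ L.+2 * cexp (- (z * t%:C))).
  have f0 : (L`!%:R : R) != 0 by rewrite pnatr_eq0 -lt0n fact_gt0.
  rewrite factSr [t ^+ L.+1]exprS; move: (complex.Re _) (complex.Re _) => A B.
  by field; rewrite f0 /= addrC natr1 pnatr_eq0.
by rewrite [z ^+ L.+2]exprSr !mulrA.
Qed.

(** The truncation times [cexp (- z)] is followed along the segment from 0 to z: it starts at 1, and
    by [is_derive_trunc_cexp] its derivative is a single small term. Multiplying back by [cexp z]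
    doubles the exponent. *)
Lemma exp_trunc_bound z (L : nat) :
  nc (cexp z - exp_trunc L.+1 z) <= nc z ^+ L.+1 / L`!%:R * expR (2 * nc z).
Proof.
suff h : nc (1 - exp_trunc L.+1 z * cexp (- z)) <=
    nc z ^+ L.+1 / L`!%:R * expR (nc z).
  have -> : cexp z - exp_trunc L.+1 z =
      cexp z * (1 - exp_trunc L.+1 z * cexp (- z)).
    by rewrite mulrBr mulr1 mulrCA -cexpD subrr cexp0 mulr1.
  rewrite ncM mulrC mulr_natl mulr2n expRD mulrA ler_pM ?nc_ge0 //.
  exact: nc_cexp_le.
have [k k1 <-] := nc_Re_rot (1 - exp_trunc L.+1 z * cexp (- z)).
have /= := @le_mvt R _ _ (nc z ^+ L.+1 / L`!%:R * expR (nc z))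
  (fun t _ => is_derive_trunc_cexp k z L t).
rewrite (_ : \sum_(m < L.+1) 1 ^+ m / m`!%:R * _ =
   complex.Re (k * (exp_trunc L.+1 z * cexp (- z)))); last first.
  rewrite /exp_trunc mulr_suml mulr_sumr cRe_sum; apply: eq_bigr => m _.
  rewrite expr1n mul1r rmorph1 mulr1.
  rewrite (_ : k * (_ * _) = (m`!%:R^-1)%:C * (k * z ^+ m * cexp (- z))).
    by rewrite [in RHS]cReM /= mul0r subr0.
  rewrite fmorphV rmorph_nat; field.
  by rewrite pnatr_eq0 -lt0n fact_gt0.
rewrite (_ : \sum_(m < L.+1) 0 ^+ m / m`!%:R * _ = complex.Re k); last first.
  rewrite big_ord_recl expr0 fact0 divr1 mul1r expr0 rmorph0 mulr0 cexp0 !mulr1 big1 ?addr0 //.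
  by move=> i _; rewrite expr0n /= !mul0r.
rewrite mulrBr mulr1 cReD cReN => h.
apply: le_trans (h _); first by rewrite -normrN opprB ler_norm.
move=> t /andP[t0 t1].
have hk : `|complex.Re (k * z ^+ L.+1 * cexp (- z * t%:C))| <=
    nc z ^+ L.+1 * expR (nc z).
  rewrite (le_trans (nc_ge_Re _)) // !ncM k1 mul1r ncX ler_wpM2l ?exprn_ge0 ?nc_ge0 //.
  rewrite (le_trans (nc_cexp_le _)) // ler_expR ncM ncN nc_real ger0_norm //.
  by rewrite ler_piMr ?nc_ge0.
rewrite normrN !normrM normfV normr_nat (ger0_norm (exprn_ge0 _ t0)).
rewrite [leRHS]mulrAC mulrC; apply: ler_pM => //.
  by rewrite divr_ge0 ?exprn_ge0.
by rewrite ler_piMl ?invr_ge0 // exprn_ile1.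
Qed.

Lemma exp_trunc_approx (Z eta : R) : 0 <= Z -> 0 < eta ->
  exists L0, forall L z, (L0 <= L)%N -> nc z <= Z ->
    nc (cexp z - exp_trunc L z) <= eta.
Proof.
move=> Z0 eta0.
pose B := Z * expR (2 * Z) + 1.
have B0 : 0 < B by rewrite ltr_wpDl ?mulr_ge0 ?expR_ge0.
have /cvgrPdist_le/(_ _ (divr_gt0 eta0 B0)) [L0 _ hL0] := @cvg_exp_coeff R Z.
exists L0.+1 => -[//|L] z; rewrite ltnS => /hL0; rewrite /= sub0r normrN.
rewrite ger0_norm ?exp_coeff_ge0 // ler_pdivlMr // /exp_coeff /= => hL zZ.
apply: le_trans (exp_trunc_bound _ _) _; apply: le_trans hL.
have zn : 0 <= nc z by exact: nc_ge0.
rewrite exprS.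
have -> : nc z * nc z ^+ L / L`!%:R * expR (2 * nc z) =
  (nc z ^+ L / L`!%:R) * (nc z * expR (2 * nc z)) by ring.
apply: ler_pM.
- by rewrite divr_ge0 ?exprn_ge0.
- by rewrite mulr_ge0 ?expR_ge0.
- by rewrite ler_wpM2r ?invr_ge0 // lerXn2r ?nnegrE.
by rewrite ler_wpDr // ler_pM ?expR_ge0 // ler_expR ler_wpM2l.
Qed.

End Taylor.

(** * Polynomials on circles *)

Section RootsOfUnity.
Context {R : realType}.
Implicit Types (x y z : R[i]) (s t r : R) (P : {poly R[i]}).

Definition rou (M : nat) : R[i] := cexp (Complex 0 (2 * pi / M%:R)).

Lemma nc_rou M : nc (rou M) = 1.
Proof. by rewrite nc_cexp /= expR0. Qed.

Lemma rouX M k : rou M ^+ k = cexp (Complex 0 (2 * pi * k%:R / M%:R)).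
Proof.
rewrite -cexpMn; congr cexp; elim: k => [|k IH].
  by rewrite mulr0n mulr0 mul0r.
by rewrite mulrSr IH; apply/eqP; rewrite eq_complex /= addr0 eqxx /= -natr1; apply/eqP; ring.
Qed.

Lemma cos_eq1_lt2pi (x : R) : 0 < x < 2 * pi -> cos x != 1.
Proof.
move=> /andP[x0 x1]; have s0 : 0 < sin (x / 2).
  by apply: sin_gt0_pi; apply/andP; split; lra.
have -> : cos x = 1 - sin (x / 2) ^+ 2 *+ 2.
  have := cos_mulr2n (x / 2); rewrite -[_ *+ 2]mulr_natr divfK // => ->.
  rewrite cos2sin2; ring.
by rewrite lt_eqF // ltrBlDr ltrDl pmulrn_lgt0 // exprn_gt0.
Qed.

Lemma rou_prim M : (0 < M)%N -> M.-primitive_root (rou M).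
Proof.
move=> M0; have M1 : (M%:R : R) != 0 by rewrite pnatr_eq0 -lt0n.
have e1 : rou M ^+ M = 1.
  rewrite rouX mulfK // /cexp /= expR0 !mul1r mulr_natl cos2pi.
  by rewrite sin2pi.
have [m pm mM] := prim_order_exists M0 e1.
have m0 := prim_order_gt0 pm.
have : (m <= M)%N by exact: dvdn_leq.
rewrite leq_eqVlt => /predU1P[emM|ltmM]; first by rewrite -{1}emM.
have := prim_expr_order pm; rewrite rouX /cexp /= expR0 !mul1r => -[c1 _].
have p0 := pi_gt0 R.
have : 0 < (2 * pi * m%:R / M%:R : R) < 2 * pi.
  rewrite !divr_gt0 ?mulr_gt0 ?ltr0n //= ltr_pdivrMr ?ltr0n //.
  by rewrite ltr_pM2l ?ltr_nat // mulr_gt0 // ltr0n.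
by move/cos_eq1_lt2pi; rewrite c1 eqxx.
Qed.

Lemma sum_rou M k : (0 < M)%N ->
  \sum_(l < M) rou M ^+ (l * k) = if (M %| k)%N then M%:R else 0.
Proof.
move=> M0; have pr := rou_prim M0.
have e (l : nat) : rou M ^+ (l * k) = (rou M ^+ k) ^+ l by rewrite -exprM mulnC.
under eq_bigr do rewrite e.
case: ifPn => [Mk|nMk].
  have -> : rou M ^+ k = 1 by apply/eqP; rewrite -(prim_order_dvd pr).
  by rewrite (eq_bigr (fun=> 1)) ?sumr_const ?card_ord // => i _; rewrite expr1n.
have n1 : rou M ^+ k != 1 by rewrite -(prim_order_dvd pr).
apply: (@mulfI _ (rou M ^+ k - 1)); first by rewrite subr_eq0.
by rewrite mulr0 -subrX1 -exprM mulnC exprM (prim_expr_order pr) expr1n subrr.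
Qed.

Lemma prod_rou M (b : R[i]) : (0 < M)%N ->
  \prod_(l < M) (1 - b * rou M ^+ l) = 1 - b ^+ M.
Proof.
move=> M0; have pr := rou_prim M0.
have [->|b0] := eqVneq b 0.
  by rewrite expr0n gtn_eqF //= subr0 big1 // => i _; rewrite mul0r subr0.
have h : \prod_(i < M) (b^-1 - rou M ^+ i) = b^-1 ^+ M - 1.
  rewrite -(hornerXn b^-1 M) -[1 in RHS](hornerC 1 b^-1) -hornerN -hornerD.
  rewrite polyC1 -(factor_Xn_sub_1 pr) horner_prod (big_mkord xpredT).
  by apply: eq_bigr => i _; rewrite hornerD hornerN hornerX hornerC.
have -> : 1 - b ^+ M = b ^+ M * (b^-1 ^+ M - 1).
  by rewrite mulrBr mulr1 -exprMn divff // expr1n.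
rewrite -h.
have <- : \prod_(i < M) b = b ^+ M by rewrite prodr_const card_ord.
rewrite -big_split /=; apply: eq_bigr => i _.
by rewrite mulrBr divff.
Qed.

Lemma sum_le_const n (F : 'I_n -> R) (c : R) :
  (forall i, F i <= c) -> \sum_(i < n) F i <= n%:R * c.
Proof.
move=> h; rewrite (le_trans (ler_sum _ (fun i _ => h i))) //.
by rewrite sumr_const card_ord mulr_natl.
Qed.

(** Discrete Fourier inversion: [M - k] plays the role of the frequency [- k], and as M is at least
    the size of P no two coefficients are aliased. *)
Lemma sum_rou_coef P (r : R[i]) M k : (size P <= M)%N -> (k < M)%N ->
  \sum_(l < M) P.[r * rou M ^+ l] * rou M ^+ (l * (M - k)) = M%:R * (P`_k * r ^+ k).
Proof.
move=> sP kM; have M0 : (0 < M)%N by apply: leq_trans kM.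
under eq_bigr => l _ do rewrite (horner_coef_wide _ sP) mulr_suml.
rewrite exchange_big /= (bigD1 (Ordinal kM)) //= [X in _ + X]big1 ?addr0.
  rewrite (eq_bigr (fun=> P`_k * r ^+ k)) => [|l _].
    by rewrite sumr_const card_ord mulr_natl.
  rewrite exprMn -exprM -!mulrA -exprD -mulnDr subnKC ?(ltnW kM) //.
  by rewrite mulnC exprM (prim_expr_order (rou_prim M0)) expr1n mulr1.
move=> j jk.
rewrite (eq_bigr (fun l : 'I_M => P`_j * r ^+ j * rou M ^+ (l * (j + (M - k))))).
  rewrite -mulr_sumr sum_rou // ifN ?mulr0 //.
  have jM := ltn_ord j; apply: contra jk => /dvdnP[q hq]; apply/eqP/val_inj => /=.
  by case: q hq => [|[|q]] hq; nia.
by move=> l _; rewrite exprMn -exprM -!mulrA -exprD -mulnDr.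
Qed.

Lemma ex_max_ord n (f : 'I_n.+1 -> R) : exists i, forall j, f j <= f i.
Proof.
by exists [arg max_(i > ord0) f i]%O => j; case: arg_maxP => // i _ /(_ j); apply.
Qed.

(** Every coefficient is a mean over the same finitely many points of the circle, so the best of
    these points serves for all k at once. *)
Lemma cauchy_max P r : 0 <= r ->
  exists2 z, nc z = r & forall k, nc P`_k * r ^+ k <= nc P.[z].
Proof.
move=> r0; pose M := (size P).+1.
have [i hi] := @ex_max_ord (size P) (fun l => nc P.[r%:C * rou M ^+ l]).
exists (r%:C * rou M ^+ i).
  by rewrite ncM ncX nc_rou expr1n mulr1 nc_real ger0_norm.
move=> k; have [sk|ks] := leqP (size P) k.
  by rewrite nth_default // nc0 mul0r nc_ge0.
have := @sum_rou_coef P r%:C M k (leqnSn _) (leqW ks).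
move/(congr1 (@Normc.normc R)); rewrite !ncM nc_nat ncX nc_real ger0_norm // => h.
have M0 : 0 < M%:R :> R by rewrite ltr0n.
rewrite -(ler_pM2l M0) -h (le_trans (nc_sum _ _ _)) //.
apply: sum_le_const => l.
by rewrite ncM ncX nc_rou expr1n mulr1 hi.
Qed.

Lemma cauchy_coef P r B k : 0 <= r -> (forall z, nc z = r -> nc P.[z] <= B) ->
  nc P`_k * r ^+ k <= B.
Proof. by move=> r0 h; have [z /h hz /(_ k) /le_trans ->] := cauchy_max P r0. Qed.

Lemma nc_horner_le P z : nc P.[z] <= \sum_(m < size P) nc P`_m * nc z ^+ m.
Proof.
rewrite horner_coef (le_trans (nc_sum _ _ _)) // ler_sum // => m _.
by rewrite ncM ncX.
Qed.

Lemma geo_le (q : R) n : 0 <= q < 1 -> \sum_(m < n) q ^+ m <= (1 - q)^-1.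
Proof.
move=> /andP[q0 q1]; have h : 0 < 1 - q by rewrite subr_gt0.
rewrite -[leRHS]mul1r ler_pdivlMr // mulrC.
have -> : (1 - q) * \sum_(m < n) q ^+ m = 1 - q ^+ n.
  by rewrite -[RHS]opprB subrX1 -mulNr opprB.
by rewrite gerBl exprn_ge0.
Qed.

(** A weak maximum principle from Cauchy's estimates and a geometric series; the loss is a constant
    at the ratios of radii used below. *)
Lemma max_principle P r z B : nc z < r -> (forall w, nc w = r -> nc P.[w] <= B) ->
  nc P.[z] <= B / (1 - nc z / r).
Proof.
move=> zr h; have z0 := nc_ge0 z; have r0 : 0 < r := le_lt_trans z0 zr.
have B0 : 0 <= B.
  apply: le_trans (nc_ge0 P.[r%:C]) (h _ _).
  by rewrite nc_real ger0_norm // ltW.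
have q0 : 0 <= nc z / r by rewrite divr_ge0 // ltW.
have q1 : nc z / r < 1 by rewrite ltr_pdivrMr ?mul1r.
rewrite (le_trans (nc_horner_le _ _)) //.
apply: (@le_trans _ _ (B * \sum_(m < size P) (nc z / r) ^+ m)); last first.
  by rewrite ler_wpM2l // geo_le // q0.
rewrite mulr_sumr ler_sum // => m _.
rewrite -[in leLHS](divfK (lt0r_neq0 r0) (nc z)) exprMn mulrCA mulrC.
rewrite ler_wpM2r ?exprn_ge0 //.
exact: cauchy_coef (ltW r0) h.
Qed.

(** The conjugate values have no component at frequency k, so the coefficient is twice the mean of
    [Re P] against a power of the root of unity. For [k > 0], [Re P] may be replaced by [Re P - A],
    which has constant sign, and the mean of [Re P] itself is [Re P(0) = 0]. *)
Lemma borel_caratheodory P r A k : 0 <= r -> (0 < k)%N -> P`_0 = 0 ->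
  (forall z, nc z = r -> complex.Re P.[z] <= A) -> nc P`_k * r ^+ k <= 2 * A.
Proof.
move=> r0 k0 P0 h.
(* Large enough for [j + k < M] for all degrees j occurring in P, so that no conjugated term is
   aliased to frequency k. *)
pose M := ((size P).*2 + k).+1; pose u (l : nat) := r%:C * rou M ^+ l.
have M0 : 0 < M%:R :> R by rewrite ltr0n.
have nu l : nc (u l) = r.
  by rewrite ncM ncX nc_rou expr1n mulr1 nc_real ger0_norm.
have sM : (size P <= M)%N by rewrite /M; lia.
have kM : (k < M)%N by rewrite /M; lia.
have [sk|ks] := leqP (size P) k.
  rewrite nth_default // nc0 mul0r mulr_ge0 //.
  have := @sum_rou_coef P r%:C M 0 sM (ltn0Sn _); rewrite P0 mul0r mulr0.
  move/(congr1 (@complex.Re R)); rewrite cRe_sum /=.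
  rewrite (eq_bigr (fun l : 'I_M => complex.Re P.[u l])); last first.
    move=> l _; rewrite subn0 mulnC exprM (prim_expr_order (rou_prim _)) //.
    by rewrite expr1n mulr1.
  move=> h0; rewrite -(pmulr_rge0 _ M0) -h0.
  by apply: sum_le_const => l; apply: h.
have e1 := @sum_rou_coef P r%:C M k sM kM.
have e2 : \sum_(l < M) cj P.[u l] * rou M ^+ (l * (M - k)) = 0.
  under eq_bigr => l _ do rewrite (horner_coef_wide _ (leqnn _)) cj_sum mulr_suml.
  rewrite exchange_big /= big1 // => j _.
  rewrite (eq_bigr (fun l : 'I_M =>
     cj P`_j * r%:C ^+ j * rou M ^+ (l * (M.-1 * j + (M - k))))).
    have [j0|j0] := posnP j; first by rewrite big1 // => l _; rewrite j0 P0 cj0 !mul0r.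
    rewrite -mulr_sumr sum_rou // ifN ?mulr0 //.
    have jP := ltn_ord j; apply/negP => /dvdnP[q hq].
    have : (M %| j + k)%N.
      apply/dvdnP; exists (j.+1 - q)%N.
      have -> : ((j.+1 - q) * M = (M.-1 * j + j + M) - q * M)%N.
        by rewrite mulnBl; congr (_ - _)%N; rewrite /M /=; ring.
      by rewrite -hq; move: kM; move: (_ * j)%N => X; move: (M) => Y; lia.
    move/dvdn_leq; rewrite addn_gt0 k0 orbT => /(_ isT); rewrite leqNgt => /negP[].
    by rewrite /M ltnS leq_add2r (leq_trans (ltnW jP)) // -addnn leq_addr.
  move=> l _; rewrite /u cjM cjX cjM cjX cj_real.
  have cr : cj (rou M) = rou M ^+ M.-1.
    apply: (@mulfI _ (rou M)); first by rewrite -nc_eq0 nc_rou oner_eq0.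
    rewrite -exprS prednK // (prim_expr_order (rou_prim _)) //.
    rewrite -cexp_cj -cexpD -[RHS](@cexp0 R); congr cexp.
    by apply/eqP; rewrite eq_complex /= addr0 subrr !eqxx.
  rewrite cr exprMn -!exprM -!mulrA -exprD; do 2 congr (_ * _).
  by congr (_ ^+ _); rewrite mulnDr; congr (_ + _)%N; ring.
have e3 : \sum_(l < M) rou M ^+ (l * (M - k)) = 0.
  rewrite sum_rou // ifN //; apply/negP => /dvdn_leq; rewrite subn_gt0 => /(_ kM).
  by lia.
have e4 : M%:R * (P`_k * r%:C ^+ k) =
   - (\sum_(l < M) (2 * (A - complex.Re P.[u l]))%:C * rou M ^+ (l * (M - k))).
  have e (l : 'I_M) : (2 * (A - complex.Re P.[u l]))%:C * rou M ^+ (l * (M - k)) =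
     (2 * A)%:C * rou M ^+ (l * (M - k)) - (P.[u l] * rou M ^+ (l * (M - k)) +
      cj P.[u l] * rou M ^+ (l * (M - k))).
    rewrite -mulrDl Re_cj_add -mulrBl; congr (_ * _).
    by rewrite -rmorphB mulrBr.
  under eq_bigr do rewrite e.
  by rewrite sumrB big_split /= e2 addr0 e1 -mulr_sumr e3 mulr0 sub0r opprK.
rewrite -(ler_pM2l M0).
have := congr1 (@Normc.normc R) e4.
rewrite ncN !ncM nc_nat ncX nc_real ger0_norm // => ->.
apply: le_trans (nc_sum _ _ _) _.
rewrite (eq_bigr (fun l : 'I_M => 2 * (A - complex.Re P.[u l]))); last first.
  move=> l _; rewrite ncM ncX nc_rou expr1n mulr1 nc_real ger0_norm //.
  by rewrite mulr_ge0 // subr_ge0 h.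
have e5 : \sum_(l < M) complex.Re P.[u l] = 0.
  have := @sum_rou_coef P r%:C M 0 sM (ltn0Sn _); rewrite P0 mul0r mulr0.
  move/(congr1 (@complex.Re R)); rewrite cRe_sum /= => h0; rewrite -[RHS]h0.
  apply: eq_bigr => l _; rewrite subn0 mulnC exprM (prim_expr_order (rou_prim _)) //.
  by rewrite expr1n mulr1.
by rewrite -mulr_sumr sumrB e5 subr0 sumr_const card_ord -[A *+ _]mulr_natl mulrCA.
Qed.

End RootsOfUnity.

(** * Local factorization *)

Section ZeroFree.
Context {R : realType}.
Implicit Types (x y z w a : R[i]) (s t r : R).

(** The K-th partial sum of the series of - log(1 - x). *)
Definition log_trunc (K : nat) x : R[i] := \sum_(k < K) x ^+ k.+1 / k.+1%:R.

Lemma Re_scale s x : complex.Re (s%:C * x) = s * complex.Re x.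
Proof. by rewrite cReM /= mul0r subr0. Qed.

Lemma nc_sub1_gt0 x : nc x <= 2^-1 -> 2^-1 <= nc (1 - x).
Proof.
move=> h; rewrite (le_trans _ (nc_subr _ _)) // nc1; lra.
Qed.

(** Only the real logarithm of a modulus occurs, so that no branch has to be chosen. With [t * x] in
    place of x the derivative in t is the tail of a geometric series, and the mean value theorem
    applies. *)
Lemma ln_nc_trunc x (K : nat) : nc x <= 2^-1 ->
  `|ln (nc (1 - x)) + complex.Re (log_trunc K x)| <= 2^-1 ^+ K.
Proof.
move=> x2.
pose u := complex.Re x; pose v := complex.Im x.
(* The squared modulus of [1 - t * x], in a form that can be differentiated over the reals. *)
pose D t := (1 - t * u) ^+ 2 + (t * v) ^+ 2.
have hD t : D t = nc (1 - t%:C * x) ^+ 2.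
  by rewrite sqr_nc !(cReD, cReN, cImD, cImN) Re_scale cImM /= mul0r addr0 add0r sqrrN.
have tx t : 0 <= t <= 1 -> nc (t%:C * x) <= nc x.
  by move=> /andP[t0 t1]; rewrite ncM nc_real ger0_norm // ler_piMl ?nc_ge0.
have n0 t : 0 <= t <= 1 -> 2^-1 <= nc (1 - t%:C * x).
  by move=> t01; apply: nc_sub1_gt0; exact: le_trans (tx t t01) x2.
have D0 t : 0 <= t <= 1 -> 0 < D t.
  by move=> t01; rewrite hD exprn_gt0 // (lt_le_trans _ (n0 t t01)).
pose f s := 2^-1 * ln (D s) + \sum_(k < K) (complex.Re (x ^+ k.+1) / k.+1%:R) * s ^+ k.+1.
pose df s := 2^-1 * ((D s)^-1 * (2 * (s * (u ^+ 2 + v ^+ 2) - u))) +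
   \sum_(k < K) (complex.Re (x ^+ k.+1) / k.+1%:R) * (k.+1%:R * s ^+ k).
have hf t : 0 <= t <= 1 -> is_derive t 1 f (df t).
  move=> t01; apply: is_derive_add; last first.
    by apply: is_derive_sumn => k; apply: is_derive_scale; exact: is_derive_expn.
  apply: is_derive_scale.
  have hDd : is_derive t 1 D (2 * (t * (u ^+ 2 + v ^+ 2) - u)).
    have h1 := is_derive_add (is_derive_cst (1:R) t (1:R)) (is_derive_lin (- u) t).
    have h2 := is_derive_lin v t.
    have := is_derive_add (is_derive_mul h1 h1) (is_derive_mul h2 h2).
    rewrite (_ : (fun s => _) = D); last first.
      by apply/funext => s; rewrite /D /cst /=; ring.
    by move=> h3; apply: (is_derive_eq h3); rewrite /cst /=; ring.
  exact: (is_derive1_comp (is_derive1_ln (D0 t t01)) hDd).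
have := @le_mvt R f df (2^-1 ^+ K) hf.
have -> : f 1 - f 0 = ln (nc (1 - x)) + complex.Re (log_trunc K x).
  have -> : f 0 = 0.
    rewrite /f /D !mul0r subr0 expr0n /= addr0 expr1n ln1 mulr0 add0r big1 // => k _.
    by rewrite expr0n /= mulr0.
  have n1 : 0 < nc (1 - x) by rewrite (lt_le_trans _ (nc_sub1_gt0 x2)).
  rewrite subr0 /f hD rmorph1 mul1r lnXn //.
  rewrite -[ln _ *+ 2]mulr_natl mulKf //; congr (_ + _).
  rewrite /log_trunc cRe_sum; apply: eq_bigr => k _.
  rewrite expr1n mulr1 mulrC -Re_scale; congr complex.Re.
  by rewrite fmorphV rmorph_nat mulrC.
apply=> t t01.
have c0 : 1 - t%:C * x != 0 by rewrite -nc_gt0 (lt_le_trans _ (n0 t t01)).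
have -> : df t = - complex.Re (x * (t%:C * x) ^+ K / (1 - t%:C * x)).
  rewrite /df.
  have -> : \sum_(k < K) complex.Re (x ^+ k.+1) / k.+1%:R * (k.+1%:R * t ^+ k) =
     complex.Re (x / (1 - t%:C * x)) - complex.Re (x * (t%:C * x) ^+ K / (1 - t%:C * x)).
    rewrite -cReN -cReD.
    have -> : x / (1 - t%:C * x) - x * (t%:C * x) ^+ K / (1 - t%:C * x) =
       \sum_(k < K) (t ^+ k)%:C * x ^+ k.+1.
      have -> : \sum_(k < K) (t ^+ k)%:C * x ^+ k.+1 = x * \sum_(k < K) (t%:C * x) ^+ k.
        rewrite mulr_sumr; apply: eq_bigr => k _.
        by rewrite exprMn rmorphXn /= exprS; ring.
      have e : (1 - t%:C * x) * \sum_(k < K) (t%:C * x) ^+ k = 1 - (t%:C * x) ^+ K.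
        by rewrite -[RHS]opprB subrX1 -[RHS]mulNr opprB.
      apply: (mulIf c0); rewrite mulrBl !divfK // -mulrA [_ * (1 - _)]mulrC e.
      by ring.
    rewrite cRe_sum; apply: eq_bigr => k _; rewrite Re_scale.
    by field; rewrite addrC natr1 pnatr_eq0.
  rewrite addrA -[RHS]add0r; congr (_ + _).
  have -> : complex.Re (x / (1 - t%:C * x)) = (u - t * (u ^+ 2 + v ^+ 2)) / D t.
    have -> : (1 - t%:C * x)^-1 = (D t)^-1%:C * cj (1 - t%:C * x).
      apply: (mulfI c0); rewrite divff // mulrCA.
      have -> : (1 - t%:C * x) * cj (1 - t%:C * x) = (D t)%:C.
        rewrite hD sqr_nc; case: (1 - _) => a b; apply/eqP; rewrite eq_complex /=.
        by apply/andP; split; apply/eqP; ring.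
      by rewrite -rmorphM /= mulVf ?gt_eqF ?D0.
    rewrite mulrCA Re_scale cReM /cj mulrC; congr (_ * _).
    rewrite /u /v; case: (x) => a b /=; ring.
  by field; rewrite gt_eqF ?D0.
rewrite normrN (le_trans (nc_ge_Re _)) // !ncM ncX ncV.
have h1 := n0 t t01; have h2 := tx t t01.
have i2 : (nc (1 - t%:C * x))^-1 <= 2 by rewrite -[leRHS]invrK lef_pV2 ?posrE // (lt_le_trans _ h1).
have h3 : nc (t%:C * x) ^+ K <= 2^-1 ^+ K.
  by rewrite lerXn2r ?nnegrE ?nc_ge0 // (le_trans h2).
have -> : 2^-1 ^+ K = 2^-1 * 2^-1 ^+ K * 2 :> R by field.
apply: ler_pM; rewrite ?mulr_ge0 ?exprn_ge0 ?nc_ge0 ?invr_ge0 ?nc_ge0 //.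
by apply: ler_pM; rewrite ?exprn_ge0 ?nc_ge0.
Qed.

End ZeroFree.

Section LocalFactorization.
Context {R : realType}.
Implicit Types (x y z w a : R[i]) (s t r A : R).

Lemma sum_geo_half K : \sum_(k < K) 2^-1 ^+ k.+1 <= 1 :> R.
Proof.
suff -> : \sum_(k < K) 2^-1 ^+ k.+1 = 1 - 2^-1 ^+ K :> R by rewrite gerBl exprn_ge0.
by elim: K => [|K IH]; rewrite ?big_ord0 ?expr0 ?subrr // big_ord_recr IH /= exprS; field.
Qed.

Lemma sum_arith_geo_half K : \sum_(k < K) k.+1%:R * 2^-1 ^+ k <= 4 :> R.
Proof.
suff -> : \sum_(k < K) k.+1%:R * 2^-1 ^+ k = 4 - (2 * K%:R + 4) * 2^-1 ^+ K :> R.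
  by rewrite gerBl mulr_ge0 ?exprn_ge0 // addr_ge0 // mulr_ge0.
elim: K => [|K IH]; first by rewrite big_ord0 expr0; ring.
by rewrite big_ord_recr IH /= exprS -natr1; field.
Qed.

Lemma ex_half_expn_le (n : nat) : exists K, n%:R * 2^-1 ^+ K <= 2^-1 :> R.
Proof.
exists n.+1; rewrite exprSr mulrA ler_piMl //.
have h : (n%:R <= 2 ^+ n :> R) by rewrite -natrX ler_nat ltnW // ltn_expl.
rewrite (le_trans (ler_wpM2r _ h)) ?exprn_ge0 // -exprMn mulfV //.
Qed.

Lemma prodr_gt0_seq (I : eqType) (l : seq I) (F : I -> R) :
  (forall i, i \in l -> 0 < F i) -> 0 < \prod_(i <- l) F i.
Proof. by move=> h; rewrite big_seq prodr_gt0. Qed.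

Lemma ler_prod_seq (I : eqType) (l : seq I) (F G : I -> R) :
  (forall i, i \in l -> 0 <= F i <= G i) ->
  \prod_(i <- l) F i <= \prod_(i <- l) G i.
Proof. by move=> h; rewrite big_seq [leRHS]big_seq ler_prod. Qed.

Lemma ln_prod (I : eqType) (l : seq I) (F : I -> R) : (forall i, i \in l -> 0 < F i) ->
  ln (\prod_(i <- l) F i) = \sum_(i <- l) ln (F i).
Proof.
elim: l => [|i l IH] h; first by rewrite !big_nil ln1.
rewrite !big_cons lnM ?posrE ?IH ?h ?mem_head //.
  by move=> j jl; apply: h; rewrite in_cons jl orbT.
by rewrite prodr_gt0_seq // => j jl; apply: h; rewrite in_cons jl orbT.
Qed.

Lemma sum_seq_le_const (I : eqType) (l : seq I) (F : I -> R) c :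
  (forall i, i \in l -> F i <= c) -> \sum_(i <- l) F i <= (size l)%:R * c.
Proof.
move=> h; rewrite big_seq (le_trans (ler_sum _ h)) // -big_seq.
by rewrite big_const_seq count_predT iter_addr_0 mulr_natl.
Qed.

Lemma sum_log_trunc (l : seq R[i]) K w :
  \sum_(a <- l) log_trunc K (a * w) =
  \sum_(k < K) (\sum_(a <- l) a ^+ k.+1) / k.+1%:R * w ^+ k.+1.
Proof.
rewrite /log_trunc exchange_big /=; apply: eq_bigr => k _.
rewrite mulrAC !mulr_suml; apply: eq_bigr => a _.
by rewrite exprMn.
Qed.

(** The product has no zero in [nc w < 8], so it has a logarithm there, whose real part is at most A
    on the circle of radius 4. Borel-Caratheodory bounds the coefficients of the logarithm; summing
    them at radius 2 bounds it and its derivative. *)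
Lemma zero_free_bounds (l : seq R[i]) A :
  (forall a, a \in l -> nc a <= 8^-1) ->
  (forall w, nc w = 4 -> nc (\prod_(a <- l) (1 - a * w)) <= expR A) ->
  forall w, nc w <= 2 ->
    expR (- (2 * A + 3)) <= nc (\prod_(a <- l) (1 - a * w)) /\
    nc (\sum_(a <- l) a / (1 - a * w)) <= 2 * A + 3.
Proof.
move=> l8 hA.
have aw a w : a \in l -> nc w <= 4 -> nc (a * w) <= 2^-1.
  move=> /l8 a8 w4; rewrite ncM (le_trans (ler_pM _ _ a8 w4)) ?nc_ge0 //; lra.
have pos a w : a \in l -> nc w <= 4 -> 0 < nc (1 - a * w).
  by move=> al w4; rewrite (lt_le_trans _ (nc_sub1_gt0 (aw _ _ al w4))).
(* K makes the total truncation error [eta] at most 1/2, so that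
   [2 * (A + eta) + eta <= 2 * A + 3]. *)
have [K hK] := ex_half_expn_le (size l).
pose eta : R := (size l)%:R * 2^-1 ^+ K.
have lnV w : nc w <= 4 -> `|ln (nc (\prod_(a <- l) (1 - a * w))) +
    complex.Re (\sum_(a <- l) log_trunc K (a * w))| <= eta.
  move=> w4; rewrite nc_prod ln_prod; last by move=> a al; apply: pos.
  rewrite cRe_sum -big_split /= (le_trans (ler_norm_sum _ _ _)) //.
  by apply: sum_seq_le_const => a al; apply: ln_nc_trunc; exact: aw.
pose s k := \sum_(a <- l) a ^+ k.
(* The Taylor polynomial of the logarithm of the product, whose coefficients are power sums. *)
pose P := \poly_(i < K.+1) (if i == 0%N then 0 else - (s i / i%:R)) : {poly R[i]}.
have hP w : P.[w] = - \sum_(a <- l) log_trunc K (a * w).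
  rewrite horner_poly big_ord_recl /= mul0r add0r sum_log_trunc -sumrN.
  by apply: eq_bigr => k _; rewrite mulNr.
have BC k : nc P`_k.+1 * 4 ^+ k.+1 <= 2 * (A + eta).
  apply: borel_caratheodory => //; first by rewrite coef_poly.
  move=> w w4; rewrite hP cReN.
  have w4' : nc w <= 4 by rewrite w4.
  have : ln (nc (\prod_(a <- l) (1 - a * w))) <= A.
    rewrite -[leRHS]expRK ler_ln ?posrE ?expR_gt0 ?hA //.
    by rewrite nc_prod prodr_gt0_seq // => a al; apply: pos.
  by have := lnV w w4'; rewrite ler_norml => /andP[]; lra.
have A0 : 0 <= A + eta.
  by have := BC 0%N; have := mulr_ge0 (nc_ge0 P`_1) (exprn_ge0 1 (ler0n R 4)); lra.
have Pk k : nc P`_k.+1 * 2 ^+ k.+1 <= 2 * (A + eta) * 2^-1 ^+ k.+1.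
  have -> : nc P`_k.+1 * 2 ^+ k.+1 = nc P`_k.+1 * 4 ^+ k.+1 * 2^-1 ^+ k.+1.
    by rewrite -mulrA -exprMn; congr (_ * _ ^+ _); field.
  by rewrite ler_wpM2r ?exprn_ge0.
move=> w w2; have w4 : nc w <= 4 by lra.
have eta2 : eta <= 2^-1 by [].
split.
  rewrite -[leRHS]lnK ?posrE; last first.
    by rewrite nc_prod prodr_gt0_seq // => a al; apply: pos.
  rewrite ler_expR.
  have : nc P.[w] <= 2 * (A + eta).
    rewrite horner_poly big_ord_recl /= mul0r add0r (le_trans (nc_sum _ _ _)) //.
    apply: (@le_trans _ _ (\sum_(k < K) 2 * (A + eta) * 2^-1 ^+ k.+1)); last first.
      by rewrite -mulr_sumr ler_piMr ?mulr_ge0 // sum_geo_half.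
    apply: ler_sum => k _; apply: le_trans (Pk k).
    rewrite coef_poly /= ltnS ltn_ord ncM ncX ler_wpM2l ?nc_ge0 //.
    by rewrite lerXn2r ?nnegrE ?nc_ge0.
  move=> h; have h1 := le_trans (nc_ge_Re _) h.
  have := lnV w w4; move: h1; rewrite hP cReN normrN !ler_norml => /andP[? ?] /andP[].
  lra.
have e a : a \in l -> a / (1 - a * w) =
    \sum_(k < K) a ^+ k.+1 * w ^+ k + a * (a * w) ^+ K / (1 - a * w).
  move=> al; have c0 : 1 - a * w != 0 by rewrite -nc_gt0 pos.
  have -> : \sum_(k < K) a ^+ k.+1 * w ^+ k = a * \sum_(k < K) (a * w) ^+ k.
    by rewrite mulr_sumr; apply: eq_bigr => k _; rewrite exprMn exprS mulrA.
  have e : (1 - a * w) * \sum_(k < K) (a * w) ^+ k = 1 - (a * w) ^+ K.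
    by rewrite -[RHS]opprB subrX1 -[RHS]mulNr opprB.
  apply: (mulIf c0); rewrite mulrDl !divfK // -mulrA [_ * (1 - _)]mulrC e.
  by ring.
rewrite big_seq (eq_bigr _ e) -big_seq big_split /=.
have h1 : nc (\sum_(a <- l) \sum_(k < K) a ^+ k.+1 * w ^+ k) <= 2 * (A + eta).
  rewrite exchange_big /=; under eq_bigr do rewrite -mulr_suml.
  rewrite (le_trans (nc_sum _ _ _)) //.
  apply: (@le_trans _ _ (\sum_(k < K) 2^-1 * (A + eta) * (k.+1%:R * 2^-1 ^+ k))); last first.
    rewrite -mulr_sumr (le_trans (ler_wpM2l _ (sum_arith_geo_half K))) ?mulr_ge0 //; lra.
  apply: ler_sum => k _.
  have sk : nc (\sum_(i <- l) i ^+ k.+1) = k.+1%:R * nc P`_k.+1.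
    rewrite coef_poly /= ltnS ltn_ord ncN ncM ncV nc_nat mulrC divfK ?pnatr_eq0 //.
  have h2 : 2 * (nc P`_k.+1 * 2 ^+ k) <= (A + eta) * 2^-1 ^+ k.
    by have := Pk k; rewrite !exprS; lra.
  rewrite ncM ncX sk -mulrA [leRHS]mulrCA ler_wpM2l //.
  apply: (@le_trans _ _ (nc P`_k.+1 * 2 ^+ k)); last by lra.
  by rewrite ler_wpM2l ?nc_ge0 // lerXn2r ?nnegrE ?nc_ge0.
have h2 : nc (\sum_(a <- l) a * (a * w) ^+ K / (1 - a * w)) <= eta.
  rewrite (le_trans (nc_sum _ _ _)) //; apply: sum_seq_le_const => a al.
  rewrite !ncM ncX ncV.
  have a8 := l8 a al; have h := nc_sub1_gt0 (aw a w al w4).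
  have i2 : (nc (1 - a * w))^-1 <= 2.
    by rewrite -[leRHS]invrK lef_pV2 ?posrE // pos.
  have h3 : nc (a * w) ^+ K <= 2^-1 ^+ K.
    by rewrite lerXn2r ?nnegrE ?nc_ge0 // aw.
  have -> : 2^-1 ^+ K = 2^-1 * 2^-1 ^+ K * 2 :> R by field.
  apply: ler_pM; rewrite ?mulr_ge0 ?exprn_ge0 ?nc_ge0 ?invr_ge0 ?nc_ge0 //.
  by apply: ler_pM; rewrite ?exprn_ge0 ?nc_ge0 //; lra.
by rewrite (le_trans (ncD _ _)) //; lra.
Qed.

End LocalFactorization.

Section LocalFactorization.
Context {R : realType}.
Implicit Types (x y z w a : R[i]) (s t r A K : R) (F G : {poly R[i]}).

Lemma expR1_le4 : expR 1 <= 4 :> R.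
Proof.
have h : 2^-1 <= expR (- 2^-1) :> R by rewrite (le_trans _ (expR_ge1Dx _)) //; lra.
have e : (1 : R) = 2^-1 + 2^-1 by field.
have h2 : expR 2^-1 <= 2 :> R.
  by rewrite -[leRHS]invrK -[X in expR X]opprK expRN lef_pV2 ?posrE ?expR_gt0.
rewrite [X in expR X]e expRD (_ : 4 = 2 * 2 :> R) ?ler_pM ?expR_ge0 //; ring.
Qed.

Lemma deriv_prod_XsubC (l : seq R[i]) z : (forall a, a \in l -> z != a) ->
  (\prod_(a <- l) ('X - a%:P))^`().[z] =
  (\prod_(a <- l) (z - a)) * \sum_(a <- l) (z - a)^-1.
Proof.
elim: l => [|a l IH] h; first by rewrite !big_nil derivC horner0 mulr0.
rewrite !big_cons derivM hornerD !hornerM derivXsubC hornerC mul1r IH.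
  have za : z - a != 0 by rewrite subr_eq0 h ?mem_head.
  rewrite horner_prod hornerXsubC mulrDr [_ * _ / _]mulrAC divff // mul1r mulrA.
  by congr (_ + _); apply: eq_bigr => b _; rewrite hornerXsubC.
by move=> b bl; apply: h; rewrite in_cons bl orbT.
Qed.

Lemma expr_size_prod (I : Type) (l : seq I) (c : R) (f : I -> R) :
  c ^+ size l * \prod_(i <- l) f i = \prod_(i <- l) (c * f i).
Proof.
elim: l => [|i l IH]; first by rewrite !big_nil mul1r.
by rewrite !big_cons -IH /= exprS; ring.
Qed.

(** The roots are split at distance 8 from z0. The near ones are counted as in Jensen's formula; the
    cofactor G has no zero within distance 8 and inherits the growth bound, so [zero_free_bounds]
    controls G and its logarithmic derivative up to distance 2. *)
Lemma local_factorization F z0 K (b : R) : 0 < b -> b <= nc F.[z0] ->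
  (forall z, nc (z - z0) = 40 -> nc F.[z] <= expR K * b) ->
  exists zs G, [/\ F = \prod_(z <- zs) ('X - z%:P) * G,
    (size zs)%:R <= K,
    (forall z, z \in zs -> nc (z - z0) < 8) &
    (forall x, nc (x - z0) <= 2 ->
      b * 8^-1 ^+ size zs * expR (- (2 * K + 5)) <= nc G.[x] /\
      nc G^`().[x] <= (2 * K + 5) * nc G.[x])].
Proof.
move=> b0 bF hF.
have [rs Frs] := closed_field_poly_normal F.
set c := lead_coef F in Frs.
pose near := fun z => nc (z - z0) < 8.
pose zs := seq.filter near rs; pose ws := seq.filter (predC near) rs.
pose G := c *: \prod_(z <- ws) ('X - z%:P).
have FG : F = \prod_(z <- zs) ('X - z%:P) * G.
  rewrite {1}Frs /G -scalerAr; congr (_ *: _).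
  rewrite -big_cat /=; apply: perm_big; rewrite perm_sym.
  by rewrite perm_filterC.
have Fev z : F.[z] = (\prod_(a <- zs) (z - a)) * G.[z].
  rewrite FG hornerM horner_prod; congr (_ * _).
  by apply: eq_bigr => a _; rewrite hornerXsubC.
have ws8 a : a \in ws -> 8 <= nc (a - z0).
  by rewrite mem_filter /= -leNgt => /andP[].
have zs8 a : a \in zs -> nc (a - z0) < 8 by rewrite mem_filter => /andP[].
pose l := [seq (a - z0)^-1 | a <- ws].
pose V w := \prod_(a <- l) (1 - a * w).
have wsn a : a \in ws -> a - z0 != 0.
  by move=> /ws8 h; rewrite -nc_gt0 (lt_le_trans _ h).
have GV z : G.[z] = G.[z0] * V (z - z0).
  rewrite /G !hornerZ !horner_prod -mulrA; congr (_ * _).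
  rewrite /V big_map -big_split /= big_seq [RHS]big_seq; apply: eq_bigr => a /wsn h.
  by rewrite !hornerXsubC; field.
have F0 : 0 < nc F.[z0] by apply: lt_le_trans bF.
have G0 : 0 < nc G.[z0].
  move: F0; rewrite Fev ncM => h; rewrite lt0r nc_ge0 andbT.
  by apply: contraTneq h => ->; rewrite mulr0 ltxx.
have l8 a : a \in l -> nc a <= 8^-1.
  move=> /mapP[d /ws8 d8 ->]; rewrite ncV lef_pV2 ?posrE //.
  exact: lt_le_trans d8.
pose N := size zs.
pose VP := \prod_(a <- l) (1 - a *: 'X) : {poly R[i]}.
have VPe w : VP.[w] = V w.
  rewrite horner_prod; apply: eq_bigr => a _.
  by rewrite hornerD hornerN hornerZ hornerX -polyC1 hornerC.
(* On the circle of radius 40 every near root a satisfies [|z0 + w - a| >= 32 >= 4 * |z0 - a|], so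
   the near roots use up a factor [4 ^ N] of the growth. *)
have V40 w : nc w = 40 -> nc VP.[w] <= expR K / 4 ^+ N.
  move=> w40; rewrite VPe ler_pdivlMr ?exprn_gt0 //.
  have h1 : nc F.[z0 + w] <= expR K * nc F.[z0].
    rewrite (le_trans (hF _ _)) ?ler_wpM2l ?expR_ge0 //.
    by rewrite addrAC subrr add0r.
  rewrite -(ler_pM2r F0) (le_trans _ h1) //.
  rewrite !Fev (GV (z0 + w)) [z0 + w - z0]addrAC subrr add0r !ncM.
  rewrite (_ : nc (V w) * _ * _ =
     (4 ^+ N * nc (\prod_(a <- zs) (z0 - a))) * (nc G.[z0] * nc (V w))); last by ring.
  rewrite ler_wpM2r ?mulr_ge0 ?nc_ge0 // !nc_prod.
  rewrite expr_size_prod; apply: ler_prod_seq => a /zs8 a8.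
  rewrite mulr_ge0 ?nc_ge0 //=.
  have h2 : 40 - nc (a - z0) <= nc (z0 + w - a).
    by rewrite -w40 (_ : z0 + w - a = w - (a - z0)) ?nc_subr //; ring.
  by rewrite (ncBC z0); lra.
have V0 : V 0 = 1.
  by rewrite /V big1 // => a _; rewrite mulr0 subr0.
exists zs, G; split=> //.
  (* At the centre this gives [4 ^ N <= expR K], hence [N <= K] because e is at most 4. *)
  have := @max_principle R VP 40 0 _ _ V40.
  rewrite nc0 mul0r subr0 divr1 VPe V0 nc1 => /(_ (ltr0n _ _)).
  rewrite ler_pdivlMr ?exprn_gt0 // mul1r => h.
  rewrite -ler_expR; apply: le_trans h.
  rewrite -[N%:R]mulr1 expRM_natl lerXn2r ?nnegrE ?expR_ge0 //.
  exact: expR1_le4.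
move=> t t2.
(* From radius 40 to radius 4 the maximum principle loses 10/9, less than e; with [A = K + 1] the
   bound [2 * A + 3] becomes [2 * K + 5]. *)
have VA w : nc w = 4 -> nc (V w) <= expR (K + 1).
  move=> w4; rewrite -VPe (le_trans (max_principle _ V40)) ?w4 //; first lra.
  have h4 : (4 ^+ N)^-1 <= 1 :> R by rewrite invf_le1 ?exprn_gt0 // exprn_ege1 //; lra.
  have h1 : 2 <= expR 1 :> R by have := @expR_ge1Dx R 1; lra.
  rewrite expRD -mulrA ler_wpM2l ?expR_ge0 //.
  rewrite ler_pdivrMr; last lra.
  by rewrite (le_trans h4) //; lra.
have [hl hu] := zero_free_bounds l8 VA t2.
have e23 : 2 * (K + 1) + 3 = 2 * K + 5 by ring.
rewrite e23 in hl hu.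
split.
  rewrite GV ncM; apply: ler_pM => //; rewrite ?expR_ge0 ?mulr_ge0 ?exprn_ge0 ?invr_ge0 ?(ltW b0) //.
  rewrite (le_trans (ler_wpM2r _ bF)) ?exprn_ge0 // Fev ncM mulrAC ler_piMl ?nc_ge0 //.
  rewrite nc_prod mulrC expr_size_prod.
  apply: (@le_trans _ _ (\prod_(a <- zs) 1)); last by rewrite big1_eq.
  apply: ler_prod_seq => a /zs8 a8; rewrite mulr_ge0 ?nc_ge0 //=.
  by rewrite ncBC; lra.
have tn a : a \in ws -> t != a.
  move=> /ws8; apply: contraTneq => <-; rewrite -ltNge; lra.
rewrite /G derivZ !hornerZ deriv_prod_XsubC // horner_prod.
under [in leRHS]eq_bigr do rewrite hornerXsubC.
rewrite mulrA ncM mulrC ler_wpM2r ?nc_ge0 //.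
rewrite (_ : \sum_(a <- ws) (t - a)^-1 = - \sum_(a <- l) a / (1 - a * (t - z0))) ?ncN //.
rewrite big_map -sumrN big_seq [RHS]big_seq; apply: eq_bigr => a aw.
have h1 := wsn a aw; have h2 : t - a != 0 by rewrite subr_eq0 tn.
have h3 : 1 - (a - z0)^-1 * (t - z0) != 0.
  apply: contra h2 => /eqP h3; apply/eqP.
  have -> : t - a = - (a - z0) * (1 - (a - z0)^-1 * (t - z0)) by field.
  by rewrite h3 mulr0.
field; rewrite h1 h2 /= andbT.
rewrite (_ : _ - _ - _ = - (t - a)) ?oppr_eq0 //; ring.
Qed.

End LocalFactorization.

(** * Growth of exponential sums *)

Section Growth.
Context {R : realType}.

Lemma exp_partial (x : R) L : 0 <= x -> \sum_(m < L) x ^+ m / m`!%:R <= expR x.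
Proof.
move=> x0; rewrite -(big_mkord xpredT (fun m => x ^+ m / m`!%:R)).
apply: (@nondecreasing_cvgn_le R (series (exp_coeff x))); last exact: is_cvg_series_exp_coeff.
by apply: nondecreasing_series => k _ _; exact: exp_coeff_ge0.
Qed.

Lemma sum_shift_le (f : nat -> R) j L : (forall i, 0 <= f i) ->
  \sum_(m < L) (if (j <= m)%N then f (m - j)%N else 0) <= \sum_(m < L) f m.
Proof.
move=> f0; elim: j L => [|j IH] L.
  by apply: ler_sum => m _; rewrite subn0.
case: L => [|L]; first by rewrite !big_ord0.
rewrite big_ord_recl /= add0r (le_trans (IH L)) // big_ord_recr /=.
by rewrite lerDl.
Qed.

Section Pascal.
Variables (u : nat -> nat -> R) (D : R) (n : nat).
Hypotheses (D0 : 0 <= D) (u0 : forall k m, 0 <= u k m)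
  (un : forall k m, (n <= k)%N -> u k m = 0)
  (up : forall k m, u k m.+1 <= D * u k m + u k.+1 m)
  (down : forall k m, u k.+1 m <= u k m.+1 + D * u k m).

Lemma binD_rec m j : ('C(m.+1, j.+1)%:R * D ^+ (m.+1 - j.+1) : R) =
  D * ('C(m, j.+1)%:R * D ^+ (m - j.+1)) + 'C(m, j)%:R * D ^+ (m - j).
Proof.
rewrite binS subSS natrD mulrDl; congr (_ + _).
have [mj|jm] := leqP m j; first by rewrite bin_small // !mul0r mulr0.
by rewrite mulrCA -exprS -subSn.
Qed.

Lemma pascal_up m k N : (m < N)%N ->
  u k m <= \sum_(j < N) 'C(m, j)%:R * D ^+ (m - j) * u (k + j)%N 0%N.
Proof.
elim: m k N => [|m IH] k [//|N] mN.
  rewrite big_ord_recl /= addn0 mul1r mul1r lerDl sumr_ge0 // => j _.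
  by rewrite mulr_ge0 // mulr_ge0 // exprn_ge0.
rewrite (le_trans (up k m)) // big_ord_recl /= bin0 mul1r subn0 addn0.
under eq_bigr => j _ do rewrite /bump add1n binD_rec mulrDl.
rewrite big_split /= addrA; apply: lerD; last first.
  by apply: le_trans (IH k.+1 N _) _ => //; apply: ler_sum => j _; rewrite addSnnS.
apply: le_trans (ler_wpM2l D0 (IH k N.+1 (leqW mN))) _.
rewrite big_ord_recl /= bin0 mul1r subn0 addn0 mulrDr mulrA -exprS lerD2l.
by rewrite mulr_sumr; apply: ler_sum => j _; rewrite /bump add1n !mulrA.
Qed.

Lemma pascal_down k m : u k m <= \sum_(i < k.+1) 'C(k, i)%:R * D ^+ (k - i) * u 0%N (m + i)%N.
Proof.
elim: k m => [|k IH] m; first by rewrite big_ord1 addn0 !mul1r.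
rewrite (le_trans (down k m)) // big_ord_recl /= bin0 mul1r subn0 addn0.
under eq_bigr => j _ do rewrite /bump add1n binD_rec mulrDl.
rewrite big_split /= [leRHS]addrA [leLHS]addrC; apply: lerD; last first.
  by apply: le_trans (IH m.+1) _ => //; apply: ler_sum => j _; rewrite addSnnS.
apply: le_trans (ler_wpM2l D0 (IH m)) _.
rewrite big_ord_recl /= bin0 mul1r subn0 addn0 mulrDr mulrA -exprS lerD2l.
rewrite big_ord_recr /= bin_small // mul0r mulr0 mul0r addr0.
by rewrite mulr_sumr; apply: ler_sum => j _; rewrite /bump add1n !mulrA.
Qed.

Lemma bin_factR m j : (j <= m)%N ->
  'C(m, j)%:R / m`!%:R = (j`!%:R)^-1 * ((m - j)`!%:R)^-1 :> R.
Proof.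
move=> jm; rewrite -(bin_fact jm) !natrM; field.
by rewrite !pnatr_eq0 -!lt0n !fact_gt0 bin_gt0 jm.
Qed.

(** All derivatives are bounded by the first n: [pascal_up] leads to the [u j 0], which vanish for
    [j >= n], and [pascal_down] returns to derivatives of order at most j. Each passage is a
    convolution with the exponential series and costs [expR (rho * D)]. *)
Lemma growth_sum (r rho b : R) (L : nat) : 0 < r -> 0 <= rho ->
  (forall i, (i < n)%N -> u 0%N i * r ^+ i / i`!%:R <= b) ->
  \sum_(m < L) u 0%N m * rho ^+ m / m`!%:R <=
    expR (2 * D * rho) * (\sum_(i < n) (rho / r) ^+ i) * b.
Proof.
move=> r0 rho0 hb.
have step1 : \sum_(m < L) u 0%N m * rho ^+ m / m`!%:R <=
    \sum_(j < L) u j 0%N * (rho ^+ j / j`!%:R) * expR (rho * D).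
  apply: (@le_trans _ _ (\sum_(m < L) \sum_(j < L)
      'C(m, j)%:R * D ^+ (m - j) * u j 0%N * (rho ^+ m / m`!%:R))).
    apply: ler_sum => m _; rewrite -mulr_suml -mulrA.
    by rewrite ler_wpM2r ?divr_ge0 ?exprn_ge0 //; exact: pascal_up.
  rewrite exchange_big /=; apply: ler_sum => j _.
  rewrite (eq_bigr (fun m : 'I_L => u j 0%N * (rho ^+ j / j`!%:R) *
     (if (j <= m)%N then (rho * D) ^+ (m - j) / (m - j)`!%:R else 0))); last first.
    move=> m _; case: leqP => [jm|mj]; last by rewrite bin_small // !mul0r mulr0.
    have h := bin_factR jm.
    rewrite mulrAC [_ * (_ / _)]mulrCA [X in X * u j 0%N]mulrC -!mulrA.
    transitivity (u j 0%N * (rho ^+ m * D ^+ (m - j)) * ('C(m, j)%:R / m`!%:R)); first by ring.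
    by rewrite h -{1}(subnKC jm) exprD exprMn; ring.
  rewrite -mulr_sumr ler_wpM2l ?mulr_ge0 ?exprn_ge0 ?invr_ge0 //.
  apply: le_trans (exp_partial L (mulr_ge0 rho0 D0)).
  exact: (@sum_shift_le (fun m => (rho * D) ^+ m / m`!%:R)
    j L (fun i => divr_ge0 (exprn_ge0 i (mulr_ge0 rho0 D0)) (ler0n _ _))).
apply: (le_trans step1).
have b0 : 0 <= b \/ n = 0%N.
  have [->|n0] := posnP n; [by right|left].
  by apply: le_trans (hb 0%N n0); rewrite expr0 mulr1 fact0 divr1.
have pos i d : 0 <= (rho / r) ^+ i * ((rho * D) ^+ d / d`!%:R).
  by rewrite mulr_ge0 ?divr_ge0 ?exprn_ge0 ?divr_ge0 ?mulr_ge0 // ltW.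
have step2 j : (j < n)%N -> u j 0%N * (rho ^+ j / j`!%:R) <=
   b * \sum_(i < n) (if (i <= j)%N then (rho / r) ^+ i * ((rho * D) ^+ (j - i) / (j - i)`!%:R) else 0).
  move=> jn; have := pascal_down j 0.
  move=> /(ler_wpM2r (divr_ge0 (exprn_ge0 j rho0) (ler0n R j`!))) h.
  apply: (le_trans h); rewrite mulr_suml mulr_sumr.
  rewrite (big_ord_widen n (fun i => 'C(j, i)%:R * D ^+ (j - i) * u 0%N (0 + i)%N * (rho ^+ j / j`!%:R))) //.
  rewrite big_mkcond /=; apply: ler_sum => i _; rewrite ltnS; case: leqP => [ij|]; last by rewrite mulr0.
  rewrite add0n.
  have hf := bin_factR ij.
  have -> : 'C(j, i)%:R * D ^+ (j - i) * u 0%N i * (rho ^+ j / j`!%:R) =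
     (u 0%N i * r ^+ i / i`!%:R) * ((rho / r) ^+ i * ((rho * D) ^+ (j - i) / (j - i)`!%:R)).
    transitivity (D ^+ (j - i) * u 0%N i * rho ^+ j * ('C(j, i)%:R / j`!%:R)); first by ring.
    have -> : rho ^+ j = rho ^+ i * rho ^+ (j - i) by rewrite -exprD subnKC.
    rewrite hf !exprMn exprVn; field.
    by rewrite !pnatr_eq0 -!lt0n !fact_gt0 expf_neq0 // gt_eqF.
  by rewrite ler_wpM2r // hb // (leq_ltn_trans ij).
have inner0 i j : 0 <= (if (i <= j)%N then (rho / r) ^+ i * ((rho * D) ^+ (j - i) / (j - i)`!%:R) else 0).
  by case: ifP => // _; exact: pos.
rewrite -mulr_suml mulrC -mulrA (_ : 2 * D * rho = rho * D + rho * D); last by ring.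
rewrite expRD -mulrA ler_wpM2l ?expR_ge0 //.
case: b0 => [b0|n0]; last first.
  rewrite n0 big_ord0 mul0r mulr0 big1 // => j _; rewrite un ?mul0r // n0 //.
rewrite mulrA [leRHS]mulrC.
apply: (@le_trans _ _ (b * \sum_(j < L) \sum_(i < n) (if (i <= j)%N then (rho / r) ^+ i * ((rho * D) ^+ (j - i) / (j - i)`!%:R) else 0))).
  rewrite mulr_sumr; apply: ler_sum => j _.
  have [nj|jn] := leqP n j; last exact: step2.
  by rewrite un // mul0r mulr_ge0 // sumr_ge0.
rewrite ler_wpM2l // exchange_big /= mulr_sumr; apply: ler_sum => i _.
rewrite (eq_bigr (fun j : 'I_L => (rho / r) ^+ i * (if (i <= j)%N then (rho * D) ^+ (j - i) / (j - i)`!%:R else 0))); last first.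
  by move=> j _; case: ifP => // _; rewrite mulr0.
rewrite -mulr_sumr mulrC ler_wpM2r ?exprn_ge0 ?divr_ge0 ?(ltW r0) //.
apply: le_trans (exp_partial L (mulr_ge0 rho0 D0)).
exact: (@sum_shift_le (fun m => (rho * D) ^+ m / m`!%:R)
    i L (fun i => divr_ge0 (exprn_ge0 i (mulr_ge0 rho0 D0)) (ler0n _ _))).
Qed.

End Pascal.

End Growth.

Section ExpSums.
Context {R : realType}.
Implicit Types (x y z w l : R[i]) (s : seq (R[i] * R[i])).

Definition expsum s z : R[i] := \sum_(e <- s) e.1 * cexp (e.2 * z).

(** The m-th derivative of [expsum s] at z. *)
Definition mom s z (m : nat) : R[i] := \sum_(e <- s) e.1 * cexp (e.2 * z) * e.2 ^+ m.

(* The exponential sum (d/dz - l) p. *)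
Definition ediff l s := [seq (e.1 * (e.2 - l), e.2) | e <- s].

(* The Taylor polynomial of [expsum s] at z, in the increment. *)
Definition tay s z (L : nat) : {poly R[i]} := \poly_(m < L) (mom s z m / m`!%:R).

Lemma tayE s z L w :
  (tay s z L).[w] = \sum_(e <- s) e.1 * cexp (e.2 * z) * exp_trunc L (e.2 * w).
Proof.
rewrite horner_poly /mom /exp_trunc.
under eq_bigr do rewrite mulrAC -mulrA mulr_suml.
rewrite exchange_big /=; apply: eq_bigr => e _; rewrite mulr_sumr.
by apply: eq_bigr => m _; rewrite exprMn; ring.
Qed.

(** The threshold is uniform in the centre z as well, because [cluster_pairs] compares expansions at
    0 and at t. *)
Lemma tay_approx s (Z eta : R) : 0 <= Z -> 0 < eta ->
  exists L0, forall L z w, (L0 <= L)%N -> nc z <= Z -> nc w <= Z ->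
    nc ((tay s z L).[w] - expsum s (z + w)) <= eta.
Proof.
move=> Z0 eta0.
pose B := \sum_(e <- s) nc e.1 * expR (nc e.2 * Z).
have B0 : 0 <= B by rewrite sumr_ge0 // => e _; rewrite mulr_ge0 ?nc_ge0 ?expR_ge0.
pose M := \sum_(e <- s) nc e.2.
have M0 : 0 <= M by rewrite sumr_ge0 // => e _; exact: nc_ge0.
have B1 : 0 < B + 1 by rewrite ltr_wpDl.
have [L0 hL0] := exp_trunc_approx (mulr_ge0 M0 Z0) (divr_gt0 eta0 B1).
exists L0 => L z w LL zZ wZ.
rewrite tayE /expsum -sumrB (le_trans (nc_sum _ _ _)) //.
apply: (@le_trans _ _ (\sum_(e <- s) nc e.1 * expR (nc e.2 * Z) * (eta / (B + 1)))).
  rewrite big_seq [leRHS]big_seq; apply: ler_sum => e es.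
  rewrite mulrDr cexpD mulrA -mulrBr !ncM.
  apply: ler_pM; rewrite ?mulr_ge0 ?nc_ge0 //.
    rewrite ler_wpM2l ?nc_ge0 // (le_trans (nc_cexp_le _)) // ler_expR ncM.
    by rewrite ler_wpM2l ?nc_ge0.
  rewrite ncBC hL0 // ncM ler_pM ?nc_ge0 //.
  rewrite /M (big_rem e) //= lerDl sumr_ge0 // => f _; exact: nc_ge0.
rewrite -mulr_suml mulrA ler_pdivrMr // mulrC ler_wpM2l ?(ltW eta0) //.
by rewrite -/B lerDl.
Qed.

Lemma mom_ediff0 s z m : mom (ediff 0 s) z m = mom s z m.+1.
Proof.
by rewrite /mom big_map; apply: eq_bigr => e _ /=; rewrite subr0 exprS; ring.
Qed.

Lemma tay_deriv s z L : (tay s z L.+1)^`() = tay (ediff 0 s) z L.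
Proof.
apply/polyP => k; rewrite coef_deriv !coef_poly ltnS mom_ediff0.
case: ltnP => kL; last by rewrite mul0rn.
rewrite factS natrM -mulr_natr; field.
by rewrite pnatr_eq0 -lt0n fact_gt0 addrC natr1 pnatr_eq0.
Qed.

(** A sum of n exponentials solves a linear differential equation of order n, so its first n Taylor
    coefficients control it on every disc. For [rho > r] the growth is essentially
    [(rho / r) ^ (n - 1)] when [D * rho] is small, whatever the length L. *)
Lemma growth_tay s z (n L : nat) (D r rho b : R) :
  (size s <= n)%N -> (n <= L)%N -> (forall e, e \in s -> nc e.2 <= D) -> 0 <= D ->
  0 < r -> 0 <= rho -> (forall k, nc (tay s z L)`_k * r ^+ k <= b) ->
  forall w, nc w <= rho ->
    nc (tay s z L).[w] <= expR (2 * D * rho) * (\sum_(i < n) (rho / r) ^+ i) * b.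
Proof.
move=> sn nL hD D0 r0 rho0 hb w wr.
pose ls := [seq e.2 | e <- s].
(* The m-th derivative at z after the first k operators d - l have been applied; it vanishes once
   all the exponents are used up. *)
pose c k m : R[i] := \sum_(e <- s) e.1 * cexp (e.2 * z) * e.2 ^+ m *
   \prod_(l <- take k ls) (e.2 - l).
have cge k m : (size s <= k)%N -> c k m = 0.
  move=> sk; rewrite /c take_oversize ?size_map // big_seq big1 // => e es.
  rewrite (big_rem e.2) ?map_f //=; by rewrite subrr mul0r mulr0.
have crec k m : exists2 l, nc l <= D & c k m.+1 = l * c k m + c k.+1 m.
  have [sk|ks] := leqP (size s) k.
    by exists 0; rewrite ?nc0 // !cge ?(leqW sk) // mul0r add0r.
  exists (nth 0 ls k).
    have /mapP[e es ->] : nth 0 ls k \in ls by rewrite mem_nth ?size_map.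
    exact: hD.
  rewrite /c mulr_sumr -big_split /=; apply: eq_bigr => e _.
  rewrite (take_nth 0) ?size_map // -cats1 big_cat big_seq1 /= exprS; ring.
pose u k m := nc (c k m).
have e0 m : u 0%N m = nc (mom s z m).
  by rewrite /u /c /mom; congr nc; apply: eq_bigr => e _; rewrite take0 big_nil mulr1.
have P1 k m : u k m.+1 <= D * u k m + u k.+1 m.
  have [l hl e] := crec k m.
  by rewrite /u e (le_trans (ncD _ _)) // lerD2r ncM ler_wpM2r ?nc_ge0.
have P2 k m : u k.+1 m <= u k m.+1 + D * u k m.
  have [l hl e] := crec k m.
  have e' : c k.+1 m = c k m.+1 - l * c k m by rewrite e; ring.
  by rewrite /u e' (le_trans (ncB _ _)) // lerD2l ncM ler_wpM2r ?nc_ge0.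
have P3 k m : (n <= k)%N -> u k m = 0.
  by move=> nk; rewrite /u cge ?nc0 // (leq_trans sn).
have := @growth_sum R u D n D0 (fun k m => nc_ge0 _) P3 P1 P2 r rho b L r0 rho0.
have hc m : (m < L)%N -> nc (tay s z L)`_m = u 0%N m / m`!%:R.
  by move=> mL; rewrite coef_poly mL ncM ncV nc_nat e0.
move=> h; apply: le_trans (h _); last first.
  by move=> i iN; have := hb i; rewrite hc ?(leq_trans iN) // mulrAC.
rewrite (horner_coef_wide _ (size_poly _ _)) (le_trans (nc_sum _ _ _)) //.
apply: ler_sum => m _; rewrite ncM ncX hc // mulrAC.
rewrite ler_wpM2r ?invr_ge0 // ler_wpM2l ?nc_ge0 //.
by rewrite lerXn2r ?nnegrE ?nc_ge0.
Qed.

End ExpSums.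

(** * Multipliers with zeros and poles in the lower half-plane *)

Section Pairs.
Context {R : realType}.
Implicit Types (x y z w : R[i]) (zs ws : seq R[i]) (ps qs : seq (R[i] * R[i])) (t : R).

(** Each pair consists of a zero and a pole of the multiplier Phi, in this order. *)
Definition pratio ps x : R := \prod_(p <- ps) (nc (x - p.1) / nc (x - p.2)).

(** Poles may be real, where the division yields 0; the lower bound is therefore asked off the poles
    only. *)
Definition good_pairs ps :=
  (forall p, p \in ps -> complex.Im p.1 <= 0 /\ complex.Im p.2 <= 0) /\
  (forall t, (forall p, p \in ps -> t%:C != p.2) -> 1 <= pratio ps t%:C).

Lemma pratio_ge0 ps x : 0 <= pratio ps x.
Proof. by rewrite prodr_ge0 // => p _; rewrite divr_ge0 ?nc_ge0. Qed.

Lemma pratio_cat ps qs x : pratio (ps ++ qs) x = pratio ps x * pratio qs x.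
Proof. exact: big_cat. Qed.

Lemma good_cat ps qs : good_pairs ps -> good_pairs qs -> good_pairs (ps ++ qs).
Proof.
move=> [h1 h2] [h3 h4]; split=> [p|t h].
  by rewrite mem_cat => /orP[/h1|/h3].
rewrite pratio_cat -[1]mulr1 ler_pM //.
  by apply: h2 => p pps; apply: h; rewrite mem_cat pps.
by apply: h4 => p pps; apply: h; rewrite mem_cat pps orbT.
Qed.

Lemma good_nil : good_pairs [::].
Proof. by split=> // t _; rewrite /pratio big_nil. Qed.

Lemma pratio_zip ws zs x : size ws = size zs ->
  pratio (zip ws zs) x = nc (\prod_(w <- ws) (x - w)) / nc (\prod_(z <- zs) (x - z)).
Proof.
rewrite /pratio; elim: ws zs => [|w ws IH] [|z zs] //= => [_|[e]].
  by rewrite !big_nil nc1 divr1.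
by rewrite !big_cons IH //= !ncM invfM; ring.
Qed.

Lemma Im_inv z : complex.Im z^-1 = - complex.Im z / nc z ^+ 2.
Proof. by rewrite sqr_nc; case: z => a b /=; rewrite mulNr. Qed.

Lemma Re_iM z : complex.Re ('i * z) = - complex.Im z.
Proof. by case: z => a b /=; rewrite mul0r mul1r sub0r. Qed.

Lemma nc_1D_ge x : 0 <= complex.Re x -> 1 <= nc (1 + x) /\ nc x <= nc (1 + x).
Proof.
move=> h.
have e : nc (1 + x) ^+ 2 = 1 + 2 * complex.Re x + nc x ^+ 2.
  by rewrite !sqr_nc cReD cImD /=; ring.
split; rewrite -(@ler_pXn2r _ 2) ?nnegrE ?nc_ge0 // e.
  by rewrite expr1n; have := sqr_ge0 (nc x); lra.
by lra.
Qed.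

Lemma nc_i_sub z : complex.Im z <= 0 -> 1 <= nc ('i - z).
Proof.
move=> h; apply: le_trans (nc_ge_Im _); rewrite cImD cImN /=.
by rewrite (le_trans _ (ler_norm _)) //; lra.
Qed.

Lemma nc_sum_inv_i zs : (forall z, z \in zs -> complex.Im z <= 0) ->
  nc (\sum_(z <- zs) ('i - z)^-1) <= (size zs)%:R.
Proof.
move=> h; rewrite (le_trans (nc_sum _ _ _)) // -[leRHS]mulr1.
apply: sum_seq_le_const => z /h /nc_i_sub h1.
by rewrite ncV invf_le1 // (lt_le_trans _ h1).
Qed.

Lemma Re_i_sum_inv zs x : (forall z, z \in zs -> complex.Im z <= 0) ->
  0 <= complex.Im x -> 0 <= complex.Re ('i * \sum_(z <- zs) (x - z)^-1).
Proof.
move=> h x0; rewrite Re_iM cIm_sum -sumrN big_seq sumr_ge0 // => z /h z0.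
rewrite Im_inv mulNr opprK divr_ge0 ?exprn_ge0 ?nc_ge0 //.
rewrite cImD cImN; lra.
Qed.

(* Boole's identity for sums of simple poles in the closed lower half-plane:
   1 + (i/a) sum 1/(x - z) is a quotient of monic polynomials all of whose
   roots stay in that half-plane, and it dominates both 1 and the sum. *)
Lemma boole_lower zs (a : R) : (forall z, z \in zs -> complex.Im z <= 0) -> 0 < a ->
  exists ws, [/\ size ws = size zs, (forall w, w \in ws -> complex.Im w <= 0),
    good_pairs (zip ws zs), pratio (zip ws zs) 'i <= expR ((size zs)%:R / a) &
    (forall t, (forall z, z \in zs -> t%:C != z) ->
       nc (\sum_(z <- zs) (t%:C - z)^-1) <= a * pratio (zip ws zs) t%:C)].
Proof.
move=> zl a0.
pose P := \prod_(z <- zs) ('X - z%:P) : {poly R[i]}.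
pose k : R[i] := a^-1%:C * 'i.
pose Q := P + k *: P^`().
have sP : size P = (size zs).+1 by rewrite size_prod_XsubC.
have Pm : P \is monic by rewrite monic_prod_XsubC.
have sPQ : (size (k *: P^`()) < size P)%N.
  by rewrite (leq_ltn_trans (size_scale_leq _ _)) // lt_size_deriv // monic_neq0.
have sQ : size Q = (size zs).+1 by rewrite size_polyDl.
have lQ : lead_coef Q = 1 by rewrite lead_coefDl // (monicP Pm).
have [ws Qws] := closed_field_poly_normal Q.
rewrite lQ scale1r in Qws.
have sws : size ws = size zs.
  by move: sQ; rewrite Qws size_prod_XsubC => -[].
have Pe x : P.[x] = \prod_(z <- zs) (x - z).
  by rewrite horner_prod; apply: eq_bigr => z _; rewrite hornerXsubC.
have Qe x : Q.[x] = \prod_(w <- ws) (x - w).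
  by rewrite Qws horner_prod; apply: eq_bigr => z _; rewrite hornerXsubC.
have PQ x : (forall z, z \in zs -> x != z) ->
    Q.[x] = P.[x] * (1 + k * \sum_(z <- zs) (x - z)^-1).
  move=> hx; rewrite hornerD hornerZ deriv_prod_XsubC // -Pe; ring.
have nP x : (forall z, z \in zs -> x != z) -> nc P.[x] != 0.
  move=> hx; rewrite nc_eq0 Pe prodf_seq_neq0; apply/allP => z /hx h /=.
  by rewrite subr_eq0.
have rE x : (forall z, z \in zs -> x != z) ->
    pratio (zip ws zs) x = nc (1 + k * \sum_(z <- zs) (x - z)^-1).
  by move=> hx; rewrite pratio_zip // -Pe -Qe PQ // ncM mulrAC divff ?mul1r ?nP.
have Rek x : 0 <= complex.Im x -> 0 <= complex.Re (k * \sum_(z <- zs) (x - z)^-1).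
  move=> hx; rewrite /k -mulrA Re_scale mulr_ge0 ?invr_ge0 ?(ltW a0) //.
  exact: Re_i_sum_inv.
have nk : nc k = a^-1 by rewrite ncM nc_i mulr1 nc_real ger0_norm // invr_ge0 ltW.
have t_Im t : 0 <= complex.Im t%:C by [].
(* In the open upper half-plane [Q / P] has real part at least 1, so that Q has no root there. *)
have wl w : w \in ws -> complex.Im w <= 0.
  move=> ww; rewrite leNgt; apply/negP => w0.
  have hx z : z \in zs -> w != z.
    by move=> /zl z0; apply: contraTneq w0 => ->; rewrite -leNgt.
  have : Q.[w] = 0 by rewrite Qe (big_rem w) //= subrr mul0r.
  rewrite PQ // => /(congr1 (@Normc.normc R)) /eqP; rewrite nc0 ncM mulf_eq0.
  rewrite (negbTE (nP _ hx)) /= => /eqP h0.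
  by have [] := nc_1D_ge (Rek w (ltW w0)); rewrite h0 ler10.
have mzip p : p \in zip ws zs -> p.1 \in ws /\ p.2 \in zs.
  elim: (ws) (zs) => [|w ws' IH] [|z zs'] //=; rewrite !in_cons.
  by case/orP => [/eqP ->|/IH[-> ->]] /=; rewrite ?eqxx ?orbT.
have zzip z : z \in zs -> exists2 p, p \in zip ws zs & p.2 = z.
  move=> zz; have : z \in unzip2 (zip ws zs) by rewrite unzip2_zip ?sws.
  by case/mapP => p pp ->; exists p.
exists ws; split=> //.
- split=> [p /mzip[/wl ? /zl ?] //|t ht].
  have hz z : z \in zs -> t%:C != z by case/zzip => p pp <-; exact: ht.
  by rewrite rE //; have [] := nc_1D_ge (Rek _ (t_Im t)).
- rewrite rE; last first.
    by move=> z /zl; apply: contraTneq => <- /=; rewrite ler10.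
  rewrite (le_trans (ncD _ _)) // nc1 ncM nk.
  apply: le_trans (expR_ge1Dx _); rewrite lerD2l mulrC ler_wpM2r ?invr_ge0 ?(ltW a0) //.
  exact: nc_sum_inv_i.
move=> t ht; rewrite rE //; have [_] := nc_1D_ge (Rek _ (t_Im t)).
by rewrite ncM nk mulrC ler_pdivrMr // mulrC.
Qed.

Definition lower z := if complex.Im z <= 0 then z else cj z.

Lemma lower_Im z : complex.Im (lower z) <= 0.
Proof.
rewrite /lower; case: ifP => // /negbT; rewrite -ltNge; case: z => a b /=.
by rewrite oppr_le0 => /ltW.
Qed.

Lemma nc_lower t z : nc (t%:C - lower z) = nc (t%:C - z).
Proof.
rewrite /lower; case: ifP => // _.
by rewrite -[RHS]nc_cj cjB cj_real.
Qed.

Lemma real_neq_lower t z : t%:C != lower z -> t%:C != z.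
Proof. by move=> h; rewrite -subr_eq0 -nc_eq0 -nc_lower nc_eq0 subr_eq0. Qed.

(** [boole_lower] is applied separately to the zeros in the lower half-plane and to the conjugates
    of the others; at real points the sum over the latter is the conjugate of the original sum. Both
    multipliers A and B are at least 1, hence A + B <= 2 A B. *)
Lemma boole_pairs zs (a : R) : 0 < a ->
  exists ps, [/\ good_pairs ps, pratio ps 'i <= expR ((size zs)%:R / a) &
    (forall t, (forall p, p \in ps -> t%:C != p.2) ->
       (forall z, z \in zs -> t%:C != z) /\
       nc (\sum_(z <- zs) (t%:C - z)^-1) <= 2 * a * pratio ps t%:C)].
Proof.
move=> a0.
pose lo := fun z => complex.Im z <= 0.
pose l1 := seq.filter lo zs.
pose l2 := seq.filter (predC lo) zs.
have h1 z : z \in l1 -> complex.Im z <= 0 by rewrite mem_filter => /andP[].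
have h2 z : z \in [seq cj z | z <- l2] -> complex.Im z <= 0.
  case/mapP => y; rewrite mem_filter /= -ltNge => /andP[+ _] ->.
  by case: y => b c /=; rewrite oppr_le0 => /ltW.
have [w1 [s1 i1 g1 r1 f1]] := boole_lower h1 a0.
have [w2 [s2 i2 g2 r2 f2]] := boole_lower h2 a0.
have zz (l w : seq R[i]) z : size w = size l -> z \in l -> exists2 p, p \in zip w l & p.2 = z.
  move=> sl zl; have : z \in unzip2 (zip w l) by rewrite unzip2_zip ?sl.
  by case/mapP => p pp ->; exists p.
have per : perm_eq (l1 ++ l2) zs by rewrite perm_filterC.
exists (zip w1 l1 ++ zip w2 [seq cj z | z <- l2]); split.
- exact: good_cat.
- rewrite pratio_cat -(perm_size per) size_cat natrD mulrDl expRD.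
  by rewrite ler_pM ?pratio_ge0 //; move: r2; rewrite size_map.
move=> t ht.
have t1 z : z \in l1 -> t%:C != z.
  by case/(zz _ w1 _ s1) => p pp <-; apply: ht; rewrite mem_cat pp.
have t2 z : z \in [seq cj z | z <- l2] -> t%:C != z.
  by case/(zz _ w2 _ s2) => p pp <-; apply: ht; rewrite mem_cat pp orbT.
split=> [z|].
  rewrite -(perm_mem per) mem_cat => /orP[/t1 //|zl2].
  have := t2 _ (map_f (@cj R) zl2); apply: contra => /eqP <-.
  by rewrite cj_real.
have e1 := f1 _ t1; have e2 := f2 _ t2.
have q1 : 1 <= pratio (zip w1 l1) t%:C.
  by apply: g1.2 => p pp; apply: ht; rewrite mem_cat pp.
have q2 : 1 <= pratio (zip w2 [seq cj z | z <- l2]) t%:C.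
  by apply: g2.2 => p pp; apply: ht; rewrite mem_cat pp orbT.
rewrite -(perm_big _ per) big_cat /= (le_trans (ncD _ _)) //.
rewrite pratio_cat.
have e3 : nc (\sum_(z <- l2) (t%:C - z)^-1) <= a * pratio (zip w2 [seq cj z | z <- l2]) t%:C.
  apply: le_trans e2; rewrite big_map -nc_cj cj_sum le_eqVlt; apply/orP; left.
  by apply/eqP; congr nc; apply: eq_bigr => z _; rewrite cjV cjB cj_real.
move: q1 q2 e1 e3; set A := pratio _ _; set B := pratio _ _ => q1 q2 e1 e3.
have h : A + B <= 2 * (A * B).
  have k1 : 0 <= (A - 1) * (B - 1) by rewrite mulr_ge0 ?subr_ge0.
  nra.
have -> : 2 * a * (A * B) = a * (2 * (A * B)) by ring.
by rewrite (le_trans (lerD e1 e3)) // -mulrDr ler_pM2l.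
Qed.

(** For w in the closed lower half-plane and real t, [|t - w + i mu|] is at least [|t - w|] and at
    least [mu], while at i it is at most [(1 + mu) |i - w|] since [|i - w| >= 1]. The multiplier
    thus replaces [|t - z|] by at least [max (|t - z|, mu)], at the cost of [expR mu] per zero. *)
Lemma shift_pairs zs (mu : R) : 0 < mu ->
  exists ps, [/\ good_pairs ps, pratio ps 'i <= expR ((size zs)%:R * mu) &
    (forall t, (forall p, p \in ps -> t%:C != p.2) ->
       (forall z, z \in zs -> t%:C != z) /\
       \prod_(z <- zs) Num.max 1 (mu / nc (t%:C - z)) <= pratio ps t%:C)].
Proof.
move=> mu0; pose f z := (lower z - mu%:C * 'i, lower z).
have key t z : t%:C != lower z ->
  Num.max 1 (mu / nc (t%:C - z)) <= nc (t%:C - (f z).1) / nc (t%:C - (f z).2).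
  move=> tz; have h : 0 < nc (t%:C - lower z) by rewrite nc_gt0 subr_eq0.
  rewrite /= -(nc_lower t z) ler_pdivlMr //.
  have l0 := lower_Im z; move: l0 h; case: (lower z) => a b /= l0 h.
  rewrite !mul0r !mulr0 !mulr1 !subr0 !addr0 !sub0r in h *.
  rewrite maxr_pMl ?(ltW h) // mul1r divfK ?gt_eqF // ge_max; apply/andP; split.
    rewrite ler_wsqrtr //= lerD2l !sqrrN; nra.
  rewrite -{1}(ger0_norm (ltW mu0)) -sqrtr_sqr ler_wsqrtr //.
  have := sqr_ge0 (t - a); rewrite sqrrN; nra.
exists [seq f z | z <- zs]; split.
- split=> [p /mapP[z _ ->] /=|t ht].
    have := lower_Im z; rewrite cImD cImN cImM /=; split=> //; lra.
  rewrite /pratio big_map.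
  apply: (@le_trans _ _ (\prod_(z <- zs) 1)); first by rewrite big1_eq.
  apply: ler_prod_seq => z zz; rewrite ler01 /=.
  apply: le_trans (key t z (ht _ (map_f f zz))).
  by rewrite le_max lexx.
- rewrite /pratio big_map -[_ * mu]mulrC -[expR _]mul1r.
  apply: (@le_trans _ _ (\prod_(z <- zs) expR mu)); last first.
    by rewrite mul1r mulrC expRM_natl big_const_seq count_predT -Monoid.iteropE.
  apply: ler_prod_seq => z _; rewrite divr_ge0 ?nc_ge0 //=.
  have h := nc_i_sub (lower_Im z); have h0 := lt_le_trans ltr01 h.
  rewrite ler_pdivrMr // opprB addrCA addrC (le_trans (ncD _ _)) //.
  rewrite ncM nc_i mulr1 nc_real gtr0_norm //.
  have := @expR_ge1Dx R mu; nra.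
move=> t ht; split=> [z zz|].
  by apply: real_neq_lower; apply: (ht _ (map_f f zz)).
rewrite /pratio big_map; apply: ler_prod_seq => z zz.
by rewrite key ?(ht _ (map_f f zz)) // le_max ler01.
Qed.

End Pairs.

(** * Spread-out exponents: the logarithmic derivative of an exponential sum *)

Section TaylorFactorization.
Context {R : realType}.
Implicit Types (s : seq (R[i] * R[i])).

Lemma sum_expn_le (q : R) n : 2 <= q -> \sum_(i < n) q ^+ i <= q ^+ n.
Proof.
move=> q2; elim: n => [|n IH]; first by rewrite big_ord0 expr0.
rewrite big_ord_recr /= exprS; have : 0 <= q ^+ n by rewrite exprn_ge0 //; lra.
nra.
Qed.

Lemma expR_nat_ge (n : nat) : 2 ^+ n <= expR n%:R :> R.
Proof.
rewrite -[n%:R]mulr1 expRM_natl lerXn2r ?nnegrE ?expR_ge0 //.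
by have := @expR_ge1Dx R 1; lra.
Qed.

Lemma tay0_0 s L : (tay s 0 L.+1)`_0 = expsum s 0.
Proof.
rewrite coef_poly /= fact0 divr1 /mom /expsum; apply: eq_bigr => e _.
by rewrite mulr0 expr0 mulr1.
Qed.

(** z0 is a point of the unit circle where the Taylor polynomial dominates all its coefficients, in
    particular the value at 0. Growth from radius 1 to radius 1 + 40 yields K:
    [2 * D * 41 = 82 * D], and the geometric sum is at most
    [41 ^ n <= 2 ^ (6 * n) <= expR (6 * n)]. *)
Lemma tay_local_factorization s (n L : nat) (D : R) :
  (size s <= n)%N -> (n <= L.+1)%N -> (forall e, e \in s -> nc e.2 <= D) ->
  0 <= D -> 1 <= n%:R :> R -> expsum s 0 != 0 ->
  let K := 82 * D + 6 * n%:R in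
  exists z0 zs G, [/\ nc z0 = 1, tay s 0 L.+1 = \prod_(z <- zs) ('X - z%:P) * G,
    (size zs)%:R <= K, (forall z, z \in zs -> nc (z - z0) < 8) &
    (forall x, nc (x - z0) <= 2 ->
      nc (expsum s 0) * 8^-1 ^+ size zs * expR (- (2 * K + 5)) <= nc G.[x] /\
      nc G^`().[x] <= (2 * K + 5) * nc G.[x])].
Proof.
move=> sn nL hD D0 n1 s0 K.
pose P := tay s 0 L.+1.
have [z0 z01 hz0] := cauchy_max P (@ler01 R).
have b0 : nc (expsum s 0) <= nc P.[z0].
  by have := hz0 0%N; rewrite tay0_0 expr0 mulr1.
have s00 : 0 < nc (expsum s 0) by rewrite nc_gt0.
have gr := growth_tay sn nL hD D0 ltr01 (ler0n R 41) hz0.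
have hK z : nc (z - z0) = 40 -> nc P.[z] <= expR K * nc P.[z0].
  move=> hz; have z41 : nc z <= 41.
    by rewrite -(subrK z0 z) (le_trans (ncD _ _)) // hz z01; lra.
  rewrite (le_trans (gr z z41)) // ler_wpM2r ?nc_ge0 //.
  rewrite /K (_ : 2 * D * 41 = 82 * D); last by ring.
  rewrite expRD ler_wpM2l ?expR_ge0 // divr1.
  rewrite (le_trans (sum_expn_le _ _)) //; first lra.
  rewrite -natrM; apply: le_trans (expR_nat_ge _).
  rewrite exprM lerXn2r ?nnegrE ?exprn_ge0 // !exprS expr0; lra.
have [zs [G [e1 e2 e3 e4]]] := local_factorization (lt_le_trans s00 b0) (lexx _) hK.
exists z0, zs, G; split=> // x hx; have [h1 h2] := e4 x hx; split=> //.
apply: le_trans h1; rewrite ler_wpM2r ?expR_ge0 //.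
by rewrite ler_wpM2r // exprn_ge0.
Qed.

Lemma real_nc_sub_le (t : R) (z0 : R[i]) : 0 <= t <= 1 -> nc z0 = 1 -> nc (t%:C - z0) <= 2.
Proof.
move=> /andP[t0 t1] z01; rewrite (le_trans (ncB _ _)) // nc_real ger0_norm // z01; lra.
Qed.

Lemma log_derivative_const (D mu q K : R) : 0 < mu -> mu <= 1 -> 1 <= q ->
  0 < K -> 4 * K + 5 <= 357 * D ->
  0 <= 2 * (K / mu) * q /\ 2 * (K / mu) * q + (2 * K + 5) <= 357 * D / mu * q.
Proof.
move=> mu0 mu1 q1 K0 KD; have q0 : 0 <= q by lra.
split; first by rewrite mulr_ge0 // mulr_ge0 // divr_ge0 // ltW.
have k1 : (2 * K + 5) <= (2 * K + 5) / mu * q.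
  rewrite -[leLHS]mulr1 ler_pM //; first lra.
  by rewrite ler_pdivlMr // ler_piMr //; lra.
apply: le_trans (lerD (lexx _) k1) _.
have -> : 2 * (K / mu) * q + (2 * K + 5) / mu * q = (4 * K + 5) / mu * q by ring.
by rewrite ler_wpM2r // ler_wpM2r ?invr_ge0 // ltW.
Qed.

(** The logarithmic derivative is the sum of 1 / (t - z) over the nearby zeros, which Boole's
    multiplier dominates, plus that of the cofactor, at most [2 * K + 5]. *)
Lemma log_derivative_pairs s (n : nat) (D mu eta : R) :
  (size s <= n)%N -> (0 < n)%N -> n%:R <= D -> (forall e, e \in s -> nc e.2 <= D) ->
  0 < mu <= 1 -> 0 < eta -> expsum s 0 != 0 ->
  exists ps, [/\ good_pairs ps, pratio ps 'i <= expR mu &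
    (forall t, 0 <= t <= 1 -> (forall p, p \in ps -> t%:C != p.2) ->
      nc (expsum (ediff 0 s) t%:C) <=
        357 * D / mu * pratio ps t%:C * (nc (expsum s t%:C) + eta))].
Proof.
move=> sn n0 nD hD /andP[mu0 mu1] eta0 s0.
have n1 : 1 <= n%:R :> R by rewrite ler1n.
have D1 : 1 <= D by lra.
have D0 : 0 <= D by lra.
have e20 : 0 < eta / 2 by lra.
have [L1 hL1] := tay_approx s (@ler01 R) e20.
have [L2 hL2] := tay_approx (ediff 0 s) (@ler01 R) e20.
have [L [nL LL1 LL2]] : exists L, [/\ (n <= L.+1)%N, (L1 <= L.+1)%N & (L2 <= L)%N].
  exists (L1 + L2 + n)%N; split; first by rewrite leqW // leq_addl.
    by rewrite leqW // -addnA leq_addr.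
  by rewrite (leq_trans (leq_addl L1 L2)) // leq_addr.
have [z0 [zs [G [z01 e1 e2 e3 e4]]]] := tay_local_factorization sn nL hD D0 n1 s0.
set K := 82 * D + 6 * n%:R in e2 e4.
have K0 : 0 < K by rewrite /K; lra.
(* There are at most K zeros, so with the weight [K / mu] the multiplier costs at most [expR mu] at
   i. *)
have [ps [g r f]] := boole_pairs zs (divr_gt0 K0 mu0).
exists ps; split=> //.
  apply: (le_trans r); rewrite ler_expR invf_div mulrA ler_pdivrMr // mulrC.
  by rewrite ler_wpM2l // ltW.
move=> t t01 ht; have [tz hb] := f t ht.
have q1 := g.2 t ht.
set q := pratio ps t%:C in q1 hb *.
have [hG1 hG2] := e4 _ (real_nc_sub_le t01 z01).
have t1 : nc t%:C <= 1 by rewrite nc_real ger0_norm; case/andP: t01.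
have a1 : nc ((tay s 0 L.+1).[t%:C] - expsum s t%:C) <= eta / 2.
  have := hL1 L.+1 0 t%:C LL1; rewrite nc0 add0r; exact.
have a2 : nc ((tay s 0 L.+1)^`().[t%:C] - expsum (ediff 0 s) t%:C) <= eta / 2.
  have := hL2 L 0 t%:C LL2; rewrite nc0 add0r tay_deriv; exact.
pose A := 357 * D / mu * q.
have [k3 hA] : 0 <= 2 * (K / mu) * q /\ 2 * (K / mu) * q + (2 * K + 5) <= A.
  by apply: log_derivative_const; rewrite // /K; lra.
have A1 : 1 <= A by clear -hA k3 K0; lra.
have hder : nc (tay s 0 L.+1)^`().[t%:C] <= A * nc (tay s 0 L.+1).[t%:C].
  rewrite e1 derivM hornerD !hornerM deriv_prod_XsubC //.
  have -> : (\prod_(z <- zs) ('X - z%:P)).[t%:C] = \prod_(z <- zs) (t%:C - z).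
    by rewrite horner_prod; apply: eq_bigr => z _; rewrite hornerXsubC.
  set Z := \prod_(z <- zs) _; set S := \sum_(z <- zs) _ in hb *.
  rewrite (le_trans (ncD _ _)) // !ncM.
  have k2 : nc Z * nc S * nc G.[t%:C] + nc Z * nc G^`().[t%:C] <=
    (nc Z * nc G.[t%:C]) * (2 * (K / mu) * q + (2 * K + 5)).
    rewrite mulrDr; apply: lerD.
      by rewrite mulrAC ler_wpM2l ?mulr_ge0 ?nc_ge0.
    by rewrite -mulrA ler_wpM2l ?nc_ge0 // mulrC.
  apply: (le_trans k2); rewrite mulrC ler_wpM2r ?mulr_ge0 ?nc_ge0 //.
have k4 : nc (expsum (ediff 0 s) t%:C) <= nc (tay s 0 L.+1)^`().[t%:C] + eta / 2.
  rewrite -lerBlDl (le_trans _ a2) // ncBC; exact: nc_subr.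
have k5 : nc (tay s 0 L.+1).[t%:C] <= nc (expsum s t%:C) + eta / 2.
  rewrite -lerBlDl (le_trans _ a1) //; exact: nc_subr.
have k6 := ler_wpM2l (le_trans ler01 A1) k5.
rewrite -/q -/A; have := mulr_ge0 (ltW e20) (le_trans ler01 A1).
clear -k4 hder k6 A1 e20; nra.
Qed.

End TaylorFactorization.

(** * Clustered exponents: counting zeros at small scales *)

Section Cluster.
Context {R : realType}.
Implicit Types (s : seq (R[i] * R[i])).

Lemma pow4_sum n : (0 < n)%N -> \sum_(i < n) 4 ^+ i <= 4 / 3 * 4 ^+ n.-1 :> R.
Proof.
case: n => // n _; rewrite /= -[leRHS]mulr1 mulrAC.
suff -> : \sum_(i < n.+1) 4 ^+ i = (4 * 4 ^+ n - 1) / 3 :> R by lra.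
elim: n => [|n IH]; first by rewrite big_ord1 !expr0; field.
by rewrite big_ord_recr IH /= !exprS; field.
Qed.

Lemma count_arith (N n : nat) (sigma b G d : R) : (0 < n)%N -> 0 < sigma <= 1 ->
  N%:R <= 88 * n%:R :> R -> 0 < b -> 0 <= d -> 100 * d <= b ->
  G = expR (8 * n%:R * sigma) * (4 / 3 * 4 ^+ n.-1) ->
  b <= (sigma + sigma ^+ 2) ^+ N *
     ((G * b + d) / (4 * sigma - sigma ^+ 2) ^+ N / (1 - 4^-1)) + d ->
  2 ^+ N <= 2 ^+ n.-1 * expR (184 * n%:R * sigma).
Proof.
move=> n0 /andP[s0 s1] Nn b0 d0 db GE h.
have [Nn1|nN] := leqP N n.-1.
  apply: (@le_trans _ _ (2 ^+ n.-1)); first by rewrite ler_weXn2l // ler1n.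
  by rewrite ler_peMr ?exprn_ge0 // -expR0 ler_expR !mulr_ge0 // ltW.
set E := expR (8 * n%:R * sigma) in GE.
have E1 : 1 <= E by rewrite -expR0 ler_expR !mulr_ge0 // ltW.
set p : R := 4 ^+ n.-1 in GE.
have p1 : 1 <= p by rewrite exprn_ege1 // ler1n.
have Ep : 1 <= E * p by rewrite -[1]mulr1 ler_pM.
have w0 : 0 < 4 * sigma - sigma ^+ 2 by rewrite subr_gt0 expr2; nra.
have v0 : 0 < sigma + sigma ^+ 2 by rewrite addr_gt0 ?exprn_gt0.
set W := (4 * sigma - sigma ^+ 2) ^+ N in h.
set V := (sigma + sigma ^+ 2) ^+ N in h.
have W0 : 0 < W by rewrite exprn_gt0.
have V0 : 0 < V by rewrite exprn_gt0.
have h1 : W <= V * (2 * (E * p)).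
  have e1 : (1 - 4^-1 : R)^-1 = 4 / 3 by field.
  rewrite e1 in h.
  have k1 : b * (99 / 100) <= V * ((G * b + d) / W * (4 / 3)) by lra.
  have k2 : b * (99 / 100) * W <= V * ((G * b + d) * (4 / 3)).
    have := ler_wpM2r (ltW W0) k1; rewrite (_ : V * _ * W = V * ((G * b + d) * (4 / 3))) //.
    by field; rewrite gt_eqF.
  have k3 : V * ((G * b + d) * (4 / 3)) <= V * (E * p * b * (9 / 5)).
    rewrite ler_pM2l // GE.
    have : d <= E * p * b / 100 by nra.
    lra.
  rewrite -(ler_pM2l b0).
  have : V * (E * p * b * (9 / 5)) <= b * (V * (2 * (E * p))) * (99 / 100).
    have : 0 <= V * (E * p * b) by rewrite !mulr_ge0 ?(ltW V0) ?(ltW b0) ?expR_ge0 ?exprn_ge0.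
    nra.
  lra.
(* The zeros lie only within [sigma ^ 2] of the centre; [expR (2 * sigma)] is the price per zero for
   treating the gain as exactly 1/4. *)
have h2 : 4 * (sigma + sigma ^+ 2) * expR (- (2 * sigma)) <= 4 * sigma - sigma ^+ 2.
  rewrite expRN ler_pdivrMr ?expR_gt0 //.
  have : 1 + 2 * sigma <= expR (2 * sigma) := expR_ge1Dx _.
  move=> /(ler_wpM2l (ltW w0)); apply: le_trans.
  have : 0 <= sigma ^+ 2 * (3 - 2 * sigma) by rewrite mulr_ge0 ?exprn_ge0 ?(ltW s0) //; lra.
  rewrite !expr2; lra.
have h3 : 4 ^+ N * expR (- (2 * sigma)) ^+ N <= 2 * (E * p).
  have : (4 * (sigma + sigma ^+ 2) * expR (- (2 * sigma))) ^+ N <= W.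
    by rewrite lerXn2r ?nnegrE ?(ltW w0) // !mulr_ge0 ?expR_ge0 // ltW.
  move=> /le_trans /(_ h1); rewrite !exprMn -/V => h4.
  by rewrite -(ler_pM2l V0) (le_trans _ h4) // le_eqVlt; apply/orP; left; apply/eqP; ring.
have h4 : 4 ^+ N <= 2 * p * expR (184 * n%:R * sigma).
  have e2 : expR (- (2 * sigma)) ^+ N = (expR (2 * sigma * N%:R))^-1.
    by rewrite expRN exprVn -expRM_natl mulrC.
  rewrite e2 ler_pdivrMr ?expR_gt0 // in h3.
  apply: (le_trans h3); rewrite -mulrA [E * p]mulrC -!mulrA ler_pM2l // ler_wpM2l ?(le_trans ler01) //.
  rewrite -expRD ler_expR.
  have := ler_wpM2l (ltW s0) Nn; nra.
have [k Nk] : exists k, N = (k.+1 + n.-1)%N.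
  by exists (N - n)%N; rewrite addSnnS prednK // subnK // -(prednK n0).
set Y := expR (184 * n%:R * sigma) in h4 *.
rewrite Nk exprD mulrC ler_pM2l ?exprn_gt0 //.
have k1 : 2 <= 2 ^+ k.+1 :> R by rewrite exprS ler_peMr // exprn_ege1 // ler1n.
have k2 : 2 ^+ k.+1 * 2 ^+ k.+1 <= 2 * Y.
  rewrite -exprMn (_ : 2 * 2 = 4 :> R); last by ring.
  rewrite Nk exprD -/p in h4.
  by rewrite -(ler_pM2r (lt_le_trans ltr01 p1)) (le_trans h4) // mulrAC.
have : 2 ^+ k.+1 * 2 <= 2 ^+ k.+1 * 2 ^+ k.+1 :> R by rewrite ler_wpM2l ?exprn_ge0.
lra.
Qed.

(* The growth of the sum from radius r to 4 r is essentially 4 ^ (n - 1), which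
   leaves room for essentially n - 1 zeros at small scales. *)
Lemma zero_count s (n L : nat) (t sigma d : R) (ys : seq R[i]) (G : {poly R[i]}) :
  (size s <= n)%N -> (0 < n)%N -> (n <= L)%N -> (forall e, e \in s -> nc e.2 <= n%:R) ->
  0 < sigma <= 1 -> 0 <= t <= 1 -> (size ys)%:R <= 88 * n%:R :> R ->
  tay s 0 L = \prod_(y <- ys) ('X - y%:P) * G ->
  (forall y, y \in ys -> nc (t%:C - y) <= sigma ^+ 2) -> 0 <= d ->
  (forall w, nc w <= 4 -> nc ((tay s 0 L).[t%:C + w] - (tay s t%:C L).[w]) <= d) ->
  (forall b, nc (tay s t%:C L).[- t%:C] <=
     expR (2 * n%:R) * (\sum_(i < n) (sigma^-1) ^+ i) * b -> 0 < b /\ 100 * d <= b) ->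
  2 ^+ size ys <= 2 ^+ n.-1 * expR (184 * n%:R * sigma).
Proof.
move=> sn n0 nL hD s01 t01 Nn PG hy d0 hd hb.
have /andP[s0 s1] := s01; have /andP[t0 t1] := t01.
pose T := tay s t%:C L.
have [w1 w1s hw1] := cauchy_max T (ltW s0).
pose b := nc T.[w1].
have gr := growth_tay (z := t%:C) sn nL hD (ler0n R n) s0.
(* The last hypothesis is a lower bound for b in disguise: growth from radius sigma reaches
   [- t%:C], where the polynomial is close to [expsum s 0]. *)
have [b0 db] : 0 < b /\ 100 * d <= b.
  apply: hb; have := gr 1 b ler01 hw1 (- t%:C).
  rewrite ncN nc_real ger0_norm // => /(_ t1).
  by rewrite mulr1 div1r.
pose Ga := expR (8 * n%:R * sigma) * (4 / 3 * 4 ^+ n.-1).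
have T4 w : nc w = 4 * sigma -> nc T.[w] <= Ga * b.
  move=> w4; have s4 : 0 <= 4 * sigma by rewrite mulr_ge0 // ltW.
  have := gr (4 * sigma) b s4 hw1 w; rewrite w4 => /(_ (lexx _)) h.
  apply: (le_trans h); rewrite mulfK ?gt_eqF // /Ga ler_wpM2r ?(ltW b0) //.
  rewrite (_ : 2 * n%:R * (4 * sigma) = 8 * n%:R * sigma); last by ring.
  by rewrite ler_wpM2l ?expR_ge0 // pow4_sum.
(* The cofactor recentred at t; the maximum principle is applied to it between the radii 4 sigma and
   sigma. *)
pose G1 := G \Po ('X + t%:C%:P).
have G1e w : G1.[w] = G.[t%:C + w].
  by rewrite horner_comp hornerD hornerX hornerC addrC.
have Pe w : (tay s 0 L).[t%:C + w] = \prod_(y <- ys) (w + (t%:C - y)) * G1.[w].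
  rewrite PG hornerM horner_prod G1e; congr (_ * _).
  by apply: eq_bigr => y _; rewrite hornerXsubC; ring.
have pw (v : R) : \prod_(y <- ys) v = v ^+ size ys.
  by rewrite big_const_seq count_predT -Monoid.iteropE.
have w0 : 0 < 4 * sigma - sigma ^+ 2 by rewrite subr_gt0 expr2; nra.
have G4 w : nc w = 4 * sigma ->
    nc G1.[w] <= (Ga * b + d) / (4 * sigma - sigma ^+ 2) ^+ size ys.
  move=> w4; have w44 : nc w <= 4 by rewrite w4; lra.
  rewrite ler_pdivlMr ?exprn_gt0 //.
  have h : nc (tay s 0 L).[t%:C + w] <= Ga * b + d.
    rewrite -lerBlDl (le_trans _ (hd w w44)) //.
    by apply: le_trans (nc_subr _ _); rewrite lerD2l lerN2 T4.
  apply: le_trans h; rewrite Pe ncM mulrC ler_wpM2r ?nc_ge0 // nc_prod -pw.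
  apply: ler_prod_seq => y /hy hy1; rewrite (ltW w0) /=.
  by apply: le_trans (nc_addr _ _); rewrite w4 lerD2l lerN2.
have lt4 : nc w1 < 4 * sigma by rewrite w1s; lra.
have mp := max_principle lt4 G4.
rewrite w1s (_ : sigma / (4 * sigma) = 4^-1) in mp; last by field; rewrite gt_eqF.
apply: (@count_arith _ _ sigma b Ga d) => //.
have w14 : nc w1 <= 4 by rewrite w1s; lra.
have h : b <= nc (tay s 0 L).[t%:C + w1] + d.
  by rewrite -lerBlDl (le_trans _ (hd w1 w14)) // ncBC nc_subr.
apply: (le_trans h); rewrite lerD2r Pe ncM.
apply: ler_pM; rewrite ?nc_ge0 // nc_prod -pw.
apply: ler_prod_seq => y /hy hy1; rewrite nc_ge0 /=.
by apply: le_trans (ncD _ _) _; rewrite w1s lerD2l.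
Qed.

End Cluster.

Section Cluster.
Context {R : realType}.
Implicit Types (s : seq (R[i] * R[i])).

Lemma ex_pow4 (mu : R) : 0 < mu <= 1 ->
  exists J, 4^-1 ^+ J <= mu /\ mu <= 4 * 4^-1 ^+ J.
Proof.
move=> /andP[mu0 mu1].
have ex : exists J, 4^-1 ^+ J <= mu.
  have [n hn] : exists n : nat, mu^-1 <= n%:R.
    by exists (Num.truncn mu^-1).+1; rewrite ltW // truncnS_gt.
  exists n; rewrite exprVn -[leRHS]invrK lef_pV2 ?posrE ?exprn_gt0 ?invr_gt0 //.
  rewrite (le_trans hn) // -natrX ler_nat ltnW // ltn_expl //.
have [J hJ hmin] := ex_minnP ex.
exists J; split=> //; case: J hJ hmin => [|J] hJ hmin.
  by rewrite expr0 mulr1; lra.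
rewrite exprS mulVKf // leNgt; apply/negP => /ltW /hmin.
by rewrite ltnn.
Qed.

(** The number of levels j with [x < 4^-j] is - log x in base 4, rounded up and cut off at J. This
    converts counts of zeros at all scales into a bound for a product of distances. *)
Lemma prod_levels (x : R) J : 0 <= x ->
  \prod_(j < J) (if x < 4^-1 ^+ j then 4^-1 else 1) <= Num.max x (4^-1 ^+ J).
Proof.
move=> x0; elim: J => [|J IH]; first by rewrite big_ord0 expr0 le_max lexx orbT.
have p0 : 0 < 4^-1 ^+ J :> R by rewrite exprn_gt0.
rewrite big_ord_recr /= le_max exprSr; case: ltP => h.
  apply/orP; right; rewrite ler_pM2r //.
  by move: IH; rewrite le_max => /orP[/le_trans -> //|//]; exact: ltW.
rewrite mulr1; apply/orP; left.
by move: IH; rewrite le_max => /orP[//|/le_trans ->].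
Qed.

Lemma prod_if_const (I : Type) (l : seq I) (a : pred I) (c : R) :
  \prod_(i <- l) (if a i then c else 1) = c ^+ size (seq.filter a l).
Proof.
elim: l => [|i l IH]; first by rewrite big_nil.
by rewrite big_cons IH /=; case: (a i); rewrite ?mul1r // exprS.
Qed.

(** At level j the scale is [4^-j = sigma ^ 2] with [sigma = 2^-j], and there are at most n - 1
    zeros up to an excess of order [n * 2^-j]. The excesses form a geometric series, so all the
    levels together lose only a constant per term: [368 = 2 * 184] because [4 = 2 ^ 2], and
    [736 = 2 * 368]. *)
Lemma levels_count (zs : seq R[i]) (t mu : R) (n J : nat) : (0 < n)%N -> 0 < mu <= 1 ->
  4^-1 ^+ J <= mu -> mu <= 4 * 4^-1 ^+ J ->
  (forall j, (j < J)%N ->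
    2 ^+ size (seq.filter (fun z => nc (t%:C - z) < 4^-1 ^+ j) zs) <=
      2 ^+ n.-1 * expR (184 * n%:R * 2^-1 ^+ j) :> R) ->
  (mu / 4) ^+ n.-1 * expR (- (736 * n%:R)) <=
    \prod_(z <- zs) Num.max (nc (t%:C - z)) mu.
Proof.
move=> n0 /andP[mu0 mu1] J1 J2 hc.
apply: (@le_trans _ _ (\prod_(z <- zs) \prod_(j < J)
    (if nc (t%:C - z) < 4^-1 ^+ j then 4^-1 else 1))); last first.
  apply: ler_prod_seq => z _; apply/andP; split.
    by apply: prodr_ge0 => j _; case: ifP.
  apply: le_trans (prod_levels J (nc_ge0 _)) _.
  by rewrite ge_max !le_max lexx J1 orbT.
rewrite exchange_big /=.
under eq_bigr do rewrite prod_if_const.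
apply: (@le_trans _ _ (\prod_(j < J) (4^-1 ^+ n.-1 * expR (- (368 * n%:R * 2^-1 ^+ j))))); last first.
  apply: ler_prod => j _; rewrite mulr_ge0 ?exprn_ge0 ?expR_ge0 //=.
  have := hc j (ltn_ord j); set N := size _ => h.
  rewrite -(ler_pXn2r (n := 2)) ?nnegrE ?exprn_ge0 ?mulr_ge0 ?expR_ge0 // in h.
  rewrite exprMn -!exprM !(mulnC _ 2%N) !exprM in h.
  rewrite (_ : 2 ^+ 2 = 4 :> R) in h; last by rewrite expr2; ring.
  rewrite (_ : 368 * n%:R * 2^-1 ^+ j = 184 * n%:R * 2^-1 ^+ j + 184 * n%:R * 2^-1 ^+ j); last by ring.
  rewrite !exprVn expRN expRD -expr2 -invfM lef_pV2 ?posrE ?mulr_gt0 ?exprn_gt0 ?expR_gt0 //.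
  by move: h; rewrite !exprVn.
rewrite big_split /= prodr_const card_ord exprAC.
apply: ler_pM; rewrite ?exprn_ge0 ?divr_ge0 ?(ltW mu0) ?expR_ge0 //.
  rewrite lerXn2r ?nnegrE ?exprn_ge0 ?divr_ge0 ?(ltW mu0) //; lra.
rewrite -expR_sum ler_expR sumrN lerN2 -mulr_sumr.
rewrite (_ : 736 * n%:R = 368 * n%:R * 2 :> R); last by ring.
apply: ler_wpM2l; first by apply: mulr_ge0; exact: ler0n.
have h2 : 0 <= (2^-1 : R) < 1 by apply/andP; split; lra.
apply: le_trans (geo_le _ h2) _.
by rewrite (_ : (1 - 2^-1)^-1 = 2 :> R) //; field.
Qed.

Lemma cluster_arith (q0 X g q p e1 e2 : R) :
  0 <= q0 -> 0 <= e1 -> 0 <= p -> 0 <= e2 -> q0 * e1 <= g -> p * e2 <= X * q ->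
  q0 * (e1 * e2) * p <= q * (X * g).
Proof.
move=> q00 e10 p0 e20 h1 h2.
rewrite (_ : _ * p = (q0 * e1) * (p * e2)); last by ring.
rewrite (_ : q * _ = g * (X * q)); last by ring.
by rewrite ler_pM ?mulr_ge0.
Qed.

Lemma cluster_final (q0 E p q Q : R) : 0 < E -> 0 < p ->
  q0 * E * p <= q * Q -> q0 <= p^-1 * E^-1 * q * Q.
Proof.
move=> E0 p0 h; rewrite (_ : _ * Q = (q * Q) / (E * p)).
  by rewrite ler_pdivlMr ?mulr_gt0 // mulrA.
by rewrite invfM; ring.
Qed.

(** Up to 88 n zeros may be nearby, but [levels_count] keeps the power of [1 / mu] down to n - 1.
    With [D = n] one has [K = 88 * n], and [1181 = 264 + 181 + 736]: [264 = 3 * 88] comes from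
    [8 ^ size zs], [181 = 2 * 88 + 5] from the cofactor, and 736 from the levels. *)
Lemma cluster_pairs s (n : nat) (mu eta : R) :
  (size s <= n)%N -> (0 < n)%N -> (forall e, e \in s -> nc e.2 <= n%:R) ->
  0 < mu <= 1 -> 0 < eta -> expsum s 0 != 0 ->
  exists ps, [/\ good_pairs ps, pratio ps 'i <= expR (88 * n%:R * mu) &
    (forall t, 0 <= t <= 1 -> (forall p, p \in ps -> t%:C != p.2) ->
      nc (expsum s 0) <= (4 / mu) ^+ n.-1 * expR (1181 * n%:R) *
        pratio ps t%:C * (nc (expsum s t%:C) + eta))].
Proof.
move=> sn n0 hD mu01 eta0 s0; have /andP[mu0 mu1] := mu01.
have n1 : 1 <= n%:R :> R by rewrite ler1n.
set q0 := nc (expsum s 0).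
have q00 : 0 < q0 by rewrite nc_gt0.
have [J [J1 J2]] := ex_pow4 mu01.
(* The growth factor from radius [2^-j] around t to radius 1, a distance that reaches the point
   0. *)
pose Bf (j : nat) : R := expR (2 * n%:R) * \sum_(i < n) ((2^-1 ^+ j)^-1) ^+ i.
have Bf_mono j : (j < J)%N -> Bf j <= Bf J.
  move=> jJ; rewrite ler_wpM2l ?expR_ge0 // ler_sum // => i _.
  rewrite lerXn2r ?nnegrE ?invr_ge0 ?exprn_ge0 // !exprVn !invrK.
  by rewrite ler_weXn2l ?(ltnW jJ) // ler1n.
have Bf1 j : 1 <= Bf j.
  rewrite -[1]mulr1 ler_pM //; first by rewrite -expR0 ler_expR mulr_ge0.
  case: (n) n0 => // k _; by rewrite big_ord_recl expr0 lerDl sumr_ge0.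
(* The Taylor error is made small against [expsum s 0] divided by the largest growth factor, that of
   level J, so that it is negligible at every level. *)
pose dd := Num.min eta (q0 / (400 * Bf J)).
have B400 : 0 < 400 * Bf J by rewrite mulr_gt0 ?ltr0n ?(lt_le_trans ltr01 (Bf1 J)).
have dd0 : 0 < dd by rewrite lt_min eta0 divr_gt0.
have dde : dd <= eta by rewrite ge_min lexx.
have ddq : dd * (400 * Bf J) <= q0 by rewrite -ler_pdivlMr // ge_min lexx orbT.
have ddq1 : 400 * dd <= q0.
  apply: le_trans ddq; rewrite mulrC; apply: ler_wpM2l; first exact: ltW.
  by apply: ler_peMr; [exact: ler0n|exact: Bf1].
have [L1 hL1] := tay_approx s (ler0n R 5) dd0.
have [L [nL LL1]] : exists L, (n <= L.+1)%N /\ (L1 <= L.+1)%N.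
  by exists (L1 + n)%N; rewrite !leqW // ?leq_addl ?leq_addr.
have [z0 [zs [G [z01 e1 e2 e3 e4]]]] :=
  tay_local_factorization sn nL hD (ler0n R n) n1 s0.
set K := 82 * n%:R + 6 * n%:R in e2 e4.
have KE : K = 88 * n%:R by rewrite /K; ring.
rewrite KE in e2 e4.
have [ps [g r f]] := shift_pairs zs mu0.
exists ps; split=> //.
  by apply: (le_trans r); rewrite ler_expR ler_wpM2r // ltW.
move=> t t01 ht; have [tz hb] := f t ht.
have q1 := g.2 t ht.
set q := pratio ps t%:C in q1 hb *.
have [hG1 _] := e4 _ (real_nc_sub_le t01 z01).
have /andP[t0 t1] := t01.
have nt : nc t%:C <= 1 by rewrite nc_real ger0_norm.
set P := tay s 0 L.+1 in e1.
have aP w : nc w <= 5 -> nc (P.[w] - expsum s w) <= dd.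
  by move=> w5; have := hL1 L.+1 0 w LL1; rewrite nc0 add0r; apply.
have hcount j : (j < J)%N ->
    2 ^+ size (seq.filter (fun z => nc (t%:C - z) < 4^-1 ^+ j) zs) <=
      2 ^+ n.-1 * expR (184 * n%:R * 2^-1 ^+ j) :> R.
  move=> jJ; set a := (fun z : R[i] => _).
  have eqP1 : P = \prod_(y <- seq.filter a zs) ('X - y%:P) *
      (\prod_(y <- seq.filter (predC a) zs) ('X - y%:P) * G).
    rewrite mulrA -big_cat /= e1; congr (_ * _); apply: perm_big.
    by rewrite perm_sym perm_filterC.
  have s01 : 0 < (2^-1 ^+ j : R) <= 1.
    by rewrite exprn_gt0 //= exprn_ile1 // invf_le1 // ler1n.
  have sz : (size (seq.filter a zs))%:R <= 88 * n%:R :> R.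
    by apply: le_trans e2; rewrite ler_nat size_filter count_size.
  apply: (zero_count (d := 2 * dd) sn n0 nL hD s01 t01 sz eqP1).
  - move=> y; rewrite mem_filter => /andP[/ltW h _]; apply: (le_trans h).
    by rewrite exprAC (_ : 2^-1 ^+ 2 = 4^-1 :> R) //; field.
  - by rewrite mulr_ge0 // ltW.
  - move=> w w4.
    have tw : nc (t%:C + w) <= 5 by apply: le_trans (ncD _ _) _; clear -w4 nt; lra.
    have h1 := aP _ tw; have h2 : nc ((tay s t%:C L.+1).[w] - expsum s (t%:C + w)) <= dd.
      by apply: (hL1 _ _ _ LL1); clear -w4 nt; lra.
    rewrite (_ : _ - _ = (P.[t%:C + w] - expsum s (t%:C + w)) -
       ((tay s t%:C L.+1).[w] - expsum s (t%:C + w))); last by ring.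
    by apply: le_trans (ncB _ _) _; clear -h1 h2; lra.
  move=> b hb1.
  have h1 : nc ((tay s t%:C L.+1).[- t%:C] - expsum s 0) <= dd.
    by have := hL1 L.+1 t%:C (- t%:C) LL1; rewrite subrr ncN; apply; clear -nt; lra.
  have h2 : q0 - dd <= nc (tay s t%:C L.+1).[- t%:C].
    rewrite lerBlDr -lerBlDl (le_trans _ h1) // ncBC; exact: nc_subr.
  have h3 : q0 / 2 <= Bf j * b by apply: le_trans hb1; apply: le_trans h2; clear -ddq1 q00; lra.
  have b0 : 0 < b.
    rewrite ltNge; apply/negP => b0; have : Bf j * b <= 0.
      by rewrite mulr_ge0_le0 // (le_trans ler01 (Bf1 j)).
    by clear -h3 q00; lra.
  split=> //.
  have h4 : Bf j * b <= Bf J * b by rewrite ler_wpM2r ?(ltW b0) // Bf_mono.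
  have h5 : Bf J * (200 * dd) <= Bf J * b by clear -ddq h3 h4; lra.
  move: h5; rewrite (ler_pM2l (lt_le_trans ltr01 (Bf1 J))) => h5.
  by clear -h5; lra.
have lev := levels_count n0 mu01 J1 J2 hcount.
have x0 z : z \in zs -> 0 < nc (t%:C - z) by move=> /tz ?; rewrite nc_gt0 subr_eq0.
set X := \prod_(z <- zs) nc (t%:C - z).
have X0 : 0 < X by apply: prodr_gt0_seq.
have h1 : \prod_(z <- zs) Num.max (nc (t%:C - z)) mu <= X * q.
  apply: le_trans (ler_wpM2l (ltW X0) hb); rewrite /X -big_split /=.
  apply: ler_prod_seq => z /x0 z0'; rewrite le_max nc_ge0 /=.
  by rewrite maxr_pMr ?(ltW z0') // mulr1 mulrCA divff ?mulr1 // gt_eqF.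
have PX : nc P.[t%:C] = X * nc G.[t%:C].
  rewrite e1 hornerM ncM horner_prod nc_prod; congr (_ * _).
  by apply: eq_bigr => z _; rewrite hornerXsubC.
have h8 : expR (- (264 * n%:R)) <= 8^-1 ^+ size zs :> R.
  rewrite expRN exprVn lef_pV2 ?posrE ?expR_gt0 ?exprn_gt0 //.
  apply: (@le_trans _ _ (expR 3 ^+ size zs)).
    rewrite lerXn2r ?nnegrE ?expR_ge0 //; apply: le_trans (expR_nat_ge 3).
    by rewrite !exprS expr0; clear; lra.
  by rewrite -expRM_natl ler_expR; clear -e2; lra.
have h9 : q0 * expR (- (445 * n%:R)) <= nc G.[t%:C].
  apply: le_trans hG1; rewrite -mulrA ler_wpM2l ?(ltW q00) //.
  apply: (@le_trans _ _ (expR (- (264 * n%:R)) * expR (- (181 * n%:R)))).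
    by rewrite -expRD ler_expR; clear; lra.
  by apply: ler_pM; rewrite ?expR_ge0 // ler_expR; clear -n1; lra.
have h10 : q0 * expR (- (1181 * n%:R)) * (mu / 4) ^+ n.-1 <= q * nc P.[t%:C].
  rewrite PX (_ : - (1181 * n%:R) = - (445 * n%:R) + - (736 * n%:R)); last by ring.
  rewrite expRD; apply: cluster_arith h9 (le_trans lev h1).
  - exact: ltW.
  - exact: expR_ge0.
  - by apply: exprn_ge0; apply: divr_ge0; [exact: ltW|exact: ler0n].
  - exact: expR_ge0.
have h11 : nc P.[t%:C] <= nc (expsum s t%:C) + eta.
  have := aP t%:C (le_trans nt (ler1n R 5)).
  have := nc_subr P.[t%:C] (expsum s t%:C); clear -dde; lra.
have k1 : 0 < (mu / 4) ^+ n.-1 by apply: exprn_gt0; apply: divr_gt0; rewrite ?ltr0n.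
have -> : (4 / mu) ^+ n.-1 = ((mu / 4) ^+ n.-1)^-1 by rewrite -exprVn invf_div.
have -> : expR (1181 * n%:R) = (expR (- (1181 * n%:R)))^-1 :> R by rewrite expRN invrK.
apply: cluster_final; [exact: expR_gt0|exact: k1|].
by apply: (le_trans h10); apply: ler_wpM2l h11; exact: le_trans ler01 q1.
Qed.

End Cluster.

(** * Induction on the number of terms *)

Section OneSided.
Context {R : realType}.
Implicit Types (s : seq (R[i] * R[i])) (l : R[i]).

Lemma ex_max_seq (T : eqType) (r : seq T) (f : T -> R) : r != [::] ->
  exists2 x, x \in r & forall y, y \in r -> f y <= f x.
Proof.
elim: r => // x [|y r] IH _.
  by exists x; rewrite ?mem_head // => z; rewrite inE => /eqP ->.
have [//|m mr hm] := IH _.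
have [h|h] := leP (f m) (f x).
  exists x; rewrite ?mem_head // => z; rewrite in_cons => /predU1P[-> //|/hm].
  by move=> /le_trans ->.
exists m; first by rewrite in_cons mr orbT.
by move=> z; rewrite in_cons => /predU1P[->|/hm //]; exact: ltW.
Qed.

(** Division by [cexp (l * z)], which turns the operator d - l into d. *)
Definition eshift l s := [seq (e.1, e.2 - l) | e <- s].

Lemma expsum_eshift l s z : expsum (eshift l s) z = cexp (- (l * z)) * expsum s z.
Proof.
rewrite /expsum big_map mulr_sumr; apply: eq_bigr => e _ /=.
by rewrite mulrBl cexpD; ring.
Qed.

Lemma expsum_ediff_eshift l s z :
  expsum (ediff 0 (eshift l s)) z = cexp (- (l * z)) * expsum (ediff l s) z.
Proof.
rewrite -expsum_eshift /expsum !big_map; apply: eq_bigr => e _ /=.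
by rewrite subr0.
Qed.

Lemma expsum_ediff l s z : expsum (ediff l s) z = mom s z 1 - l * expsum s z.
Proof.
rewrite /expsum /mom big_map mulr_sumr -sumrB; apply: eq_bigr => e _ /=.
by rewrite expr1; ring.
Qed.

Lemma expsum_filter l s z :
  expsum (seq.filter (fun e => e.2 != l) (ediff l s)) z = expsum (ediff l s) z.
Proof.
rewrite /expsum big_filter big_mkcond !big_map /=; apply: eq_bigr => e _.
by case: eqP => //= ->; rewrite subrr mulr0 mul0r.
Qed.

Lemma Re_mul_real l (t : R) : complex.Re (l * t%:C) = complex.Re l * t.
Proof. by rewrite cReM /= mulr0 subr0. Qed.

(** The factor D gained at 0 by applying d - l cancels the factor D lost in the logarithmic
    derivative; what remains is [714 = 2 * 357]. *)
Lemma one_sided_step (X D mu p0 pk p1 q1 q2 P eta : R) (A : R) :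
  0 < D -> 0 < mu -> 0 <= p1 -> 0 <= X -> 0 < eta -> 1 <= q1 -> 1 <= q2 ->
  1 <= 357 * D / mu -> 714 <= A -> 0 <= p0 ->
  p0 * D <= 2 * pk -> pk <= X * q1 * (p1 + eta / 2) ->
  p1 <= 357 * D / mu * q2 * (P + eta / 2) -> 0 <= P ->
  p0 <= A / mu * X * (q1 * q2) * (P + eta).
Proof.
move=> D0 mu0 p10 X0 e0 hq1 hq2 D1 hA p00 h1 h2 h3 P0.
have q10 : 0 <= q1 by exact: le_trans hq1.
have q20 : 0 <= q2 by exact: le_trans hq2.
have k1 : p1 + eta / 2 <= 357 * D / mu * q2 * (P + eta).
  have : 1 <= 357 * D / mu * q2 by rewrite -[leLHS]mulr1; apply: ler_pM; rewrite ?ler01.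
  set a := 357 * D / mu * q2 in h3 *; nra.
have k2 : pk <= X * q1 * (357 * D / mu * q2 * (P + eta)).
  by apply: (le_trans h2); apply: ler_wpM2l k1; exact: mulr_ge0.
have k3 : p0 * D <= 714 / mu * X * (q1 * q2) * (P + eta) * D.
  apply: (le_trans h1); apply: (@le_trans _ _ (2 * (X * q1 * (357 * D / mu * q2 * (P + eta))))).
    by rewrite ler_pM2l.
  rewrite le_eqVlt; apply/orP; left; apply/eqP; ring.
move: k3; rewrite ler_pM2r // => /le_trans; apply.
have Pe : 0 <= P + eta by rewrite addr_ge0 // ltW.
apply: ler_wpM2r => //; apply: ler_wpM2r; first exact: mulr_ge0.
apply: ler_wpM2r => //; apply: ler_wpM2r => //; by rewrite invr_ge0 ltW.
Qed.

(** [176 = 2 * 88] and [2362 = 2 * 1181]: the clustered case is applied to n + 2 terms, and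
    [n + 2 <= 2 * (n + 1)]. *)
Lemma one_sided_pairs (C0 : R) : 714 <= C0 -> 4 * expR 2362 <= C0 ->
  forall (n : nat) s (mu eta : R), (size s <= n.+1)%N ->
  (forall e, e \in s -> 0 <= complex.Re e.2) -> 0 < mu <= 1 -> 0 < eta ->
  exists ps, [/\ good_pairs ps, pratio ps 'i <= expR (176 * n%:R * mu) &
    (forall t, 0 <= t <= 1 -> (forall p, p \in ps -> t%:C != p.2) ->
      nc (expsum s 0) <= (C0 / mu) ^+ n * pratio ps t%:C *
        (nc (expsum s t%:C) + eta))].
Proof.
move=> hC1 hC2; elim=> [|n IH] s mu eta ss hs /andP[mu0 mu1] eta0.
  exists [::]; split; first exact: good_nil.
    by rewrite /pratio big_nil mulr0 mul0r expR0.
  move=> t /andP[t0 t1] _; rewrite /pratio big_nil expr0 !mul1r.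
  case: s ss hs => [|e [|//]] _ hs; rewrite /expsum ?big_nil ?big_seq1.
    by rewrite nc0 add0r ltW.
  rewrite mulr0 cexp0 mulr1 ncM nc_cexp Re_mul_real ler_wpDr ?(ltW eta0) //.
  rewrite ler_peMr ?nc_ge0 // -expR0 ler_expR mulr_ge0 // hs ?mem_head //.
have N1 : n.+1%:R = n%:R + 1 :> R by rewrite -natr1.
have N2 : n.+2%:R = n%:R + 2 :> R by rewrite -natr1 N1; ring.
have C00 : 0 <= C0 by apply: le_trans hC1; exact: ler0n.
have Cm0 : 0 <= C0 / mu by rewrite divr_ge0 // ltW.
(* If the sum vanishes at 0 the empty multiplier will do; the factorization lemmas need a nonzero
   value there. *)
have [p00|p0n] := eqVneq (expsum s 0) 0.
  exists [::]; split; first exact: good_nil.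
    rewrite /pratio big_nil -[leLHS]expR0 ler_expR; apply: mulr_ge0; last exact: ltW.
    by apply: mulr_ge0; exact: ler0n.
  move=> t _ _; rewrite p00 nc0 /pratio big_nil mulr1; apply: mulr_ge0; first exact: exprn_ge0.
  by rewrite addr_ge0 ?nc_ge0 // ltW.
have sn0 : s != [::] by apply: contraNneq p0n => ->; rewrite /expsum big_nil.
have [[e f] /allpairsP[[e' f'] /= [es fs [e1 e2]]] hmax] :
  exists2 x, x \in [seq (e, f) | e <- s, f <- s] &
    forall y, y \in [seq (e, f) | e <- s, f <- s] -> nc (y.1.2 - y.2.2) <= nc (x.1.2 - x.2.2).
  apply: (@ex_max_seq _ _ (fun y => nc (y.1.2 - y.2.2))).
  by case: (s) sn0 => // e s' _; rewrite /= .
(* D is the diameter of the set of exponents; after a shift by either of the two extremal ones, all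
   the exponents have modulus at most D. *)
subst e' f'; pose D := nc (e.2 - f.2).
have hD g h : g \in s -> h \in s -> nc (g.2 - h.2) <= D.
  by move=> gs hs'; apply: (hmax (g, h)); apply/allpairsP; exists (g, h).
have shf l : l \in [:: e.2; f.2] -> forall g, g \in eshift l s -> nc g.2 <= D.
  move=> ll g /mapP[h hs' ->] /=; move: ll; rewrite !inE => /orP[] /eqP ->.
    exact: hD. exact: hD.
have sh_size l : (size (eshift l s) <= n.+2)%N by rewrite size_map.
have sh0 l : expsum (eshift l s) 0 = expsum s 0.
  by rewrite expsum_eshift mulr0 oppr0 cexp0 mul1r.
have nsh l t : nc (expsum (eshift l s) t%:C) = expR (- (complex.Re l * t)) * nc (expsum s t%:C).
  by rewrite expsum_eshift ncM nc_cexp cReN Re_mul_real.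
have [Dn|nD] := leP D n.+2%:R.
  have fq g : g \in eshift f.2 s -> nc g.2 <= n.+2%:R.
    by move=> gs; apply: le_trans (shf f.2 _ g gs) Dn; rewrite !inE eqxx orbT.
  have mu01 : 0 < mu <= 1 by rewrite mu0.
  have sh0n : expsum (eshift f.2 s) 0 != 0 by rewrite sh0.
  have [ps [g r h]] := cluster_pairs (sh_size f.2) (ltn0Sn _) fq mu01 eta0 sh0n.
  exists ps; split=> //.
    apply: (le_trans r); rewrite ler_expR; apply: ler_wpM2r; first exact: ltW.
    rewrite N1 N2; have := ler0n R n; lra.
  move=> t t01 ht; have := h t t01 ht; rewrite sh0 nsh => /le_trans; apply.
  have q0 := pratio_ge0 ps t%:C.
  have t0 : 0 <= t by case/andP: t01.
  apply: ler_pM.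
  - apply: mulr_ge0; last exact: q0.
    by apply: mulr_ge0; [apply: exprn_ge0; apply: divr_ge0; [exact: ler0n|exact: ltW]|exact: expR_ge0].
  - by rewrite addr_ge0 ?(ltW eta0) // mulr_ge0 ?expR_ge0 ?nc_ge0.
  - apply: ler_wpM2r; first exact: q0.
    apply: (@le_trans _ _ ((4 / mu) ^+ n.+1 * expR 2362 ^+ n.+1)).
      apply: ler_wpM2l; first by apply: exprn_ge0; apply: divr_ge0; [exact: ler0n|exact: ltW].
      rewrite -expRM_natl ler_expR N1 N2; have := ler0n R n; clear; lra.
    rewrite -exprMn; apply: lerXn2r; rewrite ?nnegrE; last 2 first.
    + exact: Cm0.
    + rewrite mulrAC; apply: ler_wpM2r; last exact: hC2.
      by rewrite invr_ge0 ltW.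
    by apply: mulr_ge0; [apply: divr_ge0; [exact: ler0n|exact: ltW]|exact: expR_ge0].
  - rewrite lerD2r ler_piMl ?nc_ge0 // -expR0 ler_expR oppr_le0 mulr_ge0 // hs //.
have D0 : 0 < D by apply: lt_trans nD.
(* The sums [p' - l p] for the two extremal exponents differ by a multiple of p with factor of
   modulus D, so one of them is at least [D * |p(0)| / 2] at 0. *)
have [l ll hl] : exists2 l, l \in [:: e.2; f.2] &
    nc (expsum s 0) * D <= 2 * nc (expsum (ediff l s) 0).
  have : nc (expsum s 0) * D <= nc (expsum (ediff e.2 s) 0) + nc (expsum (ediff f.2 s) 0).
    rewrite -ncM !expsum_ediff; apply: le_trans _ (ncB _ _).
    by rewrite -ncN le_eqVlt; apply/orP; left; apply/eqP; congr nc; ring.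
  have [h|h] := leP (nc (expsum (ediff e.2 s) 0)) (nc (expsum (ediff f.2 s) 0)) => h2.
    by exists f.2; rewrite ?inE ?eqxx ?orbT //; clear -h h2; lra.
  by exists e.2; rewrite ?inE ?eqxx //; clear -h h2; lra.
pose s1 := seq.filter (fun e => e.2 != l) (ediff l s).
have ss1 : (size s1 <= n.+1)%N.
  rewrite size_filter -ltnS (leq_trans _ ss) // -(size_map (fun e => (e.1 * (e.2 - l), e.2)) s).
  rewrite -/(ediff l s) ltn_neqAle count_size andbT -all_count.
  apply/negP => /allP hall; move: ll; rewrite !inE => /orP[] /eqP le.
    by have := hall _ (map_f _ es); rewrite /= le eqxx.
  by have := hall _ (map_f _ fs); rewrite /= le eqxx.
have hs1 g : g \in s1 -> 0 <= complex.Re g.2.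
  by rewrite mem_filter => /andP[_ /mapP[h hs' ->]] /=; exact: (hs h).
have e20 : 0 < eta / 2 by rewrite divr_gt0.
have mu01 : 0 < mu <= 1 by rewrite mu0.
have [ps1 [g1 r1 h1]] := IH s1 mu (eta / 2) ss1 hs1 mu01 e20.
(* Undoing the shift multiplies the error by at most [expR (nc l)] on [0, 1]. *)
pose eta2 := eta / 2 / expR (nc l).
have eta20 : 0 < eta2 by rewrite divr_gt0 ?expR_gt0.
have sh0n : expsum (eshift l s) 0 != 0 by rewrite sh0.
have [ps2 [g2 r2 h2]] := log_derivative_pairs (sh_size l) (ltn0Sn _) (ltW nD) (shf l ll) mu01 eta20 sh0n.
exists (ps1 ++ ps2); split; first exact: good_cat.
  rewrite pratio_cat; apply: le_trans (ler_pM (pratio_ge0 _ _) (pratio_ge0 _ _) r1 r2) _.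
  rewrite -expRD ler_expR N1.
  have : 0 <= 175 * mu by apply: mulr_ge0; [exact: ler0n|exact: ltW].
  clear; lra.
move=> t t01 ht.
have t1 p : p \in ps1 -> t%:C != p.2 by move=> pp; apply: ht; rewrite mem_cat pp.
have t2 p : p \in ps2 -> t%:C != p.2 by move=> pp; apply: ht; rewrite mem_cat pp orbT.
have /andP[tt0 tt1] := t01.
have H1 := h1 t t01 t1; have H2 := h2 t t01 t2.
rewrite /s1 !expsum_filter in H1.
rewrite expsum_ediff_eshift ncM nc_cexp cReN Re_mul_real nsh expRN in H2.
set E := expR (complex.Re l * t) in H2.
have E0 : 0 < E by exact: expR_gt0.
have EE : E * eta2 <= eta / 2.
  rewrite /eta2 mulrCA -[leRHS]mulr1; apply: ler_wpM2l; first exact: ltW.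
  rewrite ler_pdivrMr ?expR_gt0 // mul1r ler_expR.
  apply: (@le_trans _ _ (nc l * t)); first by rewrite ler_wpM2r // Re_le_nc.
  by rewrite ler_piMr ?nc_ge0.
rewrite pratio_cat exprS.
have q1 := g1.2 t t1; have q2 := g2.2 t t2.
have Dmu : 1 <= 357 * D / mu.
  rewrite ler_pdivlMr // mul1r (le_trans mu1) //.
  have : 1 <= n.+2%:R :> R by rewrite ler1n.
  clear -nD; lra.
apply: (one_sided_step D0 mu0 (nc_ge0 (expsum (ediff l s) t%:C)) _ eta0 q1 q2 Dmu hC1 (nc_ge0 _) hl H1 _ (nc_ge0 _)).
  exact: exprn_ge0.
have k0 : 0 <= 357 * D / mu * pratio ps2 t%:C.
  by rewrite mulr_ge0 ?(le_trans ler01).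
have := ler_wpM2l (ltW E0) H2; rewrite mulrA mulfV ?gt_eqF // mul1r => /le_trans; apply.
rewrite mulrCA; apply: ler_wpM2l => //.
by rewrite mulrDr mulrA mulfV ?gt_eqF // mul1r lerD2l.
Qed.

End OneSided.

(** * Small values of a multiplier *)

Section Nodes.
Context {R : realType}.
Implicit Types (w z : R[i]) (ps : seq (R[i] * R[i])) (u v t psi phi : R).

Lemma pi_le4 : pi <= 4 :> R.
Proof.
have h t : 0 <= t <= 1 -> is_derive t 1 (@atan R) ((1 + t ^+ 2)^-1).
  by move=> _; exact: is_derive1_atan.
have := @le_mvt R atan _ 1 h; rewrite atan1 atan0 subr0.
have p0 := pi_gt0 R; rewrite ger0_norm; last by rewrite divr_ge0 // ltW.
move=> h1; have : pi / 4 <= 1 :> R.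
  apply: h1 => t _; have h2 : 1 <= 1 + t ^+ 2 by rewrite lerDl sqr_ge0.
  have h3 := lt_le_trans ltr01 h2.
  by rewrite ger0_norm ?invr_ge0 ?(ltW h3) // invf_le1.
by rewrite ler_pdivrMr // mul1r.
Qed.

Lemma atan_gap u v : 0 <= u -> u <= v -> v <= 1 -> (v - u) / 2 <= atan v - atan u.
Proof.
move=> u0 uv v1.
have [c] := MVT_segment uv (fun x _ => is_derive1_atan x) (continuous_subspaceT (@continuous_atan R)).
rewrite in_itv /= => /andP[uc cv] ->; rewrite mulrC ler_wpM2r ?subr_ge0 //.
rewrite lef_pV2 ?posrE //; first by have : c ^+ 2 <= 1; [rewrite exprn_ile1 //|]; lra.
by rewrite ltr_pwDl // sqr_ge0.
Qed.

Lemma unimodular_arg z : nc z = 1 ->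
  exists theta : R, - pi <= theta <= pi /\ z = cexp (Complex 0 theta).
Proof.
move=> z1; have := sqr_nc z; rewrite z1 expr1n => e.
have h1 := nc_ge_Re z; rewrite z1 ler_norml in h1.
have [/andP[a0 api] ca] := acos_def h1.
have sa := sin_acos h1.
have e2 : 1 - complex.Re z ^+ 2 = complex.Im z ^+ 2 by rewrite e; ring.
rewrite e2 sqrtr_sqr in sa.
have p0 := pi_ge0 R.
case: z {z1 e h1 e2} a0 api ca sa => a b /= a0 api ca sa.
have [b0|b0] := leP 0 b.
  exists (acos a); split; first by apply/andP; split; lra.
  by rewrite /cexp /= expR0 !mul1r ca sa ger0_norm.
exists (- acos a); split; first by apply/andP; split; lra.
by rewrite /cexp /= expR0 !mul1r cosN sinN ca sa ltr0_norm // opprK.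
Qed.

Lemma count_interval (A B : R) (M : nat) : -1 < A -> A <= B ->
  Num.min B M%:R - A - 1 <= \sum_(l < M) ((A < l%:R) && (l%:R <= B))%:R.
Proof.
move=> A1 AB; elim: M => [|M IH].
  rewrite big_ord0; have : Num.min B 0 <= 0 by rewrite ge_min lexx orbT.
  by lra.
rewrite big_ord_recr /=.
have s0 : 0 <= \sum_(l < M) ((A < l%:R) && (l%:R <= B))%:R :> R by rewrite sumr_ge0.
have m1 : Num.min B M.+1%:R <= M%:R + 1 by rewrite ge_min -natr1 lexx orbT.
have m2 : Num.min B M.+1%:R <= B by rewrite ge_min lexx.
have m3 : Num.min B M.+1%:R <= Num.min B M%:R + 1.
  by rewrite minElt -natr1 minElt; case: ltP => ?; case: ltP => ?; lra.
case: (ltP A M%:R) => hA /=; last by lra.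
case: (leP M%:R B) => hB /=; first by lra.
have e : Num.min B M%:R = B by apply/min_idPl; exact: ltW.
by rewrite e in IH; lra.
Qed.

(** Maps the closed lower half-plane into the closed unit disc and the real line into the unit
    circle. *)
Definition cayley w : R[i] := ('i + w) / ('i - w).

Lemma i_sub_neq0 w : complex.Im w <= 0 -> 'i - w != 0.
Proof. by move=> h; rewrite -nc_gt0 (lt_le_trans ltr01) // nc_i_sub. Qed.

Lemma nc_cayley w : complex.Im w <= 0 -> nc (cayley w) <= 1.
Proof.
move=> h; rewrite ncM ncV ler_pdivrMr ?nc_gt0 ?i_sub_neq0 // mul1r.
rewrite -(ler_pXn2r (n := 2)) ?nnegrE ?nc_ge0 // !sqr_nc.
rewrite !(cReD, cImD, cReN, cImN) /=; nra.
Qed.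

(* The real point with Cayley transform zeta, seen from w. *)
Lemma nc_cayley_sub w (x zeta : R[i]) : complex.Im w <= 0 ->
  x * (1 + zeta) = 'i * (1 - zeta) -> 1 + zeta != 0 ->
  nc (x - w) = nc ('i - w) * nc (1 - cayley w * zeta) / nc (1 + zeta).
Proof.
move=> h e z0; apply: (@mulIf _ (nc (1 + zeta))); first by rewrite nc_eq0.
rewrite divfK ?nc_eq0 // -!ncM mulrBl e; congr nc.
by rewrite /cayley; field; exact: i_sub_neq0.
Qed.

(** The multiplier in the disc coordinate zeta: zeta = 0 is the point i, and zeta = -1 is the point
    at infinity, where this formula still makes sense. *)
Definition ratio_on ps (zeta : R[i]) : R := pratio ps 'i *
  \prod_(p <- ps) (nc (1 - cayley p.1 * zeta) / nc (1 - cayley p.2 * zeta)).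

Lemma ratio_onE ps (x zeta : R[i]) :
  (forall p, p \in ps -> complex.Im p.1 <= 0 /\ complex.Im p.2 <= 0) ->
  x * (1 + zeta) = 'i * (1 - zeta) -> 1 + zeta != 0 -> pratio ps x = ratio_on ps zeta.
Proof.
move=> h e z0; rewrite /ratio_on /pratio -big_split /= big_seq [RHS]big_seq.
apply: eq_bigr => p /h[h1 h2]; rewrite !(nc_cayley_sub _ e z0) // invfM invrK.
rewrite -(mulrA (nc ('i - p.1) * _)) [_^-1 * (_ * _)]mulrCA mulVf ?nc_eq0 // mulr1.
by rewrite invfM; ring.
Qed.

(** At infinity each zero cancels its pole. *)
Lemma ratio_on_N1 ps :
  (forall p, p \in ps -> complex.Im p.1 <= 0 /\ complex.Im p.2 <= 0) ->
  ratio_on ps (-1) = 1.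
Proof.
move=> h; rewrite /ratio_on /pratio -big_split /= big_seq big1 // => p /h[h1 h2].
have e w : complex.Im w <= 0 -> nc (1 - cayley w * -1) = 2 / nc ('i - w).
  move=> hw; have -> : 1 - cayley w * -1 = (2%:R * 'i) / ('i - w).
    by rewrite /cayley; field; exact: i_sub_neq0.
  by rewrite !ncM ncV nc_nat nc_i mulr1.
rewrite !e //.
have k1 : nc ('i - p.1) != 0 by rewrite nc_eq0 i_sub_neq0.
have k2 : nc ('i - p.2) != 0 by rewrite nc_eq0 i_sub_neq0.
by field; rewrite k1 k2.
Qed.

(** A discrete mean value property: the product over the nodes is [Phi(i) ^ M] up to factors with
    M-th powers of points of the disc. Each numerator is at most 2, and [ex_phase] takes care of the
    denominators. *)
Lemma prod_ratio_on ps (kappa : R[i]) (M : nat) : (0 < M)%N ->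
  \prod_(l < M) ratio_on ps (kappa * rou M ^+ l) =
  pratio ps 'i ^+ M * \prod_(p <- ps)
    (nc (1 - cayley p.1 ^+ M * kappa ^+ M) / nc (1 - cayley p.2 ^+ M * kappa ^+ M)).
Proof.
move=> M0; rewrite /ratio_on big_split /= prodr_const card_ord; congr (_ * _).
rewrite exchange_big /=; apply: eq_bigr => p _.
rewrite big_split /= prodfV -!nc_prod -!exprMn -!prod_rou //.
by congr (nc _ / nc _); apply: eq_bigr => l _; rewrite mulrA.
Qed.

Lemma tan_cayley psi : cos psi != 0 ->
  (tan psi)%:C * (1 + cexp (Complex 0 (psi *+ 2))) =
  'i * (1 - cexp (Complex 0 (psi *+ 2))).
Proof.
move=> c0; rewrite /cexp /= expR0 !mul1r; apply/eqP; rewrite eq_complex /=.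
rewrite !mul0r !subr0 !add0r !addr0 !mul1r.
rewrite cos_mulr2n sin_mulr2n /tan; apply/andP; split; apply/eqP.
  by field.
by rewrite cos2sin2 !mulr2n; field.
Qed.

(* A monic polynomial is at least 1 somewhere on the unit circle. *)
Lemma ex_phase ps M : exists phi, - (pi / 2) <= phi <= pi / 2 /\
  1 <= \prod_(p <- ps) nc (1 - cayley p.2 ^+ M * cexp (Complex 0 (phi *+ 2))).
Proof.
pose Q := \prod_(x <- [seq cayley p.2 ^+ M | p <- ps]) ('X - x%:P) : {poly R[i]}.
have [z z1 hz] := cauchy_max Q (@ler01 R).
have [theta [/andP[t1 t2] zt]] := unimodular_arg z1.
exists (- (theta / 2)); split; first by apply/andP; split; lra.
have -> : cexp (Complex 0 (- (theta / 2) *+ 2)) = z^-1.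
  rewrite zt -cexpN; congr cexp; apply/eqP; rewrite eq_complex /= oppr0 eqxx /=.
  by rewrite mulNrn mulr2n -splitr.
have z0 : z != 0 by rewrite -nc_eq0 z1 oner_eq0.
have := hz (size Q).-1; rewrite expr1n mulr1 -/(lead_coef Q).
rewrite (monicP _) ?monic_prod_XsubC // nc1 => /le_trans; apply.
rewrite horner_prod nc_prod big_map.
rewrite le_eqVlt; apply/orP; left; apply/eqP; apply: eq_bigr => p _.
rewrite hornerXsubC -[LHS]mul1r -{1}(invr1 R) -{1}z1 -ncV -ncM mulrBr mulVf //.
by rewrite [_ * z^-1]mulrC.
Qed.

Lemma cexp_node phi (M l : nat) : (0 < M)%N ->
  cexp (Complex 0 (((phi + pi * l%:R) / M%:R) *+ 2)) =
  cexp (Complex 0 ((phi / M%:R) *+ 2)) * rou M ^+ l.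
Proof.
move=> M0; rewrite rouX -cexpD; congr cexp; apply/eqP.
by rewrite eq_complex /= addr0 eqxx /= !mulr2n; apply/eqP; ring.
Qed.

Lemma indicators_le1 (E : seq (R * R)) t :
  (forall p, p \in E -> p.1 <= p.2) -> pairwise (fun p q => p.2 <= q.1) E ->
  \sum_(p <- E) ((p.1 < t) && (t <= p.2))%:R <= 1 :> R.
Proof.
elim: E => [|p E IH] h /=; first by rewrite big_nil ler01.
move=> /andP[/allP hp pE]; rewrite big_cons.
have h' q : q \in E -> q.1 <= q.2 by move=> qE; apply: h; rewrite in_cons qE orbT.
case: (boolP ((p.1 < t) && (t <= p.2))) => [/andP[_ tp]|_]; last by rewrite add0r IH.
rewrite big_seq big1 ?addr0 // => q qE.
by have := hp q qE => /(le_trans tp); rewrite leNgt => /negbTE ->.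
Qed.

(** Pigeonhole: all the logarithms are nonnegative and add up to at most [M * La + N * ln 2], while
    about [M * mu / 8] nodes lie in E; they cannot all exceed [tau] when M is large. *)
Lemma ratio_small_on ps (E : seq (R * R)) (La mu : R) :
  good_pairs ps -> pratio ps 'i <= expR La -> 0 <= La ->
  (forall p, p \in E -> [/\ 0 <= p.1, p.1 <= p.2 & p.2 <= 1]) ->
  pairwise (fun p q => p.2 <= q.1) E ->
  \sum_(p <- E) (p.2 - p.1) = mu -> 0 < mu ->
  exists p t, [/\ p \in E, p.1 <= t <= p.2, (forall q, q \in ps -> t%:C != q.2) &
     pratio ps t%:C <= expR (8 * La / mu + 1)].
Proof.
move=> [hIm hg] hi La0 hE pE Emu mu0.
pose tau := 8 * La / mu + 1.
have tau0 : 0 < tau by rewrite ltr_wpDl // divr_ge0 ?mulr_ge0 // ltW.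
pose N := (size ps)%:R : R.
(* The summand 1 in [tau] leaves a slack of [M * mu / 8], which for this M beats the two terms
   independent of M. *)
have [M [M0 hM]] : exists M : nat, (0 < M)%N /\
    N * ln 2 + tau * (size E)%:R < M%:R * (mu / 8).
  exists (Num.truncn ((N * ln 2 + tau * (size E)%:R) / (mu / 8))).+1; split=> //.
  by rewrite -ltr_pdivrMr ?divr_gt0 // truncnS_gt.
have Mr0 : 0 < M%:R :> R by rewrite ltr0n.
have [phi [/andP[ph1 ph2] den1]] := ex_phase ps M.
pose psi (l : nat) := (phi + pi * l%:R) / M%:R.
pose kappa := cexp (Complex 0 ((phi / M%:R) *+ 2)).
pose zeta (l : nat) := kappa * rou M ^+ l.
have zetaE l : zeta l = cexp (Complex 0 (psi l *+ 2)) by rewrite cexp_node.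
have kM : kappa ^+ M = cexp (Complex 0 (phi *+ 2)).
  rewrite -cexpMn; congr cexp; apply/eqP.
  have e (x : R) n : Complex 0 x *+ n = Complex 0 (x *+ n) :> R[i].
    elim: n => [|n IH]; first by rewrite !mulr0n.
    by rewrite !mulrS IH; apply/eqP; rewrite eq_complex /= addr0 !eqxx.
  rewrite e eq_complex /= eqxx /= -[_ *+ M]mulr_natr !mulr2n; apply/eqP; field.
  by rewrite gt_eqF.
(* The product of the denominators over all the nodes is at least 1, so no node is a pole. *)
have dne l : (l < M)%N -> forall p, p \in ps -> nc (1 - cayley p.2 * zeta l) != 0.
  move=> lM p pp; apply: contraTneq den1 => /eqP; rewrite nc_eq0 => h.
  rewrite -ltNge (big_rem p) //= -kM -exprMn -prod_rou // (bigD1 (Ordinal lM)) //=.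
  by rewrite -mulrA (eqP h) mul0r nc0 mul0r ltr01.
have nzeta l : nc (zeta l) = 1 by rewrite zetaE nc_cexp /= expR0.
have node l : (l < M)%N -> 1 + zeta l != 0 ->
    [/\ cos (psi l) != 0, pratio ps (tan (psi l))%:C = ratio_on ps (zeta l) &
      forall q, q \in ps -> (tan (psi l))%:C != q.2].
  move=> lM z1; have c0 : cos (psi l) != 0.
    apply: contra z1 => /eqP c0; rewrite zetaE /cexp /= expR0 !mul1r.
    rewrite cos_mulr2n sin_mulr2n c0 expr0n /= !(mulr0, mul0r, mul0rn) sub0r.
    by rewrite eq_complex /= subrr addr0 eqxx.
  have tc := tan_cayley c0; rewrite -zetaE in tc.
  split=> //; first exact: ratio_onE hIm tc z1.
  move=> q qp; have [_ h2] := hIm q qp.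
  rewrite -subr_eq0 -nc_eq0 (nc_cayley_sub h2 tc z1) mulf_neq0 ?invr_eq0 ?nc_eq0 //.
  by rewrite mulf_neq0 // ?nc_eq0 ?i_sub_neq0 // -nc_eq0 dne.
have r1 l : (l < M)%N -> 1 <= ratio_on ps (zeta l).
  (* A node may be the point at infinity. *)
  move=> lM; have [z1|z1] := eqVneq (1 + zeta l) 0.
    have -> : zeta l = -1 by apply/eqP; rewrite -subr_eq0 opprK addrC z1.
    by rewrite ratio_on_N1.
  by have [c0 <- h] := node l lM z1; exact: hg.
apply: contrapT => hno.
have big l p : (l < M)%N -> p \in E -> atan p.1 < psi l -> psi l <= atan p.2 ->
    tau < ln (ratio_on ps (zeta l)).
  move=> lM pp l1 l2; have [q0 q1 q2] := hE p pp.
  have psi_in : psi l \in `]- (pi / 2), pi / 2[.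
    rewrite in_itv /=; apply/andP; split.
      by apply: lt_trans l1; exact: atan_gtNpi2.
    by apply: le_lt_trans l2 _; exact: atan_ltpi2.
  have c0 : 0 < cos (psi l).
    by move: psi_in; rewrite in_itv /= => h; exact: cos_gt0_pihalf.
  have z1 : 1 + zeta l != 0.
    rewrite zetaE /cexp /= expR0 !mul1r cos_mulr2n; apply/eqP => -[h _].
    have := exprn_gt0 2 c0; move: h; rewrite mulr2n; lra.
  have [_ e h] := node l lM z1.
  rewrite ltNge; apply/negP => h3; apply: hno; exists p, (tan (psi l)); split=> //.
    apply/andP; split; rewrite leNgt; apply/negP.
      by move=> /lt_atan; rewrite tanK // => /(lt_trans l1); rewrite ltxx.
    by move=> /lt_atan; rewrite tanK // => /(le_lt_trans l2); rewrite ltxx.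
  rewrite e -(@lnK _ (ratio_on _ _)) ?ler_expR //.
  by rewrite posrE (lt_le_trans ltr01) // r1.
have up : \sum_(l < M) ln (ratio_on ps (zeta l)) <= M%:R * La + N * ln 2.
  rewrite -ln_prod; last by move=> l _; rewrite (lt_le_trans ltr01) // r1.
  rewrite prod_ratio_on //.
  have e : M%:R * La + N * ln 2 = ln (expR La ^+ M * 2 ^+ size ps).
    rewrite lnM ?posrE ?exprn_gt0 ?expR_gt0 // !lnXn ?expR_gt0 // expRK.
    by rewrite !mulr_natl.
  have pos : 0 < pratio ps 'i ^+ M * \prod_(p <- ps)
    (nc (1 - cayley p.1 ^+ M * kappa ^+ M) / nc (1 - cayley p.2 ^+ M * kappa ^+ M)).
    by rewrite -prod_ratio_on // prodr_gt0 // => l _; rewrite (lt_le_trans ltr01) // r1.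
  rewrite e ler_ln ?posrE // ?mulr_gt0 ?exprn_gt0 ?expR_gt0 //.
  apply: ler_pM; rewrite ?exprn_ge0 ?pratio_ge0 //.
  - by rewrite prodr_ge0 // => p _; rewrite divr_ge0 ?nc_ge0.
  - by rewrite lerXn2r ?nnegrE ?pratio_ge0 ?expR_ge0.
  rewrite big_split /= prodfV kM ler_pdivrMr ?(lt_le_trans ltr01 den1) //.
  rewrite -[leLHS]mulr1; apply: ler_pM => //.
    by rewrite prodr_ge0 // => p _; exact: nc_ge0.
  rewrite (_ : 2 ^+ size ps = \prod_(p <- ps) 2); last first.
    by rewrite big_const_seq count_predT -Monoid.iteropE.
  apply: ler_prod_seq => p /hIm[h1 _]; rewrite nc_ge0 /=.
  apply: le_trans (ncB _ _) _; rewrite nc1 ncM -kM !ncX.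
  have nk : nc kappa = 1 by rewrite nc_cexp /= expR0.
  rewrite nk expr1n mulr1.
  have := exprn_ile1 M (nc_ge0 _) (nc_cayley h1).
  lra.
have low : tau * (M%:R * mu / 8 - (size E)%:R) <= \sum_(l < M) ln (ratio_on ps (zeta l)).
  apply: (@le_trans _ _ (\sum_(l < M) \sum_(p <- E)
      ((atan p.1 < psi l) && (psi l <= atan p.2))%:R * tau)).
    rewrite exchange_big /= mulrC.
    have -> : (M%:R * mu / 8 - (size E)%:R) * tau =
       \sum_(p <- E) (M%:R * (p.2 - p.1) / 8 - 1) * tau.
      rewrite -mulr_suml sumrB -mulr_suml -mulr_sumr Emu; congr ((_ - _) * _).
      by rewrite big_const_seq count_predT iter_addr_0.
    rewrite big_seq [leRHS]big_seq; apply: ler_sum => p pp.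
    have [q0 q1 q2] := hE p pp.
    rewrite -mulr_suml ler_wpM2r ?(ltW tau0) //.
    have p0 := pi_gt0 R; have p4 := pi_le4.
    pose A := (M%:R * atan p.1 - phi) / pi; pose B := (M%:R * atan p.2 - phi) / pi.
    have a0 : 0 <= atan p.1 by rewrite -atan0; exact: le_atan.
    have a1 : atan p.2 <= pi / 4 by rewrite -atan1; exact: le_atan.
    have gap := atan_gap q0 q1 q2.
    (* Origin of 8: [atan] has slope at least 1/2 on [0, 1], and the angles of consecutive nodes
       differ by [pi / M], at most [4 / M]. *)
    have AB : (M%:R * ((p.2 - p.1) / 8) : R) <= B - A.
      rewrite /A /B -mulrBl ler_pdivlMr //.
      have -> : M%:R * atan p.2 - phi - (M%:R * atan p.1 - phi) = M%:R * (atan p.2 - atan p.1) by ring.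
      rewrite -mulrA ler_pM2l //; apply: le_trans gap.
      have : 0 <= (p.2 - p.1) * (4 - pi) by rewrite mulr_ge0 ?subr_ge0.
      lra.
    have A1 : -1 < A.
      rewrite /A ltr_pdivlMr // mulN1r; have : 0 <= M%:R * atan p.1 by rewrite mulr_ge0.
      lra.
    have BM : B <= M%:R.
      rewrite /B ler_pdivrMr //.
      have : M%:R * atan p.2 <= M%:R * (pi / 4) by rewrite ler_wpM2l.
      have : 1 <= M%:R :> R by rewrite ler1n.
      move=> /(ler_wpM2r (ltW p0)); lra.
    have AB' : A <= B.
      by rewrite -subr_ge0; apply: le_trans AB; rewrite !mulr_ge0 ?subr_ge0.
    have := count_interval M A1 AB'.
    rewrite (min_idPl BM) => h.
    have -> : \sum_(l < M) ((atan p.1 < psi l) && (psi l <= atan p.2))%:R =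
       \sum_(l < M) ((A < l%:R) && (l%:R <= B))%:R :> R.
      apply: eq_bigr => l _; congr ((_ && _)%:R).
        by rewrite /psi /A ltr_pdivlMr // ltr_pdivrMr // ltrBlDl mulrC [pi * _]mulrC.
      by rewrite /psi /B ler_pdivrMr // ler_pdivlMr // lerBrDl [pi * _]mulrC [atan _ * _]mulrC.
    lra.
  apply: ler_sum => l _; rewrite -mulr_suml.
  have rl := r1 l (ltn_ord l).
  have ln0 : 0 <= ln (ratio_on ps (zeta l)) by rewrite ln_ge0.
  have [hall|] := boolP (all (fun p => ~~ ((atan p.1 < psi l) && (psi l <= atan p.2))) E).
    rewrite big_seq big1 ?mul0r // => p /(allP hall) /negbTE -> //.
  rewrite -has_predC => /hasP[p pp /=]; rewrite negbK => /andP[l1 l2].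
  apply: le_trans (ltW (big l p (ltn_ord l) pp l1 l2)).
  rewrite -[leRHS]mul1r ler_wpM2r ?(ltW tau0) //.
  have := @indicators_le1 [seq (atan p.1, atan p.2) | p <- E] (psi l).
  rewrite big_map => -> //.
    by move=> q /mapP[p' /hE[_ h _] ->] /=; exact: le_atan.
  rewrite pairwise_map; apply: sub_pairwise pE => p' q' /=; exact: le_atan.
have : tau * (M%:R * mu / 8 - (size E)%:R) <= M%:R * La + N * ln 2.
  exact: le_trans low up.
have -> : tau * (M%:R * mu / 8 - (size E)%:R) =
    M%:R * La + M%:R * (mu / 8) - tau * (size E)%:R.
  by rewrite /tau; field; rewrite gt_eqF.
move: hM; lra.
Qed.

End Nodes.

(** * The inequality on finite unions of intervals *)

Section TuranNazarov.
Context {R : realType}.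
Implicit Types (s : seq (R[i] * R[i])) (E : seq (R * R)) (t : R).

Lemma expsum_size1 s t : (size s <= 1)%N -> (forall e, e \in s -> 0 <= complex.Re e.2) ->
  0 <= t -> nc (expsum s 0) <= nc (expsum s t%:C).
Proof.
case: s => [|e [|//]] _ hs t0; rewrite /expsum ?big_nil ?nc0 // !big_seq1.
rewrite mulr0 cexp0 mulr1 ncM nc_cexp Re_mul_real ler_peMr ?nc_ge0 //.
by rewrite -expR0 ler_expR mulr_ge0 // hs ?mem_head.
Qed.

Lemma total_length_le E (a b : R) : a <= b ->
  (forall p, p \in E -> [/\ a <= p.1, p.1 <= p.2 & p.2 <= b]) ->
  pairwise (fun p q => p.2 <= q.1) E -> \sum_(p <- E) (p.2 - p.1) <= b - a.
Proof.
elim: E a => [|p E IH] a ab h /=; first by rewrite big_nil subr_ge0.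
move=> /andP[/allP hp pE]; rewrite big_cons.
have [h1 h2 h3] := h p (mem_head _ _).
have := IH p.2 h3 _ pE => /(_ _)/le_trans k.
have : \sum_(j <- E) (j.2 - j.1) <= b - p.2.
  apply: IH => // q qE; have [k1 k2 k3] := h q (mem_behead (s := p :: E) qE).
  by split=> //; exact: hp.
lra.
Qed.

(* 714 and [4 * expR 2362] are the losses per term in the two cases of the
   induction, and 1409 = 8 * 176 + 1 bounds the multiplier at a node. *)
Definition turan_const : R := (714 + 4 * expR 2362) * expR 1409.

Lemma turan_const_gt0 : 0 < turan_const.
Proof.
apply: mulr_gt0; last exact: expR_gt0.
by apply: addr_gt0; [rewrite ltr0n|apply: mulr_gt0; [rewrite ltr0n|exact: expR_gt0]].
Qed.

Lemma one_sided_turan s E (m : nat) (mu rho : R) : (size s <= m.+1)%N ->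
  (forall e, e \in s -> 0 <= complex.Re e.2) ->
  (forall p, p \in E -> [/\ 0 <= p.1, p.1 <= p.2 & p.2 <= 1]) ->
  pairwise (fun p q => p.2 <= q.1) E ->
  \sum_(p <- E) (p.2 - p.1) = mu -> 0 < mu ->
  (forall p t, p \in E -> p.1 <= t <= p.2 -> nc (expsum s t%:C) <= rho) ->
  nc (expsum s 0) <= (turan_const / mu) ^+ m * rho.
Proof.
move=> ss hs hE pE Emu mu0 hrho.
have in01 p t : p \in E -> p.1 <= t <= p.2 -> 0 <= t <= 1.
  move=> /hE[h1 h2 h3] /andP[h4 h5]; apply/andP; split; lra.
(* A single term is treated apart: the summand 1 of the node estimate is absorbed by
   [1408 * (m + 1) + 1 <= 1409 * (m + 1)], and with exponent 0 there would be no power to absorb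
   it. *)
case: m ss => [|m] ss.
  rewrite expr0 mul1r.
  case: E Emu hrho hE in01 {pE} => [|p E] Emu hrho hE in01.
    by move: mu0; rewrite -Emu big_nil ltxx.
  have [h1 h2 h3] := hE p (mem_head _ _).
  have ht : p.1 <= p.1 <= p.2 by rewrite lexx.
  by apply: le_trans (hrho p p.1 (mem_head _ _) ht); exact: expsum_size1.
have mu1 : 0 < mu <= 1.
  rewrite mu0 -Emu; have := total_length_le ler01 hE pE.
  by rewrite subr0.
pose C0 : R := 714 + 4 * expR 2362.
have e0 : 0 <= 4 * expR 2362 :> R by apply: mulr_ge0; [exact: ler0n|exact: expR_ge0].
have c1 : 714 <= C0 by rewrite /C0 lerDl.
have c2 : 4 * expR 2362 <= C0 by rewrite /C0 lerDr; exact: ler0n.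
have C00 : 0 <= C0 by apply: le_trans c2.
have m1 : 1 <= m.+1%:R :> R by rewrite ler1n.
pose W := (turan_const / mu) ^+ m.+1.
have W0 : 0 < W by apply: exprn_gt0; apply: divr_gt0 => //; exact: turan_const_gt0.
apply/ler_addgt0Pr => eps eps0.
pose eta := eps / W.
have eta0 : 0 < eta by exact: divr_gt0.
have [ps [g r h]] := one_sided_pairs c1 c2 ss hs mu1 eta0.
have La0 : 0 <= 176 * m.+1%:R * mu :> R.
  by apply: mulr_ge0; [apply: mulr_ge0; exact: ler0n|exact: ltW].
have [p [t [pE' pt np hr]]] := ratio_small_on g r La0 hE pE Emu mu0.
have t01 := in01 p t pE' pt.
apply: (le_trans (h t t01 np)).
have k1 : nc (expsum s t%:C) + eta <= rho + eta by rewrite lerD2r; exact: hrho pE' pt.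
have k0 : 0 <= nc (expsum s t%:C) + eta by rewrite addr_ge0 ?nc_ge0 // ltW.
have k2 : (C0 / mu) ^+ m.+1 * pratio ps t%:C <= W.
  apply: (@le_trans _ _ ((C0 / mu) ^+ m.+1 * expR 1409 ^+ m.+1)).
    apply: ler_wpM2l; first by apply: exprn_ge0; apply: divr_ge0 => //; exact: ltW.
    apply: (le_trans hr); rewrite -expRM_natl ler_expR.
    have -> : 8 * (176 * m.+1%:R * mu) / mu = 1408 * m.+1%:R :> R.
      by field; rewrite gt_eqF.
    clear -m1; lra.
  by rewrite -exprMn /W /turan_const -/C0 mulrAC.
have -> : W * rho + eps = W * (rho + eta).
  by rewrite mulrDr /eta mulrCA divff ?mulr1 // gt_eqF.
apply: ler_pM => //.
apply: mulr_ge0; last exact: pratio_ge0.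
by apply: exprn_ge0; apply: divr_ge0 => //; exact: ltW.
Qed.

(** The sum reparametrized from t0 in the direction [sg], times [expR (l * xi * x)]; this weight
    makes all real parts nonnegative when xi bounds their absolute values. *)
Definition affine_sum s (t0 sg l xi : R) :=
  [seq (e.1 * cexp (e.2 * t0%:C), l%:C * (xi%:C + sg%:C * e.2)) | e <- s].

Lemma affine_sumE s (t0 sg l xi x : R) :
  expsum (affine_sum s t0 sg l xi) x%:C =
  cexp (l * xi * x)%:C * expsum s (t0 + sg * l * x)%:C.
Proof.
rewrite /expsum big_map mulr_sumr; apply: eq_bigr => e _ /=.
rewrite mulrCA -mulrA -!cexpD; congr (_ * cexp _).
rewrite !(rmorphM, rmorphD) /=; ring.
Qed.

Lemma half_turan s E (m : nat) (t0 sg l xi mu rho : R) : (size s <= m.+1)%N ->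
  sg ^+ 2 = 1 -> 0 <= l -> 0 <= xi -> (forall e, e \in s -> `|complex.Re e.2| <= xi) ->
  (forall p, p \in E -> [/\ 0 <= p.1, p.1 <= p.2 & p.2 <= 1]) ->
  pairwise (fun p q => p.2 <= q.1) E ->
  \sum_(p <- E) (p.2 - p.1) = mu -> 0 < mu ->
  (forall p x, p \in E -> p.1 <= x <= p.2 -> nc (expsum s (t0 + sg * l * x)%:C) <= rho) ->
  nc (expsum s t0%:C) <= expR (l * xi) * (turan_const / mu) ^+ m * rho.
Proof.
move=> ss sg1 l0 xi0 hxi hE pE Emu mu0 hrho.
pose s' := affine_sum s t0 sg l xi.
have ss' : (size s' <= m.+1)%N by rewrite size_map.
have hs' e : e \in s' -> 0 <= complex.Re e.2.
  move=> /mapP[f fs ->]; rewrite [_.2]/= Re_scale cReD Re_scale mulr_ge0 //=.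
  have : `|sg * complex.Re f.2| <= xi.
    rewrite normrM (_ : `|sg| = 1) ?mul1r ?hxi //.
    by apply/eqP; rewrite -(@eqrXn2 _ 2) // expr1n -normrX sg1 normr1.
  rewrite ler_norml => /andP[h _]; lra.
have := @one_sided_turan s' E m mu (expR (l * xi) * rho) ss' hs' hE pE Emu mu0.
have -> : expsum s' 0 = expsum s t0%:C.
  by have := affine_sumE s t0 sg l xi 0; rewrite !mulr0 addr0 cexp0 mul1r.
move=> h; rewrite [expR _ * _]mulrC -mulrA; apply: h => p x pE' px.
have [h1 h2 h3] := hE p pE'; case/andP: (px) => h4 h5.
rewrite affine_sumE ncM nc_cexp /=; apply: ler_pM; rewrite ?expR_ge0 ?nc_ge0 //.
  have lx : 0 <= l * xi by rewrite mulr_ge0.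
  by rewrite ler_expR ler_piMr //; lra.
exact: hrho pE' px.
Qed.

Lemma pairwise_rev (T : Type) (r : rel T) (l : seq T) :
  pairwise r (rev l) = pairwise (fun x y => r y x) l.
Proof.
elim: l => //= x l IH; rewrite rev_cons -cats1 pairwise_cat IH /= andbT; congr (_ && _).
by rewrite /allrel all_rev; apply: eq_all => y /=; rewrite andbT.
Qed.

(** The one-sided estimate bounds the value at an endpoint. The point t0 cuts E into two pieces, one
    of which has at least half of the total length, whence the factor 2; that piece is mapped
    affinely into [0, 1] with t0 going to 0. *)
Lemma interval_turan s E (m : nat) (a b t0 xi L rho : R) : (size s <= m.+1)%N ->
  a < b -> a <= t0 <= b -> 0 <= xi -> (forall e, e \in s -> `|complex.Re e.2| <= xi) ->
  (forall p, p \in E -> [/\ a <= p.1, p.1 <= p.2 & p.2 <= b]) ->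
  pairwise (fun p q => p.2 <= q.1) E ->
  \sum_(p <- E) (p.2 - p.1) = L -> 0 < L ->
  (forall p t, p \in E -> p.1 <= t <= p.2 -> nc (expsum s t%:C) <= rho) ->
  nc (expsum s t0%:C) <=
    expR ((b - a) * xi) * (2 * turan_const * (b - a) / L) ^+ m * rho.
Proof.
move=> ss ab /andP[at0 tb] xi0 hxi hE pE EL L0 hrho.
pose l := b - a; have l0 : 0 < l by rewrite subr_gt0.
have [p0 hp0] : exists p, p \in E.
  case: (E) EL L0 => [|p E'] EL L0; last by exists p; exact: mem_head.
  by move: L0; rewrite -EL big_nil ltxx.
have rho0 : 0 <= rho.
  have [_ h _] := hE p0 hp0.
  by apply: le_trans (nc_ge0 _) (hrho p0 p0.1 hp0 _); rewrite lexx.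
have T0 := turan_const_gt0.
have key mu : L / (2 * l) <= mu ->
    expR (l * xi) * (turan_const / mu) ^+ m * rho <=
    expR (l * xi) * (2 * turan_const * l / L) ^+ m * rho.
  have h0 : 0 < L / (2 * l) by rewrite divr_gt0 ?mulr_gt0.
  move=> h; have mu0 := lt_le_trans h0 h.
  apply: ler_wpM2r => //; apply: ler_wpM2l; first exact: expR_ge0.
  have hh : turan_const / mu <= 2 * turan_const * l / L.
    have -> : 2 * turan_const * l / L = turan_const / (L / (2 * l)).
      by field; rewrite !gt_eqF.
    by apply: ler_wpM2l; [exact: ltW|rewrite lef_pV2 ?posrE].
  apply: lerXn2r hh; rewrite nnegrE.
    by apply: divr_ge0; exact: ltW.
  by apply: divr_ge0; [apply: mulr_ge0; [apply: mulr_ge0; [exact: ler0n|exact: ltW]|exact: ltW]|exact: ltW].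
pose fr (p : R * R) := ((Num.max p.1 t0 - t0) / l, (p.2 - t0) / l).
pose fl (p : R * R) := ((t0 - Num.min p.2 t0) / l, (t0 - p.1) / l).
pose Er := [seq fr p | p <- E & t0 < p.2].
(* Reflection in t0 reverses the order of the intervals, hence [rev]. *)
pose El := rev [seq fl p | p <- E & p.1 < t0].
have total : \sum_(p <- Er) (p.2 - p.1) + \sum_(p <- El) (p.2 - p.1) = L / l.
  have -> : \sum_(p <- El) (p.2 - p.1) = \sum_(p <- [seq fl p | p <- E & p.1 < t0]) (p.2 - p.1).
    by apply: perm_big; rewrite perm_rev.
  rewrite /Er !big_map !big_filter big_mkcond [X in _ + X]big_mkcond -big_split /=.
  rewrite -EL mulr_suml big_seq [RHS]big_seq; apply: eq_bigr => p /hE[h1 h2 h3].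
  rewrite /fr /fl /=; case: (ltP t0 p.2) => k1; case: (ltP p.1 t0) => k2.
  - by ring.
  - by ring.
  - by ring.
  - have e1 : p.2 = t0 by apply/le_anti; rewrite k1 (le_trans k2).
    have e2 : p.1 = t0 by apply/le_anti; rewrite k2 -{1}e1 h2.
    by rewrite e1 e2; ring.
have half : L / (2 * l) + L / (2 * l) = L / l by field; rewrite gt_eqF.
have pEr : pairwise (fun p q : R * R => p.2 <= q.1) Er.
  rewrite pairwise_map; apply: sub_pairwise (pairwise_filter _ pE) => p q /= pq.
  by rewrite ler_pM2r ?invr_gt0 // lerD2r le_max pq.
have pEl : pairwise (fun p q : R * R => p.2 <= q.1) El.
  rewrite pairwise_rev pairwise_map; apply: sub_pairwise (pairwise_filter _ pE) => p q /= pq.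
  by rewrite ler_pM2r ?invr_gt0 // lerD2l lerN2 ge_min pq.
have sc (x y : R) : x * l <= y -> x <= y / l by move=> h; rewrite ler_pdivlMr.
have sc2 (x y : R) : x <= y * l -> x / l <= y by move=> h; rewrite ler_pdivrMr.
have h0 : 0 < L / (2 * l) by rewrite divr_gt0 ?mulr_gt0.
have [hr|hl] := leP (L / (2 * l)) (\sum_(p <- Er) (p.2 - p.1)).
  apply: le_trans _ (key _ hr).
  apply: (@half_turan s Er m t0 1 l xi _ rho) => //; rewrite ?expr1n ?(ltW l0) //.
  - move=> p /mapP[q]; rewrite mem_filter => /andP[tq /hE[h1 h2 h3]] -> /=; split.
    + by rewrite divr_ge0 ?(ltW l0) // subr_ge0 le_max lexx orbT.
    + by rewrite ler_pM2r ?invr_gt0 // lerD2r ge_max h2 ltW.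
    + by apply: sc2; rewrite mul1r /l; lra.
  - exact: lt_le_trans hr.
  move=> p x /mapP[q]; rewrite mem_filter => /andP[tq qE] -> /= /andP[x1 x2].
  apply: (hrho q) => //.
  rewrite ler_pdivrMr // in x1; rewrite ler_pdivlMr // in x2.
  have : q.1 <= Num.max q.1 t0 by rewrite le_max lexx.
  by move=> h; apply/andP; split; lra.
have hl' : L / (2 * l) <= \sum_(p <- El) (p.2 - p.1) by lra.
apply: le_trans _ (key _ hl').
apply: (@half_turan s El m t0 (-1) l xi _ rho) => //; rewrite ?sqrrN ?expr1n ?(ltW l0) //.
- move=> p; rewrite mem_rev => /mapP[q]; rewrite mem_filter => /andP[tq /hE[h1 h2 h3]] -> /=; split.
  + by rewrite divr_ge0 ?(ltW l0) // subr_ge0 ge_min lexx orbT.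
  + by rewrite ler_pM2r ?invr_gt0 // lerD2l lerN2 le_min h2 ltW.
  + by apply: sc2; rewrite mul1r /l; lra.
- exact: lt_le_trans hl'.
move=> p x; rewrite mem_rev => /mapP[q]; rewrite mem_filter => /andP[tq qE] -> /= /andP[x1 x2].
apply: (hrho q) => //.
rewrite ler_pdivrMr // in x1; rewrite ler_pdivlMr // in x2.
have : Num.min q.2 t0 <= q.2 by rewrite ge_min lexx.
by move=> h; apply/andP; split; lra.
Qed.

End TuranNazarov.

(** * Zeros of real parts of exponential sums *)

Section RolleZeros.
Context {R : realType}.
Implicit Types (f g : R -> R) (t lo hi : R) (xs ys : seq R) (s : seq (R[i] * R[i])).

Lemma derive_continuous_on f df lo hi :
  (forall t, lo <= t <= hi -> is_derive t 1 f (df t)) -> {within `[lo, hi], continuous f}.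
Proof.
move=> h; apply: derivable_within_continuous => x; rewrite in_itv /= => /h d.
exact: ex_derive.
Qed.

Lemma rolle_point f df x y : x < y ->
  (forall t, x <= t <= y -> is_derive t 1 f (df t)) -> f x = 0 -> f y = 0 ->
  exists2 c, x < c < y & df c = 0.
Proof.
move=> xy hf fx fy.
have hd t : t \in `]x, y[ -> derivable f t 1.
  rewrite in_itv /= => /andP[h1 h2].
  have ht : x <= t <= y by rewrite !ltW.
  have := hf t ht => d; exact: ex_derive.
have fxy : f x = f y by rewrite fx fy.
have [c] := Rolle xy hd (derive_continuous_on hf) fxy.
rewrite in_itv /= => cxy hc; exists c => //.
have hc' : x <= c <= y by case/andP: cxy => h1 h2; rewrite !ltW.
by have := hf c hc' => d; rewrite -(@derive_val _ _ _ _ _ _ _ d) (@derive_val _ _ _ _ _ _ _ hc).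
Qed.

Lemma rolle_path f df lo hi x xs :
  (forall t, lo <= t <= hi -> is_derive t 1 f (df t)) ->
  path <%R x xs -> lo <= x -> (forall y, y \in x :: xs -> y <= hi) ->
  (forall y, y \in x :: xs -> f y = 0) ->
  exists ys, [/\ path <%R x ys, size ys = size xs,
    (forall y, y \in ys -> y <= hi) & (forall y, y \in ys -> df y = 0)].
Proof.
move=> hf; elim: xs x => [|y xs IH] x /=; first by exists [::].
move=> /andP[xy pxs] lox hle h0.
have hy : lo <= y by rewrite (le_trans lox) // ltW.
have [z zyxs|z zyxs|ys [pys sys lys dys]] := IH y pxs hy.
- by apply: hle; rewrite in_cons zyxs orbT.
- by apply: h0; rewrite in_cons zyxs orbT.
have yhi : y <= hi by apply: hle; rewrite !in_cons eqxx orbT.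
have hf' t : x <= t <= y -> is_derive t 1 f (df t).
  by move=> /andP[h1 h2]; apply: hf; rewrite (le_trans lox) // (le_trans h2).
have [c /andP[xc cy] dc] := rolle_point xy hf' (h0 x (mem_head _ _))
   (h0 y (mem_behead (s := x :: y :: xs) (mem_head _ _))).
exists (c :: ys); split.
- rewrite /= xc /=; case: (ys) pys => //= d ys' /andP[yd ->].
  by rewrite (lt_trans cy).
- by rewrite /= sys.
- move=> z; rewrite in_cons => /predU1P[->|/lys //].
  by rewrite (le_trans _ yhi) // ltW.
by move=> z; rewrite in_cons => /predU1P[->|/dys].
Qed.

Lemma rolle_sorted f df lo hi xs :
  (forall t, lo <= t <= hi -> is_derive t 1 f (df t)) ->
  sorted <%R xs -> (forall y, y \in xs -> lo <= y <= hi) ->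
  (forall y, y \in xs -> f y = 0) ->
  exists ys, [/\ sorted <%R ys, size ys = (size xs).-1,
    (forall y, y \in ys -> lo <= y <= hi) & (forall y, y \in ys -> df y = 0)].
Proof.
case: xs => [|x xs] hf /= pxs hb h0; first by exists [::].
have [lox _] := andP (hb x (mem_head _ _)).
have [y /hb/andP[]//|ys [p1 p2 p3 p4]] := rolle_path hf pxs lox _ h0.
exists ys; split=> //; first exact: path_sorted p1.
move=> y yys; rewrite p3 // andbT (le_trans lox) // ltW //.
by have /allP /(_ y yys) := order_path_min lt_trans p1.
Qed.

Lemma derive0_const f lo hi x y :
  (forall t, lo <= t <= hi -> is_derive t 1 f 0) ->
  lo <= x <= hi -> lo <= y <= hi -> f x = f y.
Proof.
move=> hf; wlog xy : x y / x <= y.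
  move=> h hx hy; case/orP: (le_total x y) => xy; first exact: h.
  by apply/esym; exact: h.
move=> /andP[x1 x2] /andP[y1 y2].
have hf' t : x <= t <= y -> is_derive t 1 f ((fun=> 0) t).
  by move=> /andP[h1 h2]; apply: hf; rewrite (le_trans x1) // (le_trans h2).
have hd t : t \in `]x, y[ -> is_derive t 1 f ((fun=> 0) t).
  by rewrite in_itv /= => /andP[h1 h2]; apply: hf'; rewrite !ltW.
have [c _ e] := MVT_segment xy hd (derive_continuous_on hf').
by move: e; rewrite mul0r => /eqP; rewrite subr_eq0 => /eqP.
Qed.

(* On an interval shorter than pi / |b| the operator (d/dt - a)^2 + b^2 is a
   composition of first-order operators with positive weights. *)
Lemma second_order_rolle f f1 f2 (a b lo hi : R) xs :
  (forall t, is_derive t 1 f (f1 t)) -> (forall t, is_derive t 1 f1 (f2 t)) ->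
  `|b| * (hi - lo) < pi ->
  sorted <%R xs -> (forall y, y \in xs -> lo <= y <= hi) -> (forall y, y \in xs -> f y = 0) ->
  let g t := f2 t - 2 * a * f1 t + (a ^+ 2 + b ^+ 2) * f t in
  (exists ys, [/\ sorted <%R ys, size ys = (size xs).-2,
    (forall y, y \in ys -> lo <= y <= hi) & (forall y, y \in ys -> g y = 0)]) /\
  ((2 <= size xs)%N -> (forall t, lo <= t <= hi -> g t = 0) ->
    forall t, lo <= t <= hi -> f t = 0).
Proof.
move=> hf hf1 hb sxs bxs zxs g.
pose t0 := (lo + hi) / 2.
pose E t := expR (- a * t); pose C t := cos (b * t + - (b * t0)); pose S t := sin (b * t + - (b * t0)).
have dE t : is_derive t 1 E (- a * E t).
  have := @is_derive1_comp R expR (fun t => - a * t) t _ _ (is_derive_expR _) (is_derive_lin (- a) t).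
  by rewrite mulrC.
have dl t : is_derive t 1 (fun t => b * t + - (b * t0)) b.
  have := is_derive_add (is_derive_lin b t) (is_derive_cst (- (b * t0)) t (1 : R)).
  by rewrite addr0.
have dC t : is_derive t 1 C (- b * S t).
  have := @is_derive1_comp R cos (fun t => b * t + - (b * t0)) t _ _ (is_derive_cos _) (dl t).
  by move=> h; apply: (is_derive_eq h); rewrite /S; ring.
have dS t : is_derive t 1 S (b * C t).
  have := @is_derive1_comp R sin (fun t => b * t + - (b * t0)) t _ _ (is_derive_sin _) (dl t).
  by move=> h; apply: (is_derive_eq h); rewrite mulrC.
have C0 t : lo <= t <= hi -> 0 < C t.
  move=> /andP[l1 l2]; apply: cos_gt0_pihalf.
  have : `|b * t + - (b * t0)| <= `|b| * ((hi - lo) / 2).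
    rewrite -mulrBr normrM ler_wpM2l // ler_norml /t0; apply/andP; split; lra.
  rewrite ler_norml => /andP[h1 h2]; apply/andP; split; lra.
have E0 t : 0 < E t by exact: expR_gt0.
(* With [K = E * k] one has [h' = K / C ^ 2] and [K' = E * C * g], where E and C are positive: two
   applications of Rolle's theorem lead from zeros of f to zeros of g, and conversely [g = 0] forces
   K, then h, to vanish. *)
pose k t := (f1 t - a * f t) * C t + b * (f t * S t).
pose h t := f t * E t * (C t)^-1.
pose dh t := E t * k t * (C t)^-1 ^+ 2.
have dhP t : lo <= t <= hi -> is_derive t 1 h (dh t).
  move=> tJ; have c0 : C t != 0 by rewrite gt_eqF ?C0.
  have := is_derive_mul (is_derive_mul (hf t) (dE t)) (is_deriveV c0 (dC t)).
  move=> hh; apply: (is_derive_eq hh); rewrite /dh /k /GRing.scale /= -exprVn.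
  by field.
pose K t := E t * k t.
have dK t : is_derive t 1 K (E t * C t * g t).
  have d1 := is_derive_add (hf1 t) (is_derive_scale (- a) (hf t)).
  have d2 := is_derive_scale b (is_derive_mul (hf t) (dS t)).
  have := is_derive_mul (dE t) (is_derive_add (is_derive_mul d1 (dC t)) d2).
  rewrite (_ : (fun _ => _) = K); last first.
    by apply/funext => u; rewrite /K /k; ring.
  by move=> hh; apply: (is_derive_eq hh); rewrite /g; ring.
have hz y : y \in xs -> h y = 0 by move=> /zxs e; rewrite /h e !mul0r.
have [ys [sys ny bys zys]] := rolle_sorted dhP sxs bxs hz.
have Kz y : y \in ys -> K y = 0.
  move=> yys; have := zys y yys; rewrite /dh -/(K y) => /eqP.
  by rewrite mulf_eq0 expf_eq0 /= invr_eq0 (gt_eqF (C0 y (bys y yys))) orbF => /eqP.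
split.
  have [zs [szs nz bzs zzs]] := rolle_sorted (fun t _ => dK t) sys bys Kz.
  exists zs; split=> //; first by rewrite nz ny.
  move=> y yzs; have := zzs y yzs => /eqP.
  by rewrite mulf_eq0 mulf_eq0 (gt_eqF (E0 y)) (gt_eqF (C0 y (bzs y yzs))) /= => /eqP.
move=> n2 g0.
have [y0 y0ys] : exists y, y \in ys.
  by case: (ys) ny => [|y ys'] /=; [case: (xs) n2 => [|x [|x' xs']]|exists y; exact: mem_head].
have K0 t : lo <= t <= hi -> K t = 0.
  move=> tJ; rewrite -(Kz y0 y0ys); apply: (@derive0_const K lo hi) => //; last exact: bys.
  by move=> u uJ; have := dK u; rewrite g0 // mulr0.
have [x0 x0xs] : exists x, x \in xs.
  by case: (xs) n2 => [//|x xs'] _; exists x; exact: mem_head.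
move=> t tJ; have : h t = 0.
  rewrite -(hz x0 x0xs); apply: (@derive0_const h lo hi) => //; last exact: bxs.
  by move=> u uJ; have := dhP u uJ; rewrite /dh -/(K u) K0 // mul0r.
by move=> /eqP; rewrite mulf_eq0 mulf_eq0 invr_eq0 (gt_eqF (E0 t)) (gt_eqF (C0 t tJ)) !orbF => /eqP.
Qed.

Lemma is_derive_Re_expsum s t :
  is_derive t 1 (fun t => complex.Re (expsum s t%:C)) (complex.Re (expsum (ediff 0 s) t%:C)).
Proof.
elim: s => [|e s IH].
  under eq_fun do rewrite /expsum big_nil.
  rewrite /expsum big_nil; exact: is_derive_cst.
have := is_derive_add (is_derive_Re_cexp e.1 e.2 t) IH.
rewrite (_ : (fun _ => _) = (fun t => complex.Re (expsum (e :: s) t%:C))); last first.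
  by apply/funext => u; rewrite {2}/expsum big_cons cReD.
move=> h; apply: (is_derive_eq h); rewrite {2}/expsum /= big_cons cReD /= subr0.
by rewrite mulrA.
Qed.

Lemma expsum_ediff2 (l l' : R[i]) s z :
  expsum (ediff l' (ediff l s)) z =
  expsum (ediff 0 (ediff 0 s)) z - (l + l') * expsum (ediff 0 s) z + l * l' * expsum s z.
Proof.
rewrite /expsum; elim: s => [|e s IH]; first by rewrite !big_nil; ring.
by rewrite !big_cons IH /=; ring.
Qed.

Lemma second_order_expsum (l : R[i]) s t :
  complex.Re (expsum (ediff (cj l) (ediff l s)) t%:C) =
  complex.Re (expsum (ediff 0 (ediff 0 s)) t%:C) -
   2 * complex.Re l * complex.Re (expsum (ediff 0 s) t%:C) +
   (complex.Re l ^+ 2 + complex.Im l ^+ 2) * complex.Re (expsum s t%:C).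
Proof.
rewrite expsum_ediff2 Re_cj_add.
have -> : l * cj l = (complex.Re l ^+ 2 + complex.Im l ^+ 2)%:C.
  by case: l => a b; apply/eqP; rewrite eq_complex /=; apply/andP; split; apply/eqP; ring.
by rewrite !(cReD, cReN) !Re_scale.
Qed.

(** Induction on the terms: applying both d - l and its conjugate removes the first term and at most
    two zeros, and the composition is a real operator, so it commutes with the real part. Vanishing
    is carried back by the second half of [second_order_rolle]. *)
Lemma few_zeros_short (La lo hi : R) (N : nat) s xs : (size s <= N)%N ->
  (forall e, e \in s -> `|complex.Im e.2| <= La) -> La * (hi - lo) < pi -> lo <= hi ->
  sorted <%R xs -> (forall y, y \in xs -> lo <= y <= hi) ->
  (forall y, y \in xs -> complex.Re (expsum s y%:C) = 0) -> (2 * N <= size xs)%N ->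
  forall t, lo <= t <= hi -> complex.Re (expsum s t%:C) = 0.
Proof.
move=> sN hs hLa lohi; elim: N s xs sN hs => [|N IH] s xs sN hs sxs bxs zxs nxs.
  by case: s sN {hs zxs} => // _ t _; rewrite /expsum big_nil.
case: s sN hs zxs => [|e s] sN hs zxs; first by move=> t _; rewrite /expsum big_nil.
pose s2 := ediff (cj e.2) (ediff e.2 s).
have s2E t : complex.Re (expsum s2 t%:C) =
   complex.Re (expsum (ediff (cj e.2) (ediff e.2 (e :: s))) t%:C).
  by rewrite /expsum /= big_cons /= subrr mulr0 !mul0r add0r.
have hb : `|complex.Im e.2| * (hi - lo) < pi.
  by apply: le_lt_trans hLa; rewrite ler_wpM2r ?subr_ge0 // hs ?mem_head.
have [[ys [sys ny bys zys]] h2] := second_order_rolle (complex.Re e.2)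
  (is_derive_Re_expsum (e :: s)) (is_derive_Re_expsum (ediff 0 (e :: s))) hb sxs bxs zxs.
apply: h2; first by apply: leq_trans nxs; rewrite mulnS leq_addr.
move=> t tJ; rewrite -second_order_expsum -s2E.
apply: (IH s2 ys) => //.
- by rewrite !size_map.
- move=> f /mapP[g /mapP[h hs' ->] ->] /=.
  by apply: hs; rewrite in_cons hs' orbT.
- by move=> y yys; rewrite s2E second_order_expsum zys.
by rewrite ny; move: nxs; rewrite mulnS; case: (size xs) => [|[|k]] //=; rewrite add2n.
Qed.

(** Supplies zeros on an interval where the function is already known to vanish. *)
Definition grid (p w : R) (n : nat) : seq R := [seq p + w * (i%:R / n%:R) | i <- iota 0 n].

Lemma gridP (p w : R) n : 0 < w -> [/\ sorted <%R (grid p w n), size (grid p w n) = n &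
  forall y, y \in grid p w n -> p <= y <= p + w].
Proof.
move=> w0; rewrite /grid size_map size_iota; split=> //.
  case: n => [//|n]; apply: (homo_sorted (e := ltn)) (iota_ltn_sorted 0 n.+1) => i j ij.
  by rewrite ltrD2l ltr_pM2l // ltr_pM2r ?invr_gt0 ?ltr0n // ltr_nat.
move=> y /mapP[i + ->]; rewrite mem_iota add0n => /andP[_ iN].
have n0 : 0 < n%:R :> R by rewrite ltr0n (leq_trans _ iN).
rewrite lerDl lerD2l ler_piMr ?(ltW w0) // ?mulr_ge0 ?(ltW w0) ?divr_ge0 //.
by rewrite ler_pdivrMr // mul1r ler_nat ltnW.
Qed.

(** An elementary identity theorem: in a window of length 2 d, vanishing on one half provides enough
    zeros to force vanishing on the other, and steps of length d reach every point. *)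
Lemma many_zeros_everywhere (La d c : R) (N : nat) s xs : (size s <= N)%N ->
  (forall e, e \in s -> `|complex.Im e.2| <= La) -> 0 < d -> La * (2 * d) < pi -> 0 <= La ->
  sorted <%R xs -> (forall y, y \in xs -> c <= y <= c + d) ->
  (forall y, y \in xs -> complex.Re (expsum s y%:C) = 0) -> (2 * N <= size xs)%N ->
  forall t, complex.Re (expsum s t%:C) = 0.
Proof.
move=> sN hs d0 hLa La0 sxs bxs zxs nxs.
have base t : c <= t <= c + d -> complex.Re (expsum s t%:C) = 0.
  apply: (few_zeros_short sN hs _ _ sxs bxs zxs nxs).
    by apply: le_lt_trans hLa; apply: ler_wpM2l => //; lra.
  by lra.
have step p q : d <= q - p -> (forall t, p <= t <= q -> complex.Re (expsum s t%:C) = 0) ->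
    forall t, p - d <= t <= q + d -> complex.Re (expsum s t%:C) = 0.
  move=> pq h t /andP[t1 t2].
  have [t3|t3] := leP t p.
    have [g1 g2 g3] := gridP p (2 * N) d0.
    apply: (@few_zeros_short La (p - d) (p + d) N s (grid p d (2 * N))) => //.
    - by rewrite (_ : p + d - (p - d) = 2 * d) //; ring.
    - by lra.
    - by move=> y /g3 /andP[h1 h2]; apply/andP; split; lra.
    - by move=> y /g3 /andP[h1 h2]; apply: h; apply/andP; split; lra.
    - by rewrite g2.
    - by apply/andP; split; lra.
  have [t4|t4] := leP q t; last by apply: h; apply/andP; split; lra.
  have [g1 g2 g3] := gridP (q - d) (2 * N) d0.
  apply: (@few_zeros_short La (q - d) (q + d) N s (grid (q - d) d (2 * N))) => //.
  - by rewrite (_ : q + d - (q - d) = 2 * d) //; ring.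
  - by lra.
  - by move=> y /g3 /andP[h1 h2]; apply/andP; split; lra.
  - by move=> y /g3 /andP[h1 h2]; apply: h; apply/andP; split; lra.
  - by rewrite g2.
  - by apply/andP; split; lra.
have all (k : nat) t : c - k%:R * d <= t <= c + d + k%:R * d -> complex.Re (expsum s t%:C) = 0.
  elim: k t => [|k IH] t; first by rewrite mul0r subr0 addr0; exact: base.
  have kd : 0 <= k%:R * d by rewrite mulr_ge0 // ltW.
  have := step (c - k%:R * d) (c + d + k%:R * d) _ IH t.
  move=> h ht; apply: h; first by lra.
  by move: ht; rewrite -natr1 mulrDl mul1r => /andP[h1 h2]; apply/andP; split; lra.
move=> t; pose k := (Num.truncn (`|t - c| / d)).+1.
apply: (all k); have : `|t - c| <= k%:R * d.
  by rewrite -ler_pdivrMr // ltW // truncnS_gt.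
by rewrite ler_norml => /andP[h1 h2]; apply/andP; split; lra.
Qed.

(** Unless the function vanishes identically, any 2 N consecutive zeros span more than d, and
    disjoint blocks of zeros add up. *)
Lemma zero_list_bound (La d : R) (N : nat) s : (size s <= N)%N ->
  (forall e, e \in s -> `|complex.Im e.2| <= La) -> 0 < d -> La * (2 * d) < pi -> 0 <= La ->
  (0 < N)%N ->
  (forall t, complex.Re (expsum s t%:C) = 0) \/
  (forall (k : nat) xs (A B : R), A <= B -> sorted <%R xs ->
    (forall y, y \in xs -> A <= y <= B) ->
    (forall y, y \in xs -> complex.Re (expsum s y%:C) = 0) ->
    (2 * N * k <= size xs)%N -> k%:R * d <= B - A).
Proof.
move=> sN hs d0 hLa La0 N0.
have [h|h] := pselect (forall t, complex.Re (expsum s t%:C) = 0); [by left|right].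
elim=> [|k IH] xs A B AB sxs bxs zxs nxs; first by rewrite mul0r subr_ge0.
pose ys := take (2 * N) xs; pose zs := drop (2 * N) xs.
have cat_xs : ys ++ zs = xs by exact: cat_take_drop.
have ysz : size ys = (2 * N)%N.
  by rewrite size_take_min; apply/minn_idPl; apply: leq_trans nxs; rewrite mulnS leq_addr.
have ysxs y : y \in ys -> y \in xs by move=> yy; rewrite -cat_xs mem_cat yy.
have zsxs y : y \in zs -> y \in xs by move=> yy; rewrite -cat_xs mem_cat yy orbT.
have [z zy hz] : exists2 z, z \in ys & forall y, y \in ys -> y <= z.
  by apply: ex_max_seq; rewrite -size_eq0 ysz -lt0n muln_gt0 N0.
have := sxs; rewrite -cat_xs sorted_pairwise; last exact: lt_trans.
rewrite pairwise_cat => /and3P[/allrelP hrel pys pzs].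
have zAB := bxs z (ysxs z zy).
have dz : A + d < z.
  rewrite ltNge; apply/negP => zA; apply: h.
  apply: (@many_zeros_everywhere La d A N s ys) => //.
  - by rewrite sorted_pairwise //; exact: lt_trans.
  - move=> y yy; have /andP[-> _] := bxs y (ysxs y yy).
    by rewrite (le_trans (hz y yy)).
  - by move=> y yy; apply: zxs; exact: ysxs.
  - by rewrite ysz.
have hzz : k%:R * d <= B - z.
  apply: (IH zs) => //.
  - by case/andP: zAB.
  - by rewrite sorted_pairwise //; exact: lt_trans.
  - move=> y yz; have /andP[_ ->] := bxs y (zsxs y yz).
    by rewrite ltW // hrel.
  - by move=> y yy; apply: zxs; exact: zsxs.
  by rewrite size_drop leq_subRL ?(leq_trans _ nxs) // ?mulnS ?leq_addr // -mulnS.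
by rewrite -natr1 mulrDl mul1r; lra.
Qed.

End RolleZeros.

(** Without an upper bound the maximum need not exist and [nat_max] would take its default value 0;
    this is why the numbers of solutions have to be bounded at all. *)
Lemma nat_maxP (S : set nat) n b : S n -> (forall k, S k -> (k <= b)%N) -> (n <= nat_max S)%N.
Proof.
move=> Sn hb.
have ex : exists k, `[< S k >] by exists n; exact/asboolP.
have ub k : `[< S k >] -> (k <= b)%N by move=> /asboolP; exact: hb.
have [k /asboolP Sk kmax] := ex_maxnP ex ub.
have [] := @xgetPex _ 0%N [set n | S n /\ forall k, S k -> (k <= n)%N].
  by exists k; split=> // j Sj; apply: kmax; exact/asboolP.
by move=> _; exact.
Qed.

Lemma nat_minP (S : set nat) n : S n -> (nat_min S <= n)%N.
Proof.
move=> Sn.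
have ex : exists k, `[< S k >] by exists n; exact/asboolP.
have [k /asboolP Sk kmin] := ex_minnP ex.
have [] := @xgetPex _ 0%N [set n | S n /\ forall k, S k -> (n <= k)%N].
  by exists k; split=> // j Sj; apply: kmin; exact/asboolP.
by move=> _; exact.
Qed.

(** * The number of solutions of |p| = rho on an interval *)

Section SolutionCount.
Context {R : realType}.
Implicit Types (t l rho : R) (xs : seq R) (S I : set R).

Lemma size_le_card S n xs : (S #= `I_n)%card -> uniq xs -> (forall y, y \in xs -> S y) ->
  (size xs <= n)%N.
Proof.
move=> Sn uxs hxs; rewrite -(card_fset_set Sn); apply: uniq_leq_size => // y /hxs Sy.
have fS : finite_set S by apply/finite_setP; exists n.
by have := in_fset_set fS y; rewrite mem_set // => ->.
Qed.

Lemma sort_fset (X : {fset R}) :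
  exists xs, [/\ sorted <%R xs, size xs = size (enum_fset X) & xs =i X].
Proof.
exists (sort <=%R (enum_fset X)); split.
- by rewrite sort_lt_sorted fset_uniq.
- by rewrite size_sort.
- by move=> y; rewrite mem_sort.
Qed.

Lemma interval_length_ge l I x y : interval_of_length l I -> I x -> I y -> y - x <= l.
Proof.
move=> [iI mI] Ix Iy; have [yx|xy] := leP y x.
  have : (0 <= l%:E)%E by rewrite -mI measure_ge0.
  by rewrite lee_fin; lra.
rewrite -lee_fin -mI.
have -> : (y - x)%:E = lebesgue_measure [set` `[x, y]].
  by rewrite lebesgue_measure_itv /= lte_fin xy EFinB.
apply: le_measure; rewrite ?inE.
- exact: measurable_itv.
- by move/is_intervalP: iI => ->; exact: measurable_itv.
by move=> z; rewrite /= in_itv /= => hz; exact: (iI x y).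
Qed.

Variables (m : nat) (c lam : 'I_m.+1 -> R[i]).

Definition terms : seq (R[i] * R[i]) := [seq (c k, lam k) | k <- enum 'I_m.+1].

Lemma exp_polyE t : exp_poly c lam t = expsum terms t%:C.
Proof. by rewrite /expsum /terms big_map big_enum. Qed.

(** The head is the constant [- rho ^ 2], with exponent 0; the tail expands p times its conjugate,
    which at most doubles the frequencies. *)
Definition sq_terms rho : seq (R[i] * R[i]) :=
  (- (rho ^+ 2)%:C, 0) ::
  [seq (c kl.1 * cj (c kl.2), lam kl.1 + cj (lam kl.2)) | kl <- enum {: 'I_m.+1 * 'I_m.+1}].

Lemma Re_sq_terms rho t :
  complex.Re (expsum (sq_terms rho) t%:C) = abs_exp_poly c lam t ^+ 2 - rho ^+ 2.
Proof.
rewrite /expsum big_cons /= mul0r cexp0 mulr1 big_map big_enum /=.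
have -> : \sum_(i : 'I_m.+1 * 'I_m.+1)
    c i.1 * cj (c i.2) * cexp ((lam i.1 + cj (lam i.2)) * t%:C) =
    exp_poly c lam t * cj (exp_poly c lam t).
  rewrite /exp_poly cj_sum big_distrlr /= pair_big /=.
  apply: eq_bigr => -[k l] _ /=; rewrite mulrDl cexpD cjM -cexp_cj cjM cj_real; ring.
rewrite cReD cReN /= addrC /abs_exp_poly sqr_nc; congr (_ - _).
by case: (exp_poly c lam t) => a b /=; ring.
Qed.

Lemma size_sq_terms rho : size (sq_terms rho) = (m.+1 * m.+1).+1.
Proof. by rewrite /= size_map -cardE card_prod card_ord. Qed.

Lemma max_freq_ge0 : 0 <= max_freq lam.
Proof. exact: bigmax_ge_id. Qed.

Lemma Im_sq_terms rho e : e \in sq_terms rho -> `|complex.Im e.2| <= 2 * max_freq lam.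
Proof.
rewrite in_cons => /predU1P[->|/mapP[[k l] _ ->]] /=.
  by rewrite normr0 mulr_ge0 ?max_freq_ge0.
have hk j : `|complex.Im (lam j)| <= max_freq lam by exact: (le_bigmax _ (fun j => `|complex.Im (lam j)|)).
rewrite cImD (le_trans (ler_normD _ _)) // mulr_natl mulr2n lerD //.
by case: (lam l) (hk l) => a b /=; rewrite normrN.
Qed.

End SolutionCount.

Section SolutionBound.
Context {R : realType}.
Implicit Types (t l rho : R) (xs : seq R) (S I : set R).

(** Blocks of twice the number of terms of [sq_terms], times one more than the number of windows of
    length [1 / (4 * F + 1)] that fit into l; this length is small enough for frequencies up to
    [2 * F]. *)
Definition solution_bound (m : nat) (F l : R) : nat :=
  (2 * (m.+1 * m.+1).+1 * (Num.truncn (l * (4 * F + 1))).+1)%N.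

Lemma solutions_bounded m (c lam : 'I_m.+1 -> R[i]) rho I l xs : 0 <= rho ->
  interval_of_length l I -> (exists t, abs_exp_poly c lam t != rho) -> sorted <%R xs ->
  (forall y, y \in xs -> I y /\ abs_exp_poly c lam y = rho) ->
  (size xs < solution_bound m (max_freq lam) l)%N.
Proof.
move=> rho0 hI [t0 ht0] sxs hxs; rewrite ltnNge; apply/negP => big.
set F := max_freq lam in big *; have F0 : 0 <= F by exact: max_freq_ge0.
have D0 : 0 < 4 * F + 1 by lra.
have d0 : 0 < (4 * F + 1)^-1 by rewrite invr_gt0.
have small : 2 * F * (2 * (4 * F + 1)^-1) < pi.
  apply: lt_le_trans (pi_ge2 R).
  by rewrite mulrA ltr_pdivrMr //; lra.
set N := (m.+1 * m.+1).+1 in big.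
have [|h] := zero_list_bound (eq_leq (size_sq_terms c lam rho)) (@Im_sq_terms _ _ c lam rho)
  d0 small (mulr_ge0 (ler0n _ 2) F0) (ltn0Sn _).
  move=> /(_ t0) /eqP; rewrite Re_sq_terms subr_eq0 eqrXn2 ?nc_ge0 // => /eqP h.
  by rewrite h eqxx in ht0.
case: xs sxs hxs big => [//|x xs] sxs hxs big.
have [z zxs hz] : exists2 z, z \in x :: xs & forall y, y \in x :: xs -> y <= z by exact: ex_max_seq.
have hx y : y \in x :: xs -> x <= y.
  rewrite in_cons => /predU1P[->//|yxs].
  by have /allP /(_ y yxs) /ltW := order_path_min lt_trans sxs.
have [Ix _] := hxs x (mem_head _ _); have [Iz _] := hxs z zxs.
have zl := interval_length_ge hI Ix Iz.
have := h (Num.truncn (l * (4 * F + 1))).+1 (x :: xs) x z (hx z zxs) sxs.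
move=> /(_ _ _ big) hh.
have : (Num.truncn (l * (4 * F + 1))).+1%:R * (4 * F + 1)^-1 <= z - x.
  apply: hh => y yxs; first by rewrite hx ?hz.
  by rewrite Re_sq_terms (hxs y yxs).2 subrr.
rewrite leNgt => /negP; apply; apply: le_lt_trans zl _.
by rewrite -ltr_pdivrMr ?invr_gt0 // invrK truncnS_gt.
Qed.

Lemma solution_count_bound (D : diagram) n : 0 <= diag_length D -> solution_count D n ->
  (n <= solution_bound (diag_degree D) (diag_freq D) (diag_length D))%N.
Proof.
case: D => m F l /= l0 [c [lam [rho [I [/= <- hI Sn]]]]].
have [XR [sxs szX hX]] := sort_fset (fset_set [set t | I t /\ abs_exp_poly c lam t = rho]).
rewrite (card_fset_set Sn) in szX.
have fS : finite_set [set t | I t /\ abs_exp_poly c lam t = rho] by apply/finite_setP; exists n.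
have hS y : y \in XR -> I y /\ abs_exp_poly c lam y = rho.
  by rewrite hX in_fset_set //; move/set_mem.
have [n1|n1] := leqP n 1; first by rewrite (leq_trans n1) // /solution_bound muln_gt0.
have [x [y [xX yX xy]]] : exists x y, [/\ x \in XR, y \in XR & x < y].
  case: (XR) sxs szX => [|x [|y s]] /=; [by move=> _ h; rewrite -h in n1..|].
  by move=> /andP[xy _] _; exists x, y; rewrite !in_cons !eqxx orbT.
have rho0 : 0 <= rho by have [_ <-] := hS x xX; exact: nc_ge0.
have [[t ht]|const] := pselect (exists t, abs_exp_poly c lam t != rho).
  by rewrite -szX ltnW //; exact: (solutions_bounded rho0 hI (ex_intro _ t ht) sxs hS).
(* If |p| is constantly rho, the whole segment between two solutions consists of solutions, and n +
   1 points of it contradict the count n. *)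
have yx : 0 < y - x by rewrite subr_gt0.
have [g1 g2 g3] := gridP x n.+1 yx.
have : (n.+1 <= n)%N; last by rewrite ltnn.
rewrite -{1}g2; apply: (size_le_card Sn); first exact: lt_sorted_uniq.
move=> z /g3; rewrite addrC subrK => hz; split.
  by case: hI => iI _; apply: (iI x y) => //; [have [] := hS x xX|have [] := hS y yX].
by apply/eqP; apply: contrapT => /negP h; apply: const; exists z.
Qed.

(** The solution set is first shown to be finite, since [solution_count] records finite sets
    only. *)
Lemma solutions_le_max m (c lam : 'I_m.+1 -> R[i]) rho B xs : 0 <= rho ->
  interval_of_length (interval_length B) B -> 0 <= interval_length B ->
  (exists t, abs_exp_poly c lam t != rho) -> uniq xs ->
  (forall y, y \in xs -> B y /\ abs_exp_poly c lam y = rho) ->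
  (size xs <= max_solutions (diagram_of lam B))%N.
Proof.
move=> rho0 hB l0 ht uxs hxs.
set S := [set t | B t /\ abs_exp_poly c lam t = rho].
have fS : finite_set S.
  apply: contrapT => iS.
  have [X XS] := infinite_set_fset (solution_bound m (max_freq lam) (interval_length B)) iS.
  have [ys [sys <- hys]] := sort_fset X; apply/negP; rewrite -ltnNge.
  by apply: (solutions_bounded rho0 hB ht sys) => y; rewrite hys => /XS.
have /finite_setP[n Sn] := fS.
apply: leq_trans (size_le_card Sn uxs hxs) _.
apply: (@nat_maxP _ _ (solution_bound m (max_freq lam) (interval_length B))).
  by exists c, lam, rho, B.
by move=> k; exact: solution_count_bound.
Qed.

End SolutionBound.

(** * Covering numbers *)

Section Covering.
Context {R : realType}.
Implicit Types (a b eps : R) (xs : seq R) (Z Omega B : set R) (ps : seq (R * R)).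

Lemma closed_has_min Z a : closed Z -> (forall t, Z t -> a <= t) -> Z !=set0 ->
  exists2 x, Z x & forall y, Z y -> x <= y.
Proof.
move=> cZ lbZ [z Zz].
pose W := -%R @^-1` Z.
have cW : closed W by apply: preimage_closed => // t _; exact: opp_continuous.
have W0 : W !=set0 by exists (- z); rewrite /W /= opprK.
have ubW : has_ubound W by exists (- a) => t /lbZ; rewrite lerNr.
have := closure_sup W0 ubW; rewrite -(closure_id _).1 // => Ws.
exists (- sup W) => // y Zy; rewrite lerNl; apply: ub_le_sup => //.
by rewrite /W /= opprK.
Qed.

(** The leftmost uncovered point, which exists because Z is closed, starts the next interval; the
    induction is on the number of lengths eps that exhaust b - a. *)
Lemma greedy_cover Z a b eps : closed Z -> 0 < eps -> (forall t, Z t -> a <= t <= b) ->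
  exists xs, [/\ pairwise (fun x y => x + eps <= y) xs, (forall x, x \in xs -> Z x) &
    forall t, Z t -> exists2 x, x \in xs & x <= t < x + eps].
Proof.
move=> + e0; have [n] : exists n : nat, b - a < n%:R * eps.
  by exists (Num.truncn ((b - a) / eps)).+1; rewrite -ltr_pdivrMr // truncnS_gt.
elim: n Z a => [|n IH] Z a hn cZ hZ.
  exists [::]; split=> // t /hZ /andP[h1 h2].
  by move: hn; rewrite mul0r subr_lt0 ltNge (le_trans h1).
have [Z0|/set0P Z0] := eqVneq Z set0; first by exists [::]; split=> // t; rewrite Z0.
have [x0 Zx0 hx0] := closed_has_min cZ (fun t Zt => proj1 (andP (hZ t Zt))) Z0.
have ax0 : a <= x0 by have /andP[] := hZ x0 Zx0.
have [||t [Zt ht]|xs [pxs Zxs cxs]] := IH (Z `&` [set t | x0 + eps <= t]) (x0 + eps).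
- by move: hn; rewrite -natr1 mulrDl mul1r; lra.
- by apply: closedI => //; exact: closed_ge.
- by rewrite ht; have /andP[] := hZ t Zt.
exists (x0 :: xs); split.
- by rewrite /= pxs andbT; apply/allP => x /Zxs[].
- by move=> x; rewrite in_cons => /predU1P[->|/Zxs[]].
move=> t Zt; have [t1|t1] := ltP t (x0 + eps).
  by exists x0; rewrite ?mem_head // hx0.
have [x xxs hx] := cxs t (conj Zt t1).
by exists x => //; rewrite in_cons xxs orbT.
Qed.

Lemma covering_number_le eps Omega xs : 0 < eps ->
  (forall t, Omega t -> exists2 x, x \in xs & x <= t < x + eps) ->
  (covering_number eps Omega <= size xs)%N.
Proof.
move=> e0 h; apply: nat_minP; exists (fun i => [set` `[nth 0 xs i, nth 0 xs i + eps[]); split.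
  move=> i; split; first exact: interval_is_interval.
  by rewrite lebesgue_measure_itv /= lte_fin ltrDl e0 -EFinB addrC addKr.
move=> t /h[x xxs hx]; have ix : (index x xs < size xs)%N by rewrite index_mem.
by exists (Ordinal ix) => //=; rewrite in_itv /= nth_index.
Qed.

Lemma consecutive_pairs eps xs : 0 < eps -> pairwise (fun x y => x + eps <= y) xs ->
  exists ps, [/\ size ps = (size xs).-1, pairwise (fun p q => p.2 <= q.1) ps &
    forall p, p \in ps -> [/\ p.1 + eps <= p.2, p.1 \in xs & p.2 \in xs]].
Proof.
move=> e0; elim: xs => [|x [|y xs] IH]; [by exists [::]..|].
move=> /andP[/allP hx pys]; have [ps [sps pps hps]] := IH pys.
have [/allP hy _] := andP pys.
exists ((x, y) :: ps); split; first by rewrite /= sps.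
- rewrite /= pps andbT; apply/allP => p pps' /=.
  have [_ + _] := hps p pps'; rewrite in_cons => /predU1P[->//|/hy].
  by apply: le_trans; rewrite lerDl ltW.
- move=> p; rewrite in_cons => /predU1P[->|/hps[h1 h2 h3]] /=.
    by rewrite !in_cons !eqxx orbT; split=> //; apply: hx; rewrite mem_head.
  by split=> //; rewrite in_cons ?h2 ?h3 orbT.
Qed.

(** The level lies strictly above rho because F may equal rho at the ends of the intervals, and it
    is common to all of them because solutions are counted for one level at a time. *)
Lemma common_level (F : R -> R) (rho : R) ps :
  (forall p, p \in ps -> exists2 z, p.1 < z < p.2 & rho < F z) ->
  exists2 rho', rho < rho' &
    forall p, p \in ps -> exists2 z, p.1 < z < p.2 & rho' < F z.
Proof.
elim: ps => [|p ps IH] h; first by exists (rho + 1) => //; rewrite ltrDl.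
have [q qps|r1 hr1 h1] := IH; first by apply: h; rewrite in_cons qps orbT.
have [z hz Fz] := h p (mem_head _ _).
have hm : rho < (rho + F z) / 2 by lra.
exists (Num.min r1 ((rho + F z) / 2)); first by rewrite lt_min hr1 hm.
move=> q; rewrite in_cons => /predU1P[->|/h1[w hw Fw]].
  by exists z => //; rewrite gt_min; apply/orP; right; lra.
by exists w => //; rewrite gt_min Fw.
Qed.

Lemma strict_ivt (F : R -> R) (u v rho : R) : continuous F -> u < v ->
  (F u < rho < F v) || (F v < rho < F u) -> exists2 t, u < t < v & F t = rho.
Proof.
move=> cF uv huv; have [| |t] := @IVT R F u v rho (ltW uv).
- exact: continuous_subspaceT.
- by case/orP: huv => /andP[h1 h2]; rewrite ge_min le_max (ltW h1) (ltW h2) ?orbT.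
rewrite in_itv /= => /andP[ut tv] Ft; exists t => //.
rewrite !lt_neqAle ut tv !andbT; apply/andP; split; apply: contraTneq huv => e.
  by rewrite e Ft ltxx /= andbF.
by rewrite -e Ft ltxx /= andbF.
Qed.

Lemma two_crossings (F : R -> R) (rho : R) ps : continuous F ->
  pairwise (fun p q => p.2 <= q.1) ps ->
  (forall p, p \in ps -> F p.1 < rho /\ F p.2 < rho) ->
  (forall p, p \in ps -> exists2 z, p.1 < z < p.2 & rho < F z) ->
  exists xs, [/\ sorted <%R xs, size xs = (2 * size ps)%N &
    forall x, x \in xs -> F x = rho /\ exists2 p, p \in ps & p.1 < x < p.2].
Proof.
move=> cF; elim: ps => [|p ps IH]; first by exists [::].
move=> /andP[/allP hp pps] hle hex.
have [q qps|q qps|xs [sxs nxs hxs]] := IH pps.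
- by apply: hle; rewrite in_cons qps orbT.
- by apply: hex; rewrite in_cons qps orbT.
have [F1 F2] := hle p (mem_head _ _).
have [z /andP[z1 z2] Fz] := hex p (mem_head _ _).
have [c1 /andP[l1 r1] Fc1] : exists2 t, p.1 < t < z & F t = rho.
  by apply: strict_ivt => //; rewrite F1 Fz.
have [c2 /andP[l2 r2] Fc2] : exists2 t, z < t < p.2 & F t = rho.
  by apply: strict_ivt => //; rewrite F2 Fz orbT.
have c12 := lt_trans r1 l2.
exists [:: c1, c2 & xs]; split.
- rewrite /= c12 /= path_sortedE; last exact: lt_trans.
  rewrite sxs andbT; apply/allP => x /hxs[_ [q qps /andP[qx _]]].
  by apply: lt_trans r2 _; apply: le_lt_trans qx; exact: hp.
- by rewrite /= nxs mulnS.
- move=> x; rewrite !in_cons => /or3P[/eqP->|/eqP->|/hxs[Fx [q qps hq]]]; split=> //.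
  + by exists p; rewrite ?mem_head // l1 (lt_trans c12).
  + by exists p; rewrite ?mem_head // r2 (lt_trans l1).
  + by exists q => //; rewrite in_cons qps orbT.
Qed.

Section Polynomial.
Variables (m : nat) (c lam : 'I_m.+1 -> R[i]).

Lemma continuous_abs_exp_poly : continuous (abs_exp_poly c lam).
Proof.
have -> : abs_exp_poly c lam =
    (fun t => Num.sqrt (complex.Re (expsum (sq_terms c lam 0) t%:C))).
  by apply/funext => t; rewrite Re_sq_terms expr0n subr0 sqrtr_sqr ger0_norm ?nc_ge0.
move=> t; apply: continuous_comp; last exact: sqrt_continuous.
by apply: derive_continuous => s; exact: is_derive_Re_expsum.
Qed.

(* Each bad interval crosses a common level [rho' > rho] twice, so that at most
   [max_solutions./2] of them exist. *)
Lemma sublevel_intervals a b B Omega eps rho : 0 < eps ->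
  (forall t, Omega t -> a <= t <= b /\ abs_exp_poly c lam t <= rho) ->
  (forall t, a < t < b -> B t) -> interval_of_length (interval_length B) B ->
  0 <= interval_length B ->
  exists E : seq (R * R), [/\ (forall p, p \in E -> [/\ a <= p.1, p.1 <= p.2 & p.2 <= b]),
    pairwise (fun p q => p.2 <= q.1) E, \sum_(p <- E) (p.2 - p.1) = (size E)%:R * eps,
    (forall p t, p \in E -> p.1 <= t <= p.2 -> abs_exp_poly c lam t <= rho) &
    (covering_number eps Omega <= size E + frequency_bound (diagram_of lam B))%N].
Proof.
move=> e0 hO hB iB l0; set F := abs_exp_poly c lam; have cF : continuous F by exact: continuous_abs_exp_poly.
(* The sublevel set is covered instead of Omega: it is closed, and |p| <= rho at the left end of
   every interval. *)
pose Z := F @^-1` [set x | x <= rho] `&` ([set t | a <= t] `&` [set t | t <= b]).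
have cZ : closed Z.
  apply: closedI; last by apply: closedI; [exact: closed_ge|exact: closed_le].
  by apply: preimage_closed; [move=> t _; exact: cF|exact: closed_le].
have [t [_ [h1 h2]]|xs [pxs Zxs cxs]] := greedy_cover (a := a) (b := b) cZ e0.
  exact/andP.
have [ps [sps pps hps]] := consecutive_pairs e0 pxs.
(* In a bad pair |p| exceeds rho within eps to the right of [p.1]; as [p.2] is again in the sublevel
   set, |p| comes down before it. *)
pose bad (p : R * R) := `[< exists2 z, p.1 < z <= p.1 + eps & rho < F z >].
pose bads := seq.filter bad ps; pose goods := seq.filter (predC bad) ps.
have cov : (covering_number eps Omega <= size xs)%N.
  apply: covering_number_le => // t /hO[/andP[t1 t2] t3]; apply: cxs; split=> //.
have nbads : (2 * size bads <= max_solutions (diagram_of lam B))%N.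
  case bE : bads => [//|p0 bs]; rewrite -bE.
  have p0b : p0 \in bads by rewrite bE mem_head.
  have hbad p : p \in bads -> [/\ F p.1 <= rho, F p.2 <= rho, a <= p.1, p.2 <= b &
      exists2 z, p.1 < z < p.2 & rho < F z].
    rewrite mem_filter => /andP[/asboolP[z /andP[z1 z2] Fz] /hps[h1 /Zxs[/= F1 [h3 h4]] /Zxs[/= F2 [h5 h6]]]].
    split=> //; exists z => //; rewrite z1 lt_neqAle (le_trans z2 h1) andbT.
    by apply: contraTneq Fz => ->; rewrite -leNgt.
  have [p /hbad[]//|rho' rr' hz] := @common_level F rho bads.
  have [|p /hbad[F1 F2 _ _ _]|ys [sys <- hys]] := two_crossings (rho := rho') cF _ _ hz.
  - exact: subseq_pairwise (filter_subseq _ _) pps.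
  - by split; [exact: le_lt_trans F1 rr'|exact: le_lt_trans F2 rr'].
  have [F0 _ _ _ _] := hbad p0 p0b.
  apply: (@solutions_le_max _ _ c lam rho') => //.
  - by apply: le_trans (ltW rr'); apply: le_trans F0; exact: nc_ge0.
  - by exists p0.1; rewrite lt_eqF // (le_lt_trans F0).
  - exact: lt_sorted_uniq.
  - move=> y /hys[Fy [p /hbad[_ _ h1 h2 _] /andP[h3 h4]]]; split=> //.
    by apply: hB; rewrite (le_lt_trans h1 h3) (lt_le_trans h4 h2).
exists [seq (p.1, p.1 + eps) | p <- goods]; split.
- move=> q /mapP[p + ->] /=; rewrite mem_filter => /andP[_ /hps[h1 /Zxs[_ [h3 _]] /Zxs[_ [_ h6]]]].
  by split=> //; [rewrite lerDl ltW|exact: le_trans h1 h6].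
- rewrite pairwise_map; apply: (sub_in_pairwise (P := mem ps)) (subseq_pairwise (filter_subseq _ _) pps).
    by move=> p q pps' _ /= pq; apply: le_trans pq; have [] := hps p pps'.
  by apply/allP => p; rewrite mem_filter => /andP[].
- rewrite size_map big_map /= (eq_bigr (fun=> eps)); last by move=> p _; rewrite addrAC subrr add0r.
  by rewrite big_const_seq count_predT iter_addr_0 mulr_natl.
- move=> q t /mapP[p + ->] /= /andP[t1 t2]; rewrite mem_filter => /andP[/= nb /hps[_ /Zxs[/= F1 _] _]].
  move: t1; rewrite le_eqVlt => /predU1P[<- //|t1].
  rewrite leNgt; apply: contra nb => Ft; apply/asboolP; exists t => //.
  exact/andP.
(* The last point of [xs] has no successor and is lost, which accounts for the 1 in the frequency
   bound; the half of [max_solutions] accounts for the bad pairs. *)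
rewrite size_map; apply: leq_trans cov _; rewrite /frequency_bound addnS.
have : (size xs <= (size ps).+1)%N by rewrite sps; case: (size xs).
move/leq_trans; apply; rewrite ltnS.
rewrite -(count_predC bad ps) -!size_filter addnC leq_add2l.
by rewrite geq_half_double -mul2n.
Qed.

End Polynomial.
End Covering.

(** * Passage from the metric span to a union of intervals *)

Section IntervalHull.
Context {R : realType}.
Implicit Types B : set R.

Lemma bounded_set_has_bounds B : bounded_set B -> has_lbound B /\ has_ubound B.
Proof.
move=> [M [_ hM]]; have h t : B t -> `|t| <= M + 1 by move=> Bt; apply: hM => //; rewrite ltrDl.
split; [exists (- (M + 1))|exists (M + 1)] => t /h; rewrite ler_norml => /andP[]; lra.
Qed.

Lemma interval_hull B : is_interval B -> bounded_set B -> B !=set0 ->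
  [/\ forall t, B t -> inf B <= t <= sup B, forall t, inf B < t < sup B -> B t &
      lebesgue_measure B = (sup B - inf B)%:E].
Proof.
move=> iB /bounded_set_has_bounds[lB uB] nB.
have sB t : B t -> inf B <= t <= sup B by move=> Bt; rewrite ge_inf //= ub_le_sup.
have hB t : inf B < t < sup B -> B t.
  move=> ht; apply: interior_subset.
  by rewrite interval_bounded_interior.
split=> //.
have ab : inf B <= sup B by have [t /sB /andP[h1 h2]] := nB; exact: le_trans h1 h2.
have mB : measurable B by move/is_intervalP: iB => ->; exact: measurable_itv.
have mo : lebesgue_measure [set` `]inf B, sup B[] = (sup B - inf B)%:E.
  rewrite lebesgue_measure_itv /= lte_fin; case: ltP => // h.
  by rewrite (@le_anti _ _ (inf B) (sup B)) ?ab ?h // subrr.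
have mc : lebesgue_measure [set` `[inf B, sup B]] = (sup B - inf B)%:E.
  rewrite lebesgue_measure_itv /= lte_fin; case: ltP => // h.
  by rewrite (@le_anti _ _ (inf B) (sup B)) ?ab ?h // subrr.
apply/eqP; rewrite eq_le -{1}mc -mo; apply/andP; split; apply: le_measure;
  by rewrite ?mem_set //; exact: measurable_itv.
Qed.

End IntervalHull.

Theorem theorem1p2 (R : realType) :
  exists2 C : R, 0 < C &
    forall (m : nat) (c lam : 'I_m.+1 -> R[i]) (B Omega : set R),
      is_interval B -> bounded_set B -> Omega `<=` B ->
      0 < metric_span (diagram_of lam B) Omega ->
      sup_abs c lam B <=
        expR (interval_length B * max_abs_Re lam)
        * (C * interval_length B / metric_span (diagram_of lam B) Omega) ^+ m
        * sup_abs c lam Omega.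
Proof.
(* One factor 2 comes from [interval_turan], the other from an eps that is only known to reach
   [w / 2]. *)
exists (4 * turan_const); first by rewrite mulr_gt0 ?turan_const_gt0 ?ltr0n.
move=> m c lam B Omega iB bB OB; set w := metric_span _ _ => w0.
set D := diagram_of lam B.
have [eps e0 we] : exists2 eps, 0 < eps &
    w / 2 < eps * ((covering_number eps Omega)%:R - (frequency_bound D)%:R).
  (* A supremum that does not exist has the default value 0, contrary to [w0]. *)
  have [hs|/sup_out h] := pselect (has_sup [set eps * ((covering_number eps Omega)%:R -
      (frequency_bound D)%:R) | eps in [set eps : R | 0 < eps]]); last first.
    by move: w0; rewrite /w /metric_span h ltxx.
  have w2 : 0 < w / 2 by rewrite divr_gt0.
  have [_ [eps e0 <-]] := sup_adherent w2 hs; rewrite -/(metric_span D Omega) -/w => h.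
  by exists eps => //; lra.
(* An empty Omega has covering number 0, which contradicts the choice of eps. *)
have [W0|/set0P W0] := eqVneq Omega set0.
  have := covering_number_le (Omega := Omega) (xs := [::]) e0.
  rewrite W0 leqn0 => /(_ _) /eqP h.
  have : w / 2 < 0.
    apply: lt_le_trans we _; rewrite W0 h // sub0r mulrN oppr_le0.
    by rewrite mulr_ge0 ?ler0n // ltW.
  by rewrite ltNge divr_ge0 ?(ltW w0) ?ler0n.
have nB : B !=set0 by have [t /OB Bt] := W0; exists t.
have [sB hB mB] := interval_hull iB bB nB.
have lE : interval_length B = sup B - inf B by rewrite /interval_length mB.
have cF : continuous (abs_exp_poly c lam) by exact: continuous_abs_exp_poly.
have ab : inf B <= sup B by have [t /sB /andP[h1 h2]] := nB; exact: le_trans h1 h2.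
have [tmax _ htmax] := EVT_max ab (continuous_subspaceT cF).
have ubF (A : set R) t : A `<=` B -> A t -> abs_exp_poly c lam t <= sup_abs c lam A.
  move=> AB At; apply: ub_le_sup; last by exists t.
  exists (abs_exp_poly c lam tmax) => _ [u Au <-]; apply: htmax.
  by rewrite in_itv /= sB //; exact: AB.
have rho0 : 0 <= sup_abs c lam Omega.
  by have [t Ot] := W0; apply: le_trans (ubF _ t OB Ot); exact: nc_ge0.
have l0 : 0 <= interval_length B by rewrite lE subr_ge0.
have hO t : Omega t -> inf B <= t <= sup B /\ abs_exp_poly c lam t <= sup_abs c lam Omega.
  by move=> Ot; split; [exact/sB/OB|exact: ubF].
have lB : interval_of_length (interval_length B) B by split=> //; rewrite lE.
have [E [hE pE sE FE cov]] := sublevel_intervals e0 hO hB lB l0.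
have L0 : w / 2 < (size E)%:R * eps.
  apply: lt_le_trans we _; rewrite mulrC ler_pM2r // lerBlDr -natrD ler_nat.
  exact: cov.
have Lpos : 0 < (size E)%:R * eps by apply: lt_trans L0; rewrite divr_gt0.
have ltab : inf B < sup B.
  rewrite ltNge; apply/negP => ba; move: Lpos; rewrite -sE ltNge => /negP; apply.
  rewrite big_seq; apply: sumr_le0 => p /hE[h1 h2 h3].
  by rewrite subr_le0 (le_trans h3) // (le_trans ba).
apply: ge_sup; first by have [t Bt] := nB; exists (abs_exp_poly c lam t), t.
move=> _ [t0 Bt0 <-].
have xi0 : 0 <= max_abs_Re lam by exact: bigmax_ge_id.
have := @interval_turan R (terms c lam) E m (inf B) (sup B) t0 (max_abs_Re lam)
  ((size E)%:R * eps) (sup_abs c lam Omega).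
move=> /(_ _ ltab (sB t0 Bt0) xi0 _ hE pE sE Lpos _).
rewrite -exp_polyE lE => h; apply: le_trans (h _ _ _) _ => {h}.
- by rewrite size_map size_enum_ord.
- move=> e /mapP[k _ ->] /=.
  exact: (le_bigmax _ (fun k => `|complex.Re (lam k)|)).
- by move=> p t pE' /(FE p t pE'); rewrite /abs_exp_poly exp_polyE.
have d0 : 0 < sup B - inf B by rewrite subr_gt0.
have key (K : R) : 0 < K -> 0 <= 2 * K * (sup B - inf B) / ((size E)%:R * eps) <=
    4 * K * (sup B - inf B) / w.
  move=> K0; set L := _ * eps in L0 Lpos *; have Kd : 0 < K * (sup B - inf B) by exact: mulr_gt0.
  apply/andP; split; first by rewrite divr_ge0 ?(ltW Lpos) // -mulrA mulr_ge0 ?(ltW Kd) ?ler0n.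
  have wL : w <= 2 * L by lra.
  have h := ler_wpM2l (ltW Kd) wL.
  rewrite ler_pdivlMr // mulrAC ler_pdivrMr //.
  have -> : 2 * K * (sup B - inf B) * w = 2 * (K * (sup B - inf B) * w) by ring.
  have -> : 4 * K * (sup B - inf B) * L = 2 * (K * (sup B - inf B) * (2 * L)) by ring.
  by rewrite ler_pM2l.
have /andP[k1 k2] := key _ (@turan_const_gt0 R).
apply: ler_wpM2r rho0 _ _ _; apply: ler_wpM2l (expR_ge0 _) _ _ _.
by apply: lerXn2r (k2); rewrite nnegrE; [exact: k1|exact: le_trans k1 k2].
Qed.
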